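(* Let $\alpha \in \mathbb{R}^2$ be an irrational vector and let $S$ be a convex polygon in $\mathbb{R}^2$. Then $S$ is a bounded remainder set (with respect to $\alpha$) if and only if it is centrally symmetric, and for each pair of parallel edges $e$ and $e'$ of $S$ the following two conditions are satisfied: (i) there are two points, one on the edge $e$ and the other on the edge $e'$, which differ by a vector in $\mathbb{Z}\alpha+\mathbb{Z}^2$; (ii) if the midpoints of the edges $e$ and $e'$ do not differ by a vector in $\mathbb{Z}\alpha+\mathbb{Z}^2$, then the vectors $e, e'$ themselves belong to $\mathbb{Z}\alpha+\mathbb{Z}^2$.
   Context: A vector $\alpha = (\alpha_1,\alpha_2) \in \mathbb{R}^2$ is called irrational if $1, \alpha_1, \alpha_2$ are linearly independent over $\mathbb{Q}$. We write $\mathbb{Z}\alpha+\mathbb{Z}^2 = \{ n\alpha + m : n \in \mathbb{Z}, m \in \mathbb{Z}^2\}$ and $\mathbb{T}^2 = \mathbb{R}^2/\mathbb{Z}^2$. For a bounded measurable set $S \subset \mathbb{R}^2$ let $\chi_S(x) = \sum_{k \in \mathbb{Z}^2} \mathbf{1}_S(x+k)$, a $\mathbb{Z}^2$-periodic function regarded as a function on $\mathbb{T}^2$. A bounded measurable set $S \subset \mathbb{R}^2$ is a bounded remainder set (BRS) with respect to $\alpha$ if there is a constant $C = C(S,\alpha)$ such that for every $n \geq 1$ and almost every $x \in \mathbb{T}^2$, $\left| \sum_{k=0}^{n-1} \chi_S(x+k\alpha) - n \operatorname{mes} S \right| \leq C$, where $\operatorname{mes}$ is Lebesgue measure. A convex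 polygon is a convex polytope in $\mathbb{R}^2$ with nonempty interior. Edges are closed segments (including endpoints). An edge is also regarded as a vector, namely the difference of its two endpoints (defined up to sign). Pairs of parallel edges consist of two distinct edges. *)

(* Defs.v *)
From HB Require Import structures.
From mathcomp Require Import all_boot all_order all_algebra.
From mathcomp Require Import all_classical all_reals all_analysis.

Set Implicit Arguments.
Unset Strict Implicit.
Unset Printing Implicit Defensive.

Import Order.TTheory GRing.Theory Num.Theory.
Import numFieldNormedType.Exports.

Local Open Scope classical_set_scope.
Local Open Scope ring_scope.

Section Definitions.
Context {R : realType}.

Notation plane := (R * R)%type.

Implicit Types (alpha a b c u v x y : plane) (S e V : set plane).

Definition irrational_vector alpha : Prop :=
  forall p q r : rat,
    ratr p + ratr q * alpha.1 + ratr r * alpha.2 = 0 :> R ->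
    [/\ p = 0, q = 0 & r = 0].

Definition Z2 (m : int * int) : plane := (m.1%:~R, m.2%:~R).

Definition Zalpha_Z2 alpha : set plane :=
  [set v | exists (n : int) (m : int * int), v = alpha *~ n + Z2 m].

Definition mes2 :
    {measure set (measurableTypeR R * measurableTypeR R) -> \bar R} :=
  (@lebesgue_measure R \x @lebesgue_measure R)%E.

(* The sum has finitely many nonzero terms for every [x] as soon as [S] is
   bounded; [chi S] is Z^2-periodic. *)
Definition chi S x : R := \sum_(k \in [set: int * int]) (\1_S (x + Z2 k) : R).

(* The torus R^2/Z^2 with its Haar measure is represented by this fundamental
   domain with the restriction of Lebesgue measure. *)
Definition unit_square : set plane := `[0, 1[ `*` `[0, 1[.

(* Measurability is with respect to the Borel sigma-algebra, the domain of the
   product measure [mes2]; it is not completed. *)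
Definition bounded_remainder_set alpha S : Prop :=
  [/\ bounded_set S,
      measurable (S : set (measurableTypeR R * measurableTypeR R)) &
      exists C : R, forall n : nat, (0 < n)%N ->
        {ae mes2, forall x, unit_square x ->
          `| \sum_(k < n) chi S (x + alpha *+ k) - n%:R * fine (mes2 S) |
            <= C}].

Definition convex_hull V : set plane :=
  smallest (fun A : set plane => convex_set A) V.

Definition convex_polygon S : Prop :=
  (exists V, finite_set V /\ S = convex_hull V) /\ S° !=set0.

Definition centrally_symmetric S : Prop :=
  exists c, forall x, S x -> S (c *+ 2 - x).

Definition segment a b : set plane :=
  [set (1 - t) *: a + t *: b | t in `[0, 1]].

Definition midpoint a b : plane := 2^-1 *: (a + b).

Definition dot u x : R := u.1 * x.1 + u.2 * x.2.

Definition face S u : set plane :=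
  [set x | S x /\ forall y, S y -> dot u y <= dot u x].

(* [segment a b] is an edge of [S]; since [a] and [b] are its endpoints, the
   edge regarded as a vector is [b - a], up to sign. *)
Definition edge S a b : Prop :=
  a != b /\ exists2 u, u != 0 & face S u = segment a b.

Definition parallel u v : Prop := exists2 t : R, t != 0 & v = t *: u.

End Definitions.

(* Main.v *)
Require Import Defs.
From mathcomp Require Import all_boot all_order all_algebra.
From mathcomp Require Import all_classical all_reals all_analysis.
From mathcomp Require Import measurable_realfun.
From mathcomp Require Import ring lra zify.

Set Implicit Arguments.
Unset Strict Implicit.
Unset Printing Implicit Defensive.

Import Order.TTheory GRing.Theory Num.Theory.
Import numFieldNormedType.Exports.

Local Open Scope classical_set_scope.
Local Open Scope ring_scope.

(** Write G for the group of the vectors n alpha + m, parametrized by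
    [orbit_point], and D_n(x) for the discrepancy, the sum of
    chi_S(x + k alpha) - mes S over k < n.  The polygon S is handled through
    a finite set V that spans it and through the counterclockwise list
    [hull_edges V] of its edges.

    Necessity.  Off the countably many G-translates of the lines that carry
    edges, D_n is locally constant, so the almost sure bound holds at every
    such generic point ([bounded_remainder_generic]).  Let M be the supremum
    of |D_n| over the generic points and all n, and choose z and m with
    |D_m(z)| > M - 1/4.  Since G is dense, the orbit of any y near a given x
    has a long time window that begins with m steps near the orbit of z and
    that is followed by m more such steps.  Adding the latter to the window
    or removing the former from it changes its discrepancy D to D + D_m(z) or
    D - D_m(z); as both are at most M in absolute value, |D| < 1/4.  Apply
    this to two generic points on either side of the line of an edge, near a
    point x of that line: the discrepancies differ by the number of g in the
    window with x + g on the edge, minus the same number for the parallel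
    edge on the other side of S.  This integer is less than 1/2 in absolute
    value, so the two numbers agree ([edge_hits_balance]).

    The elements of G parallel to the edge form a cyclic group
    ([gpt_line_cyclic]), so the two numbers count the points of an arithmetic
    progression in two intervals, and are differences of ceilings.  That they
    agree for almost every x on the line forces an opposite edge to exist and
    to have the same length, and makes it a G-translate of the first edge
    unless the edge vector lies in G ([ceil_count_eq],
    [opposite_edge_conditions]).  A convex polygon in which every edge has an
    opposite one of the same length is centrally symmetric, because
    consecutive edges then have consecutive opposites
    ([opposite_edges_center]).

    Sufficiency.  Call two functions equivalent if their difference has
    bounded sums along all orbits ([eqBR]).  A bounded Z^2-periodic function
    is equivalent to its G-translates, by telescoping ([eqBR_translate]).
    Counting integers on vertical lines, between the lower and the upper
    boundary of S, writes chi_S almost everywhere as a sum of periodic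
    functions, one for each edge ([chi_edge_funs]).  Their discrepancies are
    additive along a line ([edge_disc_add]), change sign with the orientation
    of the edge, and under a translation by g in G change, up to equivalence,
    by the second coordinate of g times a difference of sawtooth functions
    at the two ends ([edge_disc_shift]).  With m twice the center of S,
    conditions (i) and (ii) therefore make the discrepancy of the pair of
    edges ab and (m - a)(m - b) equivalent to Q(a) - Q(b), for a function Q
    of the vertex alone ([edge_pair_disc]).  These differences cancel around
    the polygon ([edge_sum_telescope]), whence the bound. *)

(** * Edges of the hull of a finite planar set *)

Section Hull.
Variable R : realFieldType.
Implicit Types (a b p q r w : R * R) (V : seq (R * R)).

Definition orient a b x : R :=
  (b.1 - a.1) * (x.2 - a.2) - (b.2 - a.2) * (x.1 - a.1).
Definition along a b x : R :=
  (b.1 - a.1) * (x.1 - a.1) + (b.2 - a.2) * (x.2 - a.2).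
Definition height w x : R := w.1 * x.1 + w.2 * x.2.

(** Counterclockwise edges: V lies to the left of the directed line, and the
    condition on [along] makes the ends of the edge the two extreme points of
    V on that line, so that each side of the hull is listed exactly once. *)
Definition hull_edge V (e : (R * R) * (R * R)) : bool :=
  (e.1 != e.2) &&
  all (fun r => (0 <= orient e.1 e.2 r) &&
     ((orient e.1 e.2 r == 0) ==>
        (0 <= along e.1 e.2 r <= along e.1 e.2 e.2))) V.
Definition hull_edges V :=
  [seq e <- [seq (a, b) | a <- undup V, b <- undup V] | hull_edge V e].

Lemma hull_edges_uniq V : uniq (hull_edges V).
Proof.
apply: filter_uniq; apply: allpairs_uniq; rewrite ?undup_uniq //.
by move=> [x1 x2] [y1 y2].
Qed.

Lemma hull_edgesP V a b :
  (a, b) \in hull_edges V <->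
  [/\ a \in V, b \in V, a != b,
      forall r, r \in V -> 0 <= orient a b r &
      forall r, r \in V -> orient a b r = 0 ->
        0 <= along a b r <= along a b b].
Proof.
rewrite mem_filter /hull_edge /=; split.
  case/andP=> /andP[ab /allP h] /allpairsP[[x y] /= [xV yV [ea eb]]].
  subst x y; move: xV yV; rewrite !mem_undup => xV yV; split=> //.
  - by move=> r /h/andP[].
  - by move=> r /h/andP[_ /implyP k] /eqP/k.
case=> aV bV -> h1 h2; apply/andP; split; last first.
  by apply/allpairsP; exists (a, b); rewrite !mem_undup.
apply/allP=> r rV; rewrite h1 //=; apply/implyP=> /eqP; exact: h2.
Qed.

Lemma seq_min (T : eqType) (s : seq T) (f : T -> R) (x0 : T) : x0 \in s ->
  exists2 x, x \in s & forall y, y \in s -> f x <= f y.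
Proof.
elim: s x0 => // x s IH x0 _; case: s IH => [|z s] IH.
  by exists x; rewrite ?mem_head // => y; rewrite inE => /eqP ->.
have [y ys hy] := IH z (mem_head _ _).
have [xy|yx] := leP (f x) (f y).
  exists x; first exact: mem_head.
  move=> u; rewrite inE => /orP[/eqP ->//|/hy]; exact: le_trans.
exists y; first by rewrite inE ys orbT.
by move=> u; rewrite inE => /orP[/eqP ->|/hy //]; apply: ltW.
Qed.

Lemma interval_avoid (s : seq R) (a b : R) : a < b ->
  exists2 x, a < x < b & x \notin s.
Proof.
elim: s a b => [|y s IH] a b ab.
  by exists ((a + b) / 2) => //; lra.
have [by_|yb] := leP b y.
  have [x /andP[ax xb] xs] := IH a b ab.
  by exists x; rewrite ?ax ?xb // inE negb_or xs andbT; apply/eqP => xy; lra.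
have [x /andP[ax xb] xs] := IH (Num.max a y) b ltac:(by rewrite gt_max ab yb).
move: ax; rewrite gt_max => /andP[ax yx]; exists x; first by rewrite ax xb.
by rewrite inE negb_or xs andbT; apply/eqP => xy; lra.
Qed.

Lemma sqdist_gt0 p q : p != q -> 0 < (q.1 - p.1) ^+ 2 + (q.2 - p.2) ^+ 2.
Proof.
case: p q => [p1 p2] [q1 q2] /= h; rewrite lt_neqAle addr_ge0 ?sqr_ge0 // andbT.
rewrite eq_sym paddr_eq0 ?sqr_ge0 // !sqrf_eq0 !subr_eq0.
by apply: contra h => /andP[/eqP -> /eqP ->].
Qed.

Lemma line_param p q r : p != q -> orient p q r = 0 ->
  let s := along p q r / along p q q in
  r = (p.1 + s * (q.1 - p.1), p.2 + s * (q.2 - p.2)).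
Proof.
move=> /sqdist_gt0; rewrite /orient /along -!expr2.
case: p q r => [p1 p2] [q1 q2] [r1 r2] /= n0 h.
have E1 : (q1 - p1) ^+ 2 + (q2 - p2) ^+ 2 != 0 by rewrite gt_eqF.
congr (_, _); apply/eqP; rewrite -subr_eq0.
  have -> : r1 - (p1 + ((q1 - p1) * (r1 - p1) + (q2 - p2) * (r2 - p2)) /
     ((q1 - p1) ^+ 2 + (q2 - p2) ^+ 2) * (q1 - p1)) =
     - (q2 - p2) * ((q1 - p1) * (r2 - p2) - (q2 - p2) * (r1 - p1)) /
      ((q1 - p1) ^+ 2 + (q2 - p2) ^+ 2) by field.
  by rewrite h mulr0 mul0r.
have -> : r2 - (p2 + ((q1 - p1) * (r1 - p1) + (q2 - p2) * (r2 - p2)) /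
   ((q1 - p1) ^+ 2 + (q2 - p2) ^+ 2) * (q2 - p2)) =
   (q1 - p1) * ((q1 - p1) * (r2 - p2) - (q2 - p2) * (r1 - p1)) /
    ((q1 - p1) ^+ 2 + (q2 - p2) ^+ 2) by field.
by rewrite h mulr0 mul0r.
Qed.

Lemma along_gt0 p q : p != q -> 0 < along p q q.
Proof. by move=> /sqdist_gt0; rewrite /along -!expr2. Qed.

Lemma on_line p q r : p != q -> orient p q r = 0 ->
  exists s : R, [/\ r = (p.1 + s * (q.1 - p.1), p.2 + s * (q.2 - p.2)),
     0 <= along p q r -> 0 <= s & along p q r <= along p q q -> s <= 1].
Proof.
move=> pq h; have n0 := along_gt0 pq.
exists (along p q r / along p q q); split; first exact: line_param.
- by move=> ?; rewrite divr_ge0 // ltW.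
- by rewrite ler_pdivrMr // mul1r.
Qed.

(** The edge joins the two points of V that are extreme on the supporting
    line; its ends are parametrized on that line by l <= 0 and m >= 1. *)
Lemma supporting_edge V p q : p \in V -> q \in V -> p != q ->
  (forall r, r \in V -> 0 <= orient p q r) ->
  exists a b, [/\ (a, b) \in hull_edges V &
   exists l m : R, [/\ l <= 0, 1 <= m,
     a = (p.1 + l * (q.1 - p.1), p.2 + l * (q.2 - p.2)) &
     b = (p.1 + m * (q.1 - p.1), p.2 + m * (q.2 - p.2))]].
Proof.
move=> pV qV pq hV.
have n0 := along_gt0 pq; set n := along p q q in n0.
pose L := [seq r <- V | orient p q r == 0].
have onL r : r \in L ->
    r = (p.1 + along p q r / n * (q.1 - p.1), p.2 + along p q r / n * (q.2 - p.2)).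
  by rewrite mem_filter => /andP[/eqP h _]; exact: line_param.
have pL : p \in L by rewrite mem_filter pV andbT /orient !subrr !mulr0 subr0.
have qL : q \in L.
  by rewrite mem_filter qV andbT /orient; apply/eqP; ring.
have [a aL ha] := seq_min (along p q) pL.
have [b bL hb] := seq_min (fun x => - along p q x) pL.
have alp : along p q p = 0 by rewrite /along !subrr !mulr0 addr0.
have aV : a \in V by move: aL; rewrite mem_filter => /andP[].
have bV : b \in V by move: bL; rewrite mem_filter => /andP[].
set l := along p q a / n; set m := along p q b / n.
have l0 : l <= 0 by rewrite /l pmulr_lle0 ?invr_gt0 // -alp ha.
have m1 : 1 <= m by rewrite /m ler_pdivlMr // mul1r -lerN2 hb.
have ea := onL a aL; have eb := onL b bL; rewrite -/l -/m in ea eb.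
have ml : 0 < m - l by lra.
have orE r : orient a b r = (m - l) * orient p q r.
  rewrite ea eb /orient /=; ring.
have alE r : along a b r = (m - l) * (along p q r - along p q a).
  have -> : along p q a = l * n by rewrite /l mulfVK ?gt_eqF.
  rewrite ea eb /n /along /=; ring.
exists a, b; split; last by exists l, m.
apply/hull_edgesP; split=> //.
- apply/eqP => ab; have := orE; rewrite ab => _.
  have : along p q a = along p q b by rewrite ab.
  move=> h; move: ml; rewrite /m /l h; lra.
- by move=> r rV; rewrite orE mulr_ge0 ?hV // ltW.
move=> r rV; rewrite orE => /eqP; rewrite mulf_eq0 (gt_eqF ml) /= => rL.
have {rL} rL : r \in L by rewrite mem_filter rL.
rewrite !alE pmulr_rge0 // subr_ge0 ha //= ler_pM2l // lerD2r -lerN2 hb //.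
Qed.

(** Among the segments joining a point of V below the level t to a point
    above it, the one that crosses the level furthest to the right of the
    direction w has all of V on its left. *)
Lemma slice_edge V w t : (forall r, r \in V -> height w r != t) ->
  (exists2 p, p \in V & height w p < t) -> (exists2 q, q \in V & t < height w q) ->
  exists a b, [/\ (a, b) \in hull_edges V, height w a < t & t < height w b].
Proof.
move=> gen [p0 p0V p0t] [q0 q0V q0t].
pose X := height w; pose Y r := w.1 * r.2 - w.2 * r.1.
have w0 : 0 < w.1 ^+ 2 + w.2 ^+ 2.
  have := @sqdist_gt0 (0, 0) w; rewrite /= !subr0; apply.
  apply/eqP => e; move: p0t q0t; rewrite /height -e /=; lra.
pose P := [seq pq <- [seq (p, q) | p <- V, q <- V] | X pq.1 < t < X pq.2].
(* coordinate, across w, of the point where the segment crosses the level *)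
pose h (pq : _ * _) := (Y pq.1 * (X pq.2 - t) + Y pq.2 * (t - X pq.1)) / (X pq.2 - X pq.1).
have P0 : (p0, q0) \in P.
  by rewrite mem_filter /= p0t q0t; apply/allpairsP; exists (p0, q0).
have memP p q : p \in V -> q \in V -> X p < t -> t < X q -> (p, q) \in P.
  move=> pV qV pt qt; rewrite mem_filter /= pt qt.
  by apply/allpairsP; exists (p, q).
have [[p q]] := seq_min h P0.
rewrite mem_filter /= => /andP[/andP[pt qt] /allpairsP[[p' q'] /= [pV qV [ep eq]]]].
subst p' q' => hmin.
have orE r : (w.1 ^+ 2 + w.2 ^+ 2) * orient p q r =
   (X q - X p) * (Y r - Y p) - (Y q - Y p) * (X r - X p).
  rewrite /orient /X /Y /height; ring.
have Xpq : 0 < X q - X p by lra.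
have sup r : r \in V -> 0 <= orient p q r.
  move=> rV; rewrite leNgt; apply/negP => neg.
  have neg' : (X q - X p) * (Y r - Y p) - (Y q - Y p) * (X r - X p) < 0.
    by rewrite -orE pmulr_rlt0.
  have := gen r rV; rewrite -/(X r) neq_lt => /orP[rt|tr].
    have := hmin _ (memP _ _ rV qV rt qt); rewrite leNgt => /negP; apply.
    have Xrq : 0 < X q - X r by lra.
    rewrite -subr_gt0 /h /=.
    have -> : (Y p * (X q - t) + Y q * (t - X p)) / (X q - X p) -
        (Y r * (X q - t) + Y q * (t - X r)) / (X q - X r) =
      (X q - t) * - ((X q - X p) * (Y r - Y p) - (Y q - Y p) * (X r - X p)) /
        ((X q - X p) * (X q - X r)).
      by field; rewrite !gt_eqF.
    apply: divr_gt0; last exact: mulr_gt0.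
    by apply: mulr_gt0; lra.
  have := hmin _ (memP _ _ pV rV pt tr); rewrite leNgt => /negP; apply.
  have Xrp : 0 < X r - X p by lra.
  rewrite -subr_gt0 /h /=.
  have -> : (Y p * (X q - t) + Y q * (t - X p)) / (X q - X p) -
      (Y p * (X r - t) + Y r * (t - X p)) / (X r - X p) =
    (t - X p) * - ((X q - X p) * (Y r - Y p) - (Y q - Y p) * (X r - X p)) /
      ((X q - X p) * (X r - X p)).
    by field; rewrite !gt_eqF.
  apply: divr_gt0; last exact: mulr_gt0.
  by apply: mulr_gt0; lra.
have pq : p != q by apply/eqP => e; rewrite e subrr ltxx in Xpq.
have [a [b [abE [l [m [l0 m1 ea eb]]]]]] := supporting_edge pV qV pq sup.
exists a, b; split=> //.
  have -> : height w a = X p + l * (X q - X p).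
    by rewrite ea /X /height /=; ring.
  have : l * (X q - X p) <= 0 by rewrite pmulr_lle0.
  lra.
have -> : height w b = X p + m * (X q - X p).
  by rewrite eb /X /height /=; ring.
have : 1 * (X q - X p) <= m * (X q - X p) by rewrite ler_pM2r.
lra.
Qed.

Lemma heightN w x : height (- w.1, - w.2) x = - height w x.
Proof. by rewrite /height /=; ring. Qed.

Lemma slice_edge_down V w t : (forall r, r \in V -> height w r != t) ->
  (exists2 p, p \in V & height w p < t) -> (exists2 q, q \in V & t < height w q) ->
  exists a b, [/\ (a, b) \in hull_edges V, t < height w a & height w b < t].
Proof.
move=> gen [p pV pt] [q qV tq].
have [|||a [b [abE]]] := @slice_edge V (- w.1, - w.2) (- t).
- by move=> r rV; rewrite heightN eqr_opp gen.
- by exists q; rewrite // heightN ltrN2.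
- by exists p; rewrite // heightN ltrN2.
by rewrite !heightN !ltrN2; exists a, b.
Qed.

(** Each of the two edges has extreme ends on the common line, hence contains
    the other. *)
Lemma collinear_edges_eq V a b c d w :
  (a, b) \in hull_edges V -> (c, d) \in hull_edges V ->
  height w a < height w b -> height w c < height w d ->
  [/\ orient a b c = 0, orient a b d = 0, orient c d a = 0 & orient c d b = 0] ->
  (a, b) = (c, d).
Proof.
move=> /hull_edgesP[aV bV ab _ hab] /hull_edgesP[cV dV cd _ hcd] wab wcd.
have heightE (p q : R * R) (s : R) :
    height w (p.1 + s * (q.1 - p.1), p.2 + s * (q.2 - p.2)) =
    height w p + s * (height w q - height w p).
  by rewrite /height /=; ring.
have half (p q r u : R * R) : p != q -> r != u -> p \in V -> r \in V -> q \in V -> u \in V ->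
   (forall x, x \in V -> orient p q x = 0 -> 0 <= along p q x <= along p q q) ->
   (forall x, x \in V -> orient r u x = 0 -> 0 <= along r u x <= along r u u) ->
   height w p < height w q -> height w r < height w u ->
   orient p q r = 0 -> orient p q u = 0 ->
   height w p <= height w r /\ height w u <= height w q.
  move=> pq ru pV rV qV uV hp hr wpq wru o1 o2.
  have [s [es s0 _]] := on_line pq o1; have [t [et _ t1]] := on_line pq o2.
  move: (hp r rV o1) (hp u uV o2) => /andP[/s0 {}s0 _] /andP[_ /t1 {}t1].
  rewrite es et !heightE; split.
    by rewrite lerDl mulr_ge0 // subr_ge0 ltW.
  have : t * (height w q - height w p) <= 1 * (height w q - height w p).
    by rewrite ler_pM2r // subr_gt0.
  lra.
case=> o1 o2 o3 o4.
have [h1 h2] := half _ _ _ _ ab cd aV cV bV dV hab hcd wab wcd o1 o2.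
have [h3 h4] := half _ _ _ _ cd ab cV aV dV bV hcd hab wcd wab o3 o4.
have [s [es _ _]] := on_line ab o1; have [t [et _ _]] := on_line ab o2.
have : height w c = height w a by lra.
rewrite {1}es heightE => e1.
have : height w d = height w b by lra.
rewrite {1}et heightE => e2.
have s0 : s = 0.
  have /eqP : s * (height w b - height w a) = 0 by lra.
  by rewrite mulf_eq0 subr_eq0 (gt_eqF wab) orbF => /eqP.
have t1 : t - 1 = 0.
  have /eqP : (t - 1) * (height w b - height w a) = 0 by lra.
  by rewrite mulf_eq0 [_ - height w a == 0]subr_eq0 (gt_eqF wab) orbF => /eqP.
have {}t1 : t = 1 by lra.
move: es et; rewrite s0 t1 !mul1r !mul0r !addr0 => -> ->.
rewrite -!surjective_pairing; congr (_, _); rewrite [LHS]surjective_pairing.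
by congr (_, _); ring.
Qed.

(** The point where one edge crosses the level is a convex combination of
    vertices, hence on the left of the other edge, and conversely; the weighted
    identity [sum0] makes both inequalities equalities, so that the edges are
    collinear. *)
Lemma slice_edge_unique V w t a b c d :
  (a, b) \in hull_edges V -> (c, d) \in hull_edges V ->
  height w a < t -> t < height w b -> height w c < t -> t < height w d ->
  (a, b) = (c, d).
Proof.
move=> abE cdE at_ tb ct td.
apply: (@collinear_edges_eq V a b c d w) => //; [lra..|].
move/hull_edgesP: abE => [aV bV ab hab _].
move/hull_edgesP: cdE => [cV dV cd hcd _].
have A := hcd a aV; have B := hcd b bV; have C := hab c cV; have D := hab d dV.
have sum0 : (height w d - t) * orient a b c + (t - height w c) * orient a b d +
  ((height w b - t) * orient c d a + (t - height w a) * orient c d b) = 0.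
  rewrite /orient /height; ring.
have hC : 0 <= (height w d - t) * orient a b c by rewrite mulr_ge0 // subr_ge0 ltW.
have hD : 0 <= (t - height w c) * orient a b d by rewrite mulr_ge0 // subr_ge0 ltW.
have hA : 0 <= (height w b - t) * orient c d a by rewrite mulr_ge0 // subr_ge0 ltW.
have hB : 0 <= (t - height w a) * orient c d b by rewrite mulr_ge0 // subr_ge0 ltW.
have z (x y : R) : 0 < x -> x * y = 0 -> y = 0.
  by move=> x0 /eqP; rewrite mulf_eq0 gt_eqF //= => /eqP.
by split; [apply: (z (height w d - t))|apply: (z (t - height w c))|
  apply: (z (height w b - t))|apply: (z (t - height w a))]; lra.
Qed.

(** Two codirectional lines with V on their left, and through points of V, are
    each on the left of the other, so they coincide. *)
Lemma parallel_edges_eq V a b c d k : 0 < k ->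
  (a, b) \in hull_edges V -> (c, d) \in hull_edges V ->
  d.1 - c.1 = k * (b.1 - a.1) -> d.2 - c.2 = k * (b.2 - a.2) ->
  (a, b) = (c, d).
Proof.
move=> k0 abE cdE e1 e2.
move/hull_edgesP: (abE) => [aV bV ab hab _].
move/hull_edgesP: (cdE) => [cV dV cd hcd _].
have n0 := sqdist_gt0 ab.
pose w := (b.1 - a.1, b.2 - a.2).
apply: (@collinear_edges_eq V a b c d w) => //.
- rewrite -subr_gt0.
  by have -> : height w b - height w a = (b.1 - a.1) ^+ 2 + (b.2 - a.2) ^+ 2
    by rewrite /height /=; ring.
- rewrite -subr_gt0.
  have -> : height w d - height w c = k * ((b.1 - a.1) ^+ 2 + (b.2 - a.2) ^+ 2).
    have -> : height w d - height w c =
      (b.1 - a.1) * (d.1 - c.1) + (b.2 - a.2) * (d.2 - c.2).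
      by rewrite /height /=; ring.
    by rewrite e1 e2; ring.
  exact: mulr_gt0.
have oE x y : orient c d x - orient c d y = k * (orient a b x - orient a b y).
  by rewrite /orient e1 e2; ring.
have occ : orient c d c = 0 by rewrite /orient; ring.
have ocd : orient c d d = 0 by rewrite /orient; ring.
have oaa : orient a b a = 0 by rewrite /orient; ring.
have oab : orient a b b = 0 by rewrite /orient; ring.
have dc : orient a b d = orient a b c.
  have := oE d c; rewrite occ ocd subrr => /esym/eqP.
  by rewrite mulf_eq0 (gt_eqF k0) subr_eq0 => /eqP.
have := oE a c; have := oE b c; rewrite oaa oab occ sub0r !subr0 => hb ha.
have := hcd a aV; rewrite ha pmulr_rge0 // => h1.
have oc : orient a b c = 0 by have := hab c cV; lra.
by split; rewrite ?dc ?ha ?hb ?oc // oppr0 mulr0.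
Qed.

Lemma out_edge_unique V b c d :
  (b, c) \in hull_edges V -> (b, d) \in hull_edges V -> c = d.
Proof.
move=> bcE bdE.
move/hull_edgesP: (bcE) => [bV cV bc hc hc'].
move/hull_edgesP: (bdE) => [_ dV bd hd hd'].
have o : orient b d c = - orient b c d by rewrite /orient; ring.
have ocd : orient b c d = 0 by have := hc d dV; have := hd c cV; lra.
have [s [es s0 _]] := on_line bc ocd.
have {}s0 : 0 <= s by apply: s0; case/andP: (hc' d dV ocd).
have {}s0 : 0 < s.
  rewrite lt_neqAle s0 andbT; apply: contra bd => /eqP s00.
  by rewrite es -s00 !mul0r !addr0 -surjective_pairing.
have [] // : (b, c) = (b, d).
by apply: (@parallel_edges_eq V b c b d s) => //; rewrite {1}es /=; ring.
Qed.

End Hull.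

(** * The boundary cycle of the hull *)

Section Hull2.
Variable R : realFieldType.
Implicit Types (a b p q r w : R * R) (V : seq (R * R)).

Lemma slice_count V w t : (forall r, r \in V -> height w r != t) ->
  (exists2 p, p \in V & height w p < t) -> (exists2 q, q \in V & t < height w q) ->
  \sum_(e <- hull_edges V) (height w e.1 < t < height w e.2)%R%:R = 1 :> R.
Proof.
move=> gen lo hi; have [a [b [abE at_ tb]]] := slice_edge gen lo hi.
rewrite (bigD1_seq (a, b)) ?hull_edges_uniq //= at_ tb big_seq_cond big1 ?addr0 //.
move=> [c d] /= /andP[cdE ne]; case: (boolP (_ && _)) => // /andP[ct td].
by case/eqP: ne; rewrite -(slice_edge_unique abE cdE at_ tb ct td).
Qed.

(** A level that misses V is crossed upwards by as many edges as downwards: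
    once each, or not at all. *)
Lemma slice_balance V w t : (forall r, r \in V -> height w r != t) ->
  \sum_(e <- hull_edges V) ((height w e.1 < t)%R%:R - (height w e.2 < t)%R%:R) = 0 :> R.
Proof.
move=> gen.
have [lo|nlo] := boolP (has (fun r => height w r < t) V); last first.
  rewrite big_seq big1 // => -[a b] /hull_edgesP[aV bV _ _ _] /=.
  move/hasPn: nlo => h; rewrite !ltNge !ltW ?subrr //.
    by have := h b bV; rewrite -leNgt le_eqVlt eq_sym (negbTE (gen b bV)).
  by have := h a aV; rewrite -leNgt le_eqVlt eq_sym (negbTE (gen a aV)).
have [hi|nhi] := boolP (has (fun r => t < height w r) V); last first.
  rewrite big_seq big1 // => -[a b] /hull_edgesP[aV bV _ _ _] /=.
  move/hasPn: nhi => h.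
  by rewrite !lt_neqAle !gen // ![_ <= t]leNgt !h // subrr.
have h1 : \sum_(e <- hull_edges V) (height w e.1 < t < height w e.2)%R%:R = 1 :> R.
  by apply: slice_count => //; [case/hasP: lo => r|case/hasP: hi => r]; exists r.
have h2 : \sum_(e <- hull_edges V) (height w e.2 < t < height w e.1)%R%:R = 1 :> R.
  rewrite -[RHS](@slice_count V (- w.1, - w.2) (- t)).
  - by apply: eq_bigr => e _; rewrite !heightN !ltrN2 andbC.
  - by move=> r rV; rewrite heightN eqr_opp gen.
  - by case/hasP: hi => r rV hr; exists r => //; rewrite heightN ltrN2.
  - by case/hasP: lo => r rV hr; exists r => //; rewrite heightN ltrN2.
rewrite -[RHS](subrr (1 : R)) -[X in _ = X - _]h1 -[X in _ = _ - X]h2 -sumrB.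
apply: eq_big_seq => -[a b] /hull_edgesP[aV bV _ _ _] /=.
case: (ltgtP (height w a) t) (gen a aV) => //= _ _;
  case: (ltgtP (height w b) t) (gen b bV) => //= _ _; by rewrite ?subrr.
Qed.

Lemma separating_direction V : exists w, {in V &, injective (height w)}.
Proof.
pose bad := [seq - (p.1 - q.1) / (p.2 - q.2) | p <- V, q <- V].
have [s _ sbad] := interval_avoid bad (@ltr01 R).
exists (1, s) => p q pV qV; rewrite /height /= !mul1r => e.
have [e2|ne2] := eqVneq p.2 q.2.
  have e1 : p.1 = q.1 by move: e; rewrite e2; lra.
  by rewrite [p]surjective_pairing e1 e2 -surjective_pairing.
case/negP: sbad; apply/allpairsP; exists (p, q); split => //=.
have d0 : p.2 - q.2 != 0 by rewrite subr_eq0.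
by apply: (mulIf d0); rewrite divfK //; lra.
Qed.

Lemma gap (s : seq R) x :
  exists2 e, 0 < e & forall y, y \in s -> y != x -> e <= `|y - x|.
Proof.
elim: s => [|y s [e e0 IH]]; first by exists 1.
have [->|yx] := eqVneq y x.
  exists e => // z; rewrite inE => /orP[/eqP ->|/IH //]; by rewrite eqxx.
exists (Num.min e `|y - x|); first by rewrite lt_min e0 normr_gt0 subr_eq0.
move=> z; rewrite inE => /orP[/eqP -> _|zs zx]; first by rewrite ge_min lexx orbT.
by rewrite ge_min IH.
Qed.

(** In a direction that separates the points of V, the crossing balances just
    above and just below p differ by the edges that begin or end at p. *)
Lemma vertex_degree V p : p \in V ->
  \sum_(e <- hull_edges V) (e.1 == p)%:R = \sum_(e <- hull_edges V) (e.2 == p)%:R :> R.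
Proof.
move=> pV; have [w winj] := separating_direction V.
have [d d0 hd] := gap [seq height w r | r <- V] (height w p).
have far r : r \in V -> r != p -> d <= `|height w r - height w p|.
  by move=> rV rp; apply: hd; rewrite ?map_f // (inj_in_eq winj).
have level t : `|t - height w p| = d / 2 ->
    \sum_(e <- hull_edges V) ((height w e.1 < t)%R%:R - (height w e.2 < t)%R%:R) = 0 :> R.
  move=> td; apply: slice_balance => r rV; apply/eqP => e.
  have [rp|/(far r rV)] := eqVneq r p; last by rewrite e td; lra.
  by move: td; rewrite -e rp subrr normr0; lra.
have up : `|height w p + d / 2 - height w p| = d / 2.
  by rewrite addrAC subrr add0r ger0_norm //; lra.
have dn : `|height w p - d / 2 - height w p| = d / 2.
  by rewrite addrAC subrr add0r normrN ger0_norm //; lra.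
have one r : r \in V ->
    (height w r < height w p + d / 2)%R%:R -
    (height w r < height w p - d / 2)%R%:R = (r == p)%:R :> R.
  move=> rV; have [->|rp] := eqVneq r p.
    have -> : height w p < height w p + d / 2 by lra.
    have -> : (height w p < height w p - d / 2) = false by apply/negbTE; rewrite -leNgt; lra.
    by rewrite subr0.
  have := far r rV rp; rewrite ler_normr => /orP[h|h].
    have -> : (height w r < height w p + d / 2) = false by apply/negbTE; rewrite -leNgt; lra.
    have -> : (height w r < height w p - d / 2) = false by apply/negbTE; rewrite -leNgt; lra.
    by rewrite subrr.
  have -> : height w r < height w p + d / 2 by lra.
  have -> : height w r < height w p - d / 2 by lra.
  by rewrite subrr.
have /= := congr2 (fun x y => x - y) (level _ up) (level _ dn).
rewrite [RHS]subr0 -sumrB => h.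
apply/eqP; rewrite -subr_eq0 -sumrB -[X in _ == X]h; apply/eqP.
apply: eq_big_seq => -[a b] /hull_edgesP[aV bV _ _ _] /=.
rewrite -!one //; ring.
Qed.

(** The boundary is a closed cycle: every vertex begins as many edges as it
    ends. *)
Lemma edge_sum_telescope V (Q : R * R -> R) :
  \sum_(e <- hull_edges V) (Q e.2 - Q e.1) = 0.
Proof.
have E (g : (R * R) * (R * R) -> R * R) :
    (forall e, e \in hull_edges V -> g e \in V) ->
    \sum_(e <- hull_edges V) Q (g e) =
    \sum_(p <- undup V) (\sum_(e <- hull_edges V) (g e == p)%:R) * Q p.
  move=> gV; under [RHS]eq_bigr do rewrite mulr_suml.
  rewrite exchange_big /=; apply: eq_big_seq => e eE.
  rewrite (bigD1_seq (g e)) ?undup_uniq ?mem_undup ?gV //= eqxx mul1r.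
  by rewrite big1 ?addr0 // => p; rewrite eq_sym => /negbTE ->; rewrite mul0r.
rewrite sumrB !E; first last.
- by move=> [a b] /hull_edgesP[].
- by move=> [a b] /hull_edgesP[].
apply/eqP; rewrite subr_eq0; apply/eqP/eq_big_seq => p; rewrite mem_undup => pV.
by rewrite vertex_degree.
Qed.

Lemma sum_bool_gt0 (T : eqType) (s : seq T) (P : pred T) :
  (0 < \sum_(e <- s) (P e)%:R :> R) = has P s.
Proof.
rewrite -natr_sum ltr0n; elim: s => [|x s IH]; first by rewrite big_nil.
by rewrite big_cons /= -IH addn_gt0; case: (P x).
Qed.

Lemma next_edge V a b : (a, b) \in hull_edges V -> exists c, (b, c) \in hull_edges V.
Proof.
move=> abE; have /hull_edgesP[_ bV _ _ _] := abE.
have : has (fun e => e.2 == b) (hull_edges V).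
  by apply/hasP; exists (a, b) => //=.
rewrite -sum_bool_gt0 -vertex_degree // sum_bool_gt0 => /hasP[[x c] xcE /= /eqP e].
by exists c; rewrite -e.
Qed.

Lemma prev_edge V a b : (a, b) \in hull_edges V -> exists z, (z, a) \in hull_edges V.
Proof.
move=> abE; have /hull_edgesP[aV _ _ _ _] := abE.
have : has (fun e => e.1 == a) (hull_edges V).
  by apply/hasP; exists (a, b) => //=.
rewrite -sum_bool_gt0 vertex_degree // sum_bool_gt0 => /hasP[[z x] xcE /= /eqP e].
by exists z; rewrite -e.
Qed.

Definition noncollinear V :=
  forall p q, p != q -> exists2 r, r \in V & orient p q r != 0.

Lemma corner_gt0 V a b c : noncollinear V ->
  (a, b) \in hull_edges V -> (b, c) \in hull_edges V -> 0 < orient a b c.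
Proof.
move=> nc /hull_edgesP[aV bV ab hab hab'] /hull_edgesP[_ cV bc hbc _].
rewrite lt_neqAle hab // andbT; apply/eqP => /esym o.
have [s [es _ s1]] := on_line ab o.
have {}s1 : s <= 1 by apply: s1; case/andP: (hab' c cV o).
have s1' : s < 1.
  rewrite lt_neqAle s1 andbT; apply: contra bc => /eqP s11; apply/eqP.
  by rewrite es s11 !mul1r [b]surjective_pairing /=; congr (_, _); ring.
have [r rV /eqP] := nc a b ab; apply.
have : 0 <= (s - 1) * orient a b r.
  have -> : (s - 1) * orient a b r = orient b c r by rewrite es /orient /=; ring.
  exact: hbc.
have := hab r rV; rewrite le_eqVlt => /orP[/eqP <- //|o0].
by rewrite pmulr_lge0 //; lra.
Qed.

(** A line through x and an interior point p of K, chosen to avoid V, leaves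
    the hull through two edges; their crossing points with it are in K and
    enclose x.  The axioms on K are those of the convex hull of V. *)
Lemma hull_interE V (K : R * R -> Prop) o (eps : R) :
  (forall r, r \in V -> K r) ->
  (forall p q s, K p -> K q -> 0 <= s <= 1 ->
     K (p.1 + s * (q.1 - p.1), p.2 + s * (q.2 - p.2))) ->
  (forall w t, (forall r, r \in V -> height w r <= t) ->
     forall y, K y -> height w y <= t) ->
  0 < eps -> (forall y, `|y.1 - o.1| < eps -> `|y.2 - o.2| < eps -> K y) ->
  forall x, (forall a b, (a, b) \in hull_edges V -> 0 <= orient a b x) -> K x.
Proof.
move=> VK cK hK e0 oK x hx.
have [/VK//|xV] := boolP (x \in V).
(* slopes and offsets to avoid, so that the line from x to p misses V *)
pose slopes := [seq (r.2 - x.2) / (r.1 - x.1) | r <- V].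
have [k /andP[k0 k1] kbad] := interval_avoid slopes (@ltr01 R).
have ndir r : r \in V -> (r.1 - x.1) * k - (r.2 - x.2) != 0.
  move=> rV; apply/eqP => h.
  have [e1|ne1] := eqVneq r.1 x.1.
    case/negP: xV; have e2 : r.2 = x.2 by move: h; rewrite e1; lra.
    by rewrite [x]surjective_pairing -e1 -e2 -surjective_pairing.
  case/negP: kbad; apply/mapP; exists r => //.
  have d0 : r.1 - x.1 != 0 by rewrite subr_eq0.
  by apply: (mulIf d0); rewrite divfK //; lra.
pose shifts := [seq - orient x r o / ((r.1 - x.1) * k - (r.2 - x.2)) | r <- V].
have [s /andP[s0 s1] sbad] := interval_avoid shifts (ltac:(lra) : 0 < eps / 2).
pose p := (o.1 + s, o.2 + s * k).
have pgen r : r \in V -> orient x r p != 0.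
  move=> rV; apply/eqP => h; case/negP: sbad; apply/mapP; exists r => //.
  have d0 := ndir r rV; apply: (mulIf d0); rewrite divfK //.
  by move: h; rewrite /orient /p /=; lra.
have pK y : `|y.1 - p.1| < eps / 2 -> `|y.2 - p.2| < eps / 2 -> K y.
  have sk : 0 < s * k by apply: mulr_gt0.
  have sk' : s * k < s by rewrite -[ltRHS]mulr1 ltr_pM2l.
  rewrite /p /= !ltr_norml => /andP[h1 h2] /andP[h3 h4].
  by apply: oK; rewrite ltr_norml; apply/andP; split; lra.
(* the line through x and p is the level of x for w; Y measures position on it *)
pose w := (- (p.2 - x.2), p.1 - x.1).
have wE r : height w r - height w x = - orient x r p.
  by rewrite /height /orient /=; ring.
have wpx : height w p = height w x by rewrite /height /=; ring.
have gen r : r \in V -> height w r != height w x.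
  by move=> rV; rewrite -subr_eq0 wE oppr_eq0 pgen.
have V0 : exists r, r \in V.
  case E: (V) => [|r V']; last by exists r; rewrite mem_head.
  have : height (0, 0) o <= -1.
    apply: hK => [r|]; first by rewrite E.
    by apply: oK; rewrite subrr normr0.
  by rewrite /height /= !mul0r addr0; lra.
have n0 : 0 < w.1 ^+ 2 + w.2 ^+ 2.
  have := @sqdist_gt0 _ (0, 0) w; rewrite /= !subr0; apply.
  have [r rV] := V0; apply/eqP => we; have := gen r rV.
  by rewrite /height -we /= !mul0r eqxx.
have m0 : 0 < 1 + `|w.1| + `|w.2| by have := normr_ge0 w.1; have := normr_ge0 w.2; lra.
have mv z : `|z| = eps / 2 / (1 + `|w.1| + `|w.2|) -> K (p.1 + z * w.1, p.2 + z * w.2).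
  move=> ez; have z0 : 0 < `|z| by rewrite ez !divr_gt0 // mulr_gt0 //; lra.
  have eE : eps / 2 = `|z| * (1 + `|w.1| + `|w.2|) by rewrite ez divfK ?gt_eqF.
  have n1 := normr_ge0 w.1; have n2 := normr_ge0 w.2.
  by apply: pK; rewrite /= addrAC subrr add0r normrM eE ltr_pM2l //; lra.
pose z := eps / 2 / (1 + `|w.1| + `|w.2|).
have z0 : 0 < z by rewrite !divr_gt0 // ; lra.
have hi : exists2 q, q \in V & height w x < height w q.
  have [/hasP[q qV hq]|/hasPn h] := boolP (has (fun q => height w x < height w q) V).
    by exists q.
  have : height w (p.1 + z * w.1, p.2 + z * w.2) <= height w x.
    apply: hK; first by move=> r /h; rewrite -leNgt.
    by apply: mv; rewrite gtr0_norm.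
  have -> : height w (p.1 + z * w.1, p.2 + z * w.2) = height w p + z * (w.1 ^+ 2 + w.2 ^+ 2).
    by rewrite /height /=; ring.
  by rewrite wpx gerDl leNgt mulr_gt0.
have lo : exists2 q, q \in V & height w q < height w x.
  have [/hasP[q qV hq]|/hasPn h] := boolP (has (fun q => height w q < height w x) V).
    by exists q.
  have : height (- w.1, - w.2) (p.1 + - z * w.1, p.2 + - z * w.2) <= - height w x.
    apply: hK; first by move=> r /h; rewrite -leNgt heightN lerN2.
    by apply: mv; rewrite normrN gtr0_norm.
  rewrite heightN lerN2.
  have -> : height w (p.1 + - z * w.1, p.2 + - z * w.2) = height w p - z * (w.1 ^+ 2 + w.2 ^+ 2).
    by rewrite /height /=; ring.
  by rewrite wpx lerBrDr gerDl leNgt mulr_gt0.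
set t := height w x in gen hi lo.
have [a [b [abE at_ tb]]] := slice_edge gen lo hi.
have [c [d [cdE ct td]]] := slice_edge_down gen lo hi.
have abx := hx a b abE; have cdx := hx c d cdE.
have /hull_edgesP[aV bV _ _ _] := abE; have /hull_edgesP[cV dV _ _ _] := cdE.
pose Y r := w.1 * r.2 - w.2 * r.1.
have orE p' q r : (w.1 ^+ 2 + w.2 ^+ 2) * orient p' q r =
   (height w q - height w p') * (Y r - Y p') - (Y q - Y p') * (height w r - height w p').
  rewrite /orient /Y /height; ring.
have hE (p' q : R * R) s' : height w (p'.1 + s' * (q.1 - p'.1), p'.2 + s' * (q.2 - p'.2)) =
   height w p' + s' * (height w q - height w p') by rewrite /height /=; ring.
have YE (p' q : R * R) s' : Y (p'.1 + s' * (q.1 - p'.1), p'.2 + s' * (q.2 - p'.2)) =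
   Y p' + s' * (Y q - Y p') by rewrite /Y /=; ring.
pose cut (p q : R * R) := (p.1 + (t - height w p) / (height w q - height w p) * (q.1 - p.1),
                p.2 + (t - height w p) / (height w q - height w p) * (q.2 - p.2)).
have cutX p' q : height w p' != height w q -> height w (cut p' q) = t.
  move=> ne; have ne' : height w q - height w p' != 0 by rewrite subr_eq0 eq_sym.
  rewrite hE.
  by rewrite divfK //; lra.
have cutY p' q : height w p' != height w q -> (w.1 ^+ 2 + w.2 ^+ 2) * orient p' q x = (height w q - height w p') * (Y x - Y (cut p' q)).
  move=> ne; have ne' : height w q - height w p' != 0 by rewrite subr_eq0 eq_sym.
  rewrite YE.
  by rewrite orE -/t; field.
have cutK p' q : K p' -> K q -> 0 <= (t - height w p') / (height w q - height w p') <= 1 -> K (cut p' q).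
  exact: cK.
have nab : height w a != height w b by rewrite lt_eqF //; lra.
have ncd : height w c != height w d by rewrite gt_eqF //; lra.
have K1 : K (cut a b).
  apply: cutK; [exact: VK|exact: VK|].
  have h : 0 < height w b - height w a by lra.
  by rewrite ler_pdivrMr // ler_pdivlMr //; apply/andP; split; lra.
have K2 : K (cut c d).
  apply: cutK; [exact: VK|exact: VK|].
  have h : height w d - height w c < 0 by lra.
  by rewrite ler_ndivrMr // ler_ndivlMr //; apply/andP; split; lra.
have Y1 : Y (cut a b) <= Y x.
  have : 0 <= (height w b - height w a) * (Y x - Y (cut a b)).
    by rewrite -cutY // mulr_ge0 // ltW.
  by rewrite pmulr_rge0 ?subr_ge0 // subr_gt0; lra.
have Y2 : Y x <= Y (cut c d).
  have : 0 <= (height w d - height w c) * (Y x - Y (cut c d)).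
    by rewrite -cutY // mulr_ge0 // ltW.
  by rewrite nmulr_rge0 ?subr_le0 // subr_lt0; lra.
have rec y y' : height w y = height w y' -> Y y = Y y' -> y = y'.
  move=> e1 e2; have n0' : w.1 ^+ 2 + w.2 ^+ 2 != 0 by rewrite gt_eqF.
  rewrite [y]surjective_pairing [y']surjective_pairing; congr (_, _).
    apply: (mulfI n0').
    have h u : (w.1 ^+ 2 + w.2 ^+ 2) * u.1 = w.1 * height w u - w.2 * Y u.
      by rewrite /height /Y; ring.
    by rewrite !h e1 e2.
  apply: (mulfI n0').
  have h u : (w.1 ^+ 2 + w.2 ^+ 2) * u.2 = w.2 * height w u + w.1 * Y u.
    by rewrite /height /Y; ring.
  by rewrite !h e1 e2.
have [e12|ne12] := eqVneq (Y (cut a b)) (Y (cut c d)).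
  by rewrite (rec x (cut a b)) // ?cutX // ; lra.
have d12 : 0 < Y (cut c d) - Y (cut a b).
  by rewrite subr_gt0 lt_neqAle ne12 (le_trans Y1).
pose l := (Y x - Y (cut a b)) / (Y (cut c d) - Y (cut a b)).
have l01 : 0 <= l <= 1.
  by rewrite /l ler_pdivrMr // ler_pdivlMr //; apply/andP; split; lra.
rewrite (rec x ((cut a b).1 + l * ((cut c d).1 - (cut a b).1),
                (cut a b).2 + l * ((cut c d).2 - (cut a b).2))).
- exact: cK.
- by rewrite hE !cutX // subrr mulr0 addr0.
- by rewrite YE /l divfK ?gt_eqF //; ring.
Qed.

End Hull2.

(** * Central symmetry from opposite edges *)

Section Hull3.
Variable R : realFieldType.
Implicit Types (a b c p q r w m : R * R) (V : seq (R * R)).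

Definition det2 u v : R := u.1 * v.2 - u.2 * v.1.

Lemma det2_eq0 (u v f : R * R) : 0 < det2 u v -> det2 u f = 0 -> det2 v f = 0 -> f = (0, 0).
Proof.
rewrite /det2 => D h1 h2.
have e1 : (u.1 * v.2 - u.2 * v.1) * f.1 = 0.
  have -> : (u.1 * v.2 - u.2 * v.1) * f.1 =
    - (v.1 * f.2 - v.2 * f.1) * u.1 + (u.1 * f.2 - u.2 * f.1) * v.1 by ring.
  by rewrite h1 h2; ring.
have e2 : (u.1 * v.2 - u.2 * v.1) * f.2 = 0.
  have -> : (u.1 * v.2 - u.2 * v.1) * f.2 =
    - (v.1 * f.2 - v.2 * f.1) * u.2 + (u.1 * f.2 - u.2 * f.1) * v.2 by ring.
  by rewrite h1 h2; ring.
move/eqP: e1; move/eqP: e2; rewrite !mulf_eq0 !(gt_eqF D) /= => /eqP f2 /eqP f1.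
by rewrite [f]surjective_pairing f1 f2.
Qed.

(** In the basis v1, v2 of the edge vectors at b, the counterclockwise order
    of directions is the order of the boundary.  If the opposite of bc did not
    start where the opposite a'b' of ab ends, the edge leaving b' would have a
    direction z strictly between -v1 and -v2, and the opposite of that edge
    would have both ends at b. *)
Lemma opposite_next V a b c a' b' p q : noncollinear V ->
  (forall x y, (x, y) \in hull_edges V ->
     exists x' y', (x', y') \in hull_edges V /\ y' - x' = x - y) ->
  (a, b) \in hull_edges V -> (b, c) \in hull_edges V ->
  (a', b') \in hull_edges V -> (p, q) \in hull_edges V ->
  b' - a' = a - b -> q - p = b - c -> p = b'.
Proof.
move=> nc opp abE bcE abE' pqE e1 e2.
have [d bdE] := next_edge abE'.
have [s [s' [ssE e3]]] := opp _ _ bdE.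
have cr := corner_gt0 nc abE bcE; have cr' := corner_gt0 nc abE' bdE.
have /hull_edgesP[aV bV ab hab _] := abE; have /hull_edgesP[_ cV bc hbc _] := bcE.
have /hull_edgesP[aV' bV' ab' hab' _] := abE'; have /hull_edgesP[_ dV' bd hbd _] := bdE.
have /hull_edgesP[pV qV pq hpq hpq'] := pqE; have /hull_edgesP[sV sV' ss hss _] := ssE.
pose v1 := (b.1 - a.1, b.2 - a.2); pose v2 := (c.1 - b.1, c.2 - b.2).
pose z := (d.1 - b'.1, d.2 - b'.2); pose f := (p.1 - b'.1, p.2 - b'.2).
have D0 : 0 < det2 v1 v2.
  by apply: le_lt_trans cr _ || (move: cr; rewrite /orient /det2 /v1 /v2 /=; lra).
have e11 : b'.1 - a'.1 = a.1 - b.1 by case: (e1).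
have e12 : b'.2 - a'.2 = a.2 - b.2 by case: (e1).
have e21 : q.1 - p.1 = b.1 - c.1 by case: (e2).
have e22 : q.2 - p.2 = b.2 - c.2 by case: (e2).
have e31 : s'.1 - s.1 = b'.1 - d.1 by case: (e3).
have e32 : s'.2 - s.2 = b'.2 - d.2 by case: (e3).
have zv1 : 0 < det2 z v1.
  have -> : det2 z v1 = orient a' b' d.
    have -> : orient a' b' d = (b'.1 - a'.1) * (d.2 - b'.2) - (b'.2 - a'.2) * (d.1 - b'.1).
      by rewrite /orient; ring.
    by rewrite e11 e12 /det2 /=; ring.
  exact: cr'.
have B0 : 0 <= - det2 v1 f.
  have -> : - det2 v1 f = orient a' b' p.
    have -> : orient a' b' p = (b'.1 - a'.1) * (p.2 - b'.2) - (b'.2 - a'.2) * (p.1 - b'.1).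
      by rewrite /orient; ring.
    by rewrite e11 e12 /det2 /=; ring.
  exact: hab'.
have oA : orient p q b' = det2 v2 f.
  by rewrite /orient e21 e22 /det2 /=; ring.
have A0 : 0 <= det2 v2 f by rewrite -oA hpq.
apply/eqP/contraT => pb.
have f0 : f <> (0, 0).
  by case=> f1 f2; case/eqP: pb; apply: injective_projections; apply: subr0_eq.
have zf : 0 <= det2 z f.
  by have := hbd p pV.
have Did : det2 v1 v2 * det2 z f = - det2 v2 f * det2 z v1 + det2 v1 f * det2 z v2.
  by rewrite /det2; ring.
have h0 : 0 <= - det2 v2 f * det2 z v1 + det2 v1 f * det2 z v2.
  by rewrite -Did mulr_ge0 // ltW.
have Bp : 0 < - det2 v1 f.
  rewrite lt_neqAle B0 andbT eq_sym oppr_eq0; apply/eqP => B00.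
  move: h0; rewrite B00 mul0r addr0 mulNr oppr_ge0 => h0.
  case: f0; apply: (det2_eq0 D0 B00); apply/eqP; rewrite eq_le A0 andbT.
  by move: h0; rewrite pmulr_lle0.
have Ap : 0 < det2 v2 f.
  rewrite lt_neqAle A0 andbT eq_sym; apply/eqP => A00.
  have := hpq' b' bV'; rewrite oA => /(_ A00) /andP[+ _].
  apply/negP; rewrite -ltNge.
  have -> : along p q b' = v2.1 * f.1 + v2.2 * f.2.
    by rewrite /along e21 e22 /=; ring.
  have n0 := sqdist_gt0 bc.
  have : det2 v1 v2 * (v2.1 * f.1 + v2.2 * f.2) = det2 v1 f * ((c.1 - b.1) ^+ 2 + (c.2 - b.2) ^+ 2).
    have -> : det2 v1 f * ((c.1 - b.1) ^+ 2 + (c.2 - b.2) ^+ 2) =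
      det2 v1 v2 * (v2.1 * f.1 + v2.2 * f.2) + det2 v2 f * (v1.1 * v2.1 + v1.2 * v2.2).
      by rewrite /det2 /=; ring.
    by rewrite A00 mul0r addr0.
  move=> h; rewrite -(pmulr_rlt0 _ D0) h; rewrite pmulr_llt0 //; lra.
have zv2 : det2 z v2 < 0.
  rewrite ltNge; apply/negP => h.
  have t1 : det2 v1 f * det2 z v2 <= 0 by rewrite mulr_le0_ge0 //; lra.
  have t2 : 0 < det2 v2 f * det2 z v1 by exact: mulr_gt0.
  have t3 : det2 v1 f * det2 z v2 < det2 v2 f * det2 z v1 by exact: le_lt_trans t1 t2.
  by move: h0; rewrite mulNr addrC subr_ge0 leNgt t3.
have vtx x : x \in V -> 0 <= det2 z (x.1 - b.1, x.2 - b.2) -> x = b.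
  move=> xV hx; set g := (_, _) in hx.
  have P0 : 0 <= det2 v1 g.
    by have := hab x xV; congr (_ <= _); rewrite /orient /det2 /=; ring.
  have N0 : 0 <= det2 v2 g by exact: (hbc x xV).
  have id : det2 v1 v2 * det2 z g = - (det2 v2 g * det2 z v1) + det2 v1 g * det2 z v2.
    by rewrite /det2 /=; ring.
  have h1 : 0 <= det2 v2 g * det2 z v1 by rewrite mulr_ge0 // ltW.
  have h2 : det2 v1 g * det2 z v2 <= 0 by rewrite mulr_ge0_le0 // ltW.
  have h3 : 0 <= det2 v1 v2 * det2 z g by rewrite mulr_ge0 // ltW.
  have /eqP : det2 v2 g * det2 z v1 = 0 by lra.
  rewrite mulf_eq0 (gt_eqF zv1) orbF => /eqP k2.
  have /eqP : det2 v1 g * det2 z v2 = 0 by lra.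
  rewrite mulf_eq0 (lt_eqF zv2) orbF => /eqP k1.
  have [g1 g2] := det2_eq0 D0 k1 k2.
  by apply: injective_projections; apply: subr0_eq.
have sb : 0 <= det2 z (s.1 - b.1, s.2 - b.2).
  have := hss b bV; congr (_ <= _).
  by rewrite /orient e31 e32 /det2 /=; ring.
have sb' : 0 <= det2 z (s'.1 - b.1, s'.2 - b.2).
  move: sb; congr (_ <= _).
  have -> : det2 z (s'.1 - b.1, s'.2 - b.2) =
     det2 z (s.1 - b.1, s.2 - b.2) + (z.1 * (s'.2 - s.2) - z.2 * (s'.1 - s.1)).
    by rewrite /det2 /=; ring.
  by rewrite e31 e32 /=; ring.
by case/eqP: ss; rewrite (vtx s) // (vtx s').
Qed.

(** The center m is fixed by one edge, at the lowest vertex a0.  By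
    [opposite_next] the edges that m reflects to edges are stable under passing
    to the next or the previous edge.  A bad edge with lowest initial vertex
    then has its two neighbours bad as well, hence above it, so that it starts
    at a local, hence global, minimum, which is a0. *)
Lemma opposite_edges_center V : noncollinear V ->
  (forall x y, (x, y) \in hull_edges V ->
     exists x' y', (x', y') \in hull_edges V /\ y' - x' = x - y) ->
  exists m, forall a b, (a, b) \in hull_edges V -> (m - a, m - b) \in hull_edges V.
Proof.
move=> nc opp; have [w winj] := separating_direction V.
have [-> //|[e1 e1E]] : hull_edges V = [::] \/ exists e, e \in hull_edges V.
  by case: (hull_edges V) => [|e s]; [left|right; exists e; rewrite mem_head].
  by exists 0.
have [[a0 b0] e0E e0min] := seq_min (fun e => height w e.1) e1E.
have [a0' [b0' [e0E' ee0]]] := opp _ _ e0E.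
pose m := a0 + a0'; pose good e := (m - e.1, m - e.2) \in hull_edges V.
have good0 : good (a0, b0).
  rewrite /good /m /= addrAC subrr add0r.
  suff -> : a0 + a0' - b0 = b0' by [].
  by rewrite addrAC -ee0 subrK.
have good_next a b c : (a, b) \in hull_edges V -> (b, c) \in hull_edges V ->
    good (a, b) -> good (b, c).
  move=> abE bcE g; have [p [q [pqE e]]] := opp _ _ bcE.
  have pe : p = m - b.
    apply: (opposite_next nc opp abE bcE g pqE _ e) => /=.
    by apply: injective_projections => /=; ring.
  rewrite /good /= -pe; suff -> : m - c = q by [].
  move: (congr1 fst e) (congr1 snd e); rewrite pe /= => k1 k2.
  by apply: injective_projections => /=; lra.
have good_prev a b c : (a, b) \in hull_edges V -> (b, c) \in hull_edges V ->
    good (b, c) -> good (a, b).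
  move=> abE bcE g; have [p [q [pqE e]]] := opp _ _ abE.
  have qe : m - b = q.
    apply: (opposite_next nc opp abE bcE pqE g e) => /=.
    by apply: injective_projections => /=; ring.
  rewrite /good /= qe; suff -> : m - a = p by [].
  move: (congr1 fst e) (congr1 snd e); rewrite -qe /= => k1 k2.
  by apply: injective_projections => /=; lra.
exists m => a b abE; rewrite -/(good (a, b)).
apply: contraT => bad.
have : (a, b) \in [seq e <- hull_edges V | ~~ good e] by rewrite mem_filter bad.
move/(seq_min (fun e => height w e.1)) => {abE bad} [[{}a {}b]].
rewrite mem_filter => /andP[bad abE] min.
have [z zaE] := prev_edge abE; have [c bcE] := next_edge abE.
have wz : height w a <= height w z.
  apply: (min (z, a)); rewrite mem_filter zaE andbT.
  by apply: contra bad; apply: good_next.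
have wb : height w a <= height w b.
  apply: (min (b, c)); rewrite mem_filter bcE andbT.
  by apply: contra bad; apply: good_prev.
have D0 := corner_gt0 nc zaE abE.
have /hull_edgesP[zV aV _ hza _] := zaE; have /hull_edgesP[_ bV _ hab _] := abE.
have amin r : r \in V -> height w a <= height w r.
  move=> rV; have h1 := hza r rV; have h2 := hab r rV.
  rewrite -subr_ge0 -(pmulr_rge0 _ D0).
  have -> : orient z a b * (height w r - height w a) =
    orient a b r * (height w z - height w a) + orient z a r * (height w b - height w a).
    by rewrite /orient /height; ring.
  by rewrite addr_ge0 // mulr_ge0 // subr_ge0.
have /hull_edgesP[a0V _ _ _ _] := e0E.
have ea : a = a0.
  by apply: winj => //; apply/eqP; rewrite eq_le amin // (e0min (a, b)).
subst a; have eb := out_edge_unique abE e0E; subst b.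
by rewrite good0 in bad.
Qed.

End Hull3.

(** * Convex polygons and their faces *)

Section Polygon.
Variable R : realType.
Implicit Types (a b c d p q r u w x y : R * R) (S : set (R * R)) (V : seq (R * R)).

(** The third clause says that S lies in the closed convex hull of V; it is
    stated with linear forms because that is how it is applied, in particular
    to half-planes that are not bounded by edges. *)
Definition polygon_hull S V :=
  [/\ noncollinear V, forall r, r \in V -> S r,
      forall w t, (forall r, r \in V -> height w r <= t) ->
        forall y, S y -> height w y <= t &
      forall x, S x <-> forall a b, (a, b) \in hull_edges V -> 0 <= orient a b x].

Lemma segmentP a b x : segment a b x <->
  exists2 t : R, 0 <= t <= 1 & x = (a.1 + t * (b.1 - a.1), a.2 + t * (b.2 - a.2)).
Proof.
have E (t : R) : (1 - t) *: a + t *: b = (a.1 + t * (b.1 - a.1), a.2 + t * (b.2 - a.2)).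
  apply: injective_projections; rewrite /= /GRing.scale /=; ring.
split=> [[t /=]|[t t01 ->]].
  by rewrite in_itv /= => t01 <-; exists t => //; rewrite E.
by exists t; rewrite /= ?in_itv //= E.
Qed.

Lemma orient_ge0_halfplane V (K : set (R * R)) :
  (forall w t, (forall r, r \in V -> height w r <= t) ->
     forall y, K y -> height w y <= t) ->
  forall a b, (forall r, r \in V -> 0 <= orient a b r) ->
  forall x, K x -> 0 <= orient a b x.
Proof.
move=> hK a b hab x Kx; pose w := (b.2 - a.2, - (b.1 - a.1)).
have E y : orient a b y = height w a - height w y by rewrite /orient /height /=; ring.
rewrite E subr_ge0; apply: hK Kx => r rV; by have := hab r rV; rewrite E subr_ge0.
Qed.

Lemma convex_polygon_hull S : convex_polygon S -> exists V, polygon_hull S V.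
Proof.
case=> -[V0 [finV SE]] [ o0 oS].
have [V VE] : exists V : seq (R * R), V0 = [set` V] by apply/finite_seqP.
have VS r : r \in V -> S r.
  by move=> rV; rewrite SE => A [/= _ VA]; apply: VA; rewrite VE.
have SK (K : set (R * R)) : convex_set (K : set (convex_lmodType (R * R)%type)) -> (forall r, r \in V -> K r) -> S `<=` K.
  move=> cK VK x; rewrite SE => /(_ K); apply; split => // r; rewrite VE /=; exact: VK.
have Sconv p q (s : R) : S p -> S q -> 0 <= s <= 1 ->
    S (p.1 + s * (q.1 - p.1), p.2 + s * (q.2 - p.2)).
  move=> pS qS /andP[s0 s1]; rewrite SE => A [/= cA VA].
  have pA : A p by move: pS; rewrite SE; apply; split.
  have qA : A q by move: qS; rewrite SE; apply; split.
  have := cA q p (Itv01 s0 s1); rewrite !inE => /(_ qA pA).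
  congr (A _); apply: injective_projections; rewrite /= /GRing.scale /= /unstable.onem; ring.
have Shalf w t : (forall r, r \in V -> height w r <= t) -> forall y, S y -> height w y <= t.
  move=> h; apply: SK => // x y l; rewrite !inE /= => hx hy.
  have -> : height w (conv l x y) = l%:num * height w x + (1 - l%:num) * height w y.
    by rewrite /height /= /GRing.scale /= /unstable.onem; ring.
  have l0 : 0 <= l%:num by []. have l1 : 0 <= 1 - l%:num by rewrite subr_ge0.
  have := ler_wpM2l l0 hx; have := ler_wpM2l l1 hy; lra.
have /nbhs_ballP[e /= e0 eS] := oS.
have oeS y : `|y.1 - o0.1| < e -> `|y.2 - o0.2| < e -> S y.
  by move=> h1 h2; apply: eS; split; rewrite /= /ball /= distrC.
have nc : noncollinear V.
  move=> p q pq; apply: contrapT => h.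
  have h0 r : r \in V -> orient p q r = 0.
    by move=> rV; apply/eqP/negPn/negP => k; apply: h; exists r.
  have Sp x : S x -> 0 <= orient p q x.
    by move=> ?; apply: (orient_ge0_halfplane Shalf) => // r /h0 ->.
  have Sq x : S x -> 0 <= orient q p x.
    move=> ?; apply: (orient_ge0_halfplane Shalf) => // r /h0 k.
    suff -> : orient q p r = - orient p q r by rewrite k oppr0.
    by rewrite /orient; ring.
  have S0 x : S x -> orient p q x = 0.
    move=> Sx; apply/eqP; rewrite eq_le Sp // andbT -oppr_ge0.
    have -> : - orient p q x = orient q p x by rewrite /orient; ring.
    exact: Sq.
  have oo : orient p q o0 = 0 by apply/S0/oeS; rewrite subrr normr0.
  have n1 : `|e / 2| < e by rewrite ger0_norm; lra.
  have o1 : orient p q (o0.1 + e / 2, o0.2) = 0.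
    by apply/S0/oeS => /=; rewrite ?subrr ?normr0 // addrAC subrr add0r.
  have o2 : orient p q (o0.1, o0.2 + e / 2) = 0.
    by apply/S0/oeS => /=; rewrite ?subrr ?normr0 // addrAC subrr add0r.
  case/negP: pq; apply/eqP/injective_projections.
    apply/eqP; rewrite eq_sym -subr_eq0; apply/eqP/(mulIf (lt0r_neq0 e0)).
    by move: oo o1 o2; rewrite /orient /=; lra.
  apply/eqP; rewrite eq_sym -subr_eq0; apply/eqP/(mulIf (lt0r_neq0 e0)).
  by move: oo o1 o2; rewrite /orient /=; lra.
exists V; split => // x; split => [Sx a b /hull_edgesP[_ _ _ hab _]|].
  exact: (orient_ge0_halfplane Shalf).
exact: (hull_interE VS Sconv Shalf e0 oeS).
Qed.

Section Hulled.
Variables (S : set (R * R)) (V : seq (R * R)).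
Hypothesis SV : polygon_hull S V.
Let nc : noncollinear V. Proof. by case: SV. Qed.
Let VS r : r \in V -> S r. Proof. by case: SV => _ + _ _; apply. Qed.
Let SE x : S x <-> forall a b, (a, b) \in hull_edges V -> 0 <= orient a b x.
Proof. by case: SV => _ _ _; apply. Qed.

Lemma polygon_bounded : exists B : nat, forall x, S x -> `|x.1| <= B%:R /\ `|x.2| <= B%:R.
Proof.
have [B hB] : exists B : nat, forall r, r \in V -> `|r.1| <= B%:R /\ `|r.2| <= B%:R.
  elim: (V) => [|r s [B IH]]; first by exists 0%N.
  exists (maxn B (maxn (Num.truncn `|r.1|).+1 (Num.truncn `|r.2|).+1)) => q.
  rewrite inE => /orP[/eqP ->|/IH[h1 h2]]; last first.
    by split; [apply: le_trans h1 _|apply: le_trans h2 _]; rewrite ler_nat leq_maxl.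
  split; [apply: le_trans (ltW (truncnS_gt `|r.1|)) _|
          apply: le_trans (ltW (truncnS_gt `|r.2|)) _]; rewrite ler_nat !leq_max !leqnn ?orbT //.
exists B => x Sx; case: SV => _ _ half _.
have E1 y : height (1, 0) y = y.1 by rewrite /height /=; ring.
have E2 y : height (-1, 0) y = - y.1 by rewrite /height /=; ring.
have E3 y : height (0, 1) y = y.2 by rewrite /height /=; ring.
have E4 y : height (0, -1) y = - y.2 by rewrite /height /=; ring.
split; rewrite ler_norml lerNl.
  rewrite -(E2 x) -(E1 x); apply/andP; split; apply: half Sx => r /hB[+ _];
    by rewrite ler_norml ?E1 ?E2 lerNl => /andP[].
rewrite -(E4 x) -(E3 x); apply/andP; split; apply: half Sx => r /hB[_ +];
  by rewrite ler_norml ?E3 ?E4 lerNl => /andP[].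
Qed.

(** The two neighbouring edges cut the ends of the segment off the line. *)
Lemma edge_line_segment a b x : (a, b) \in hull_edges V -> S x -> orient a b x = 0 ->
  segment a b x.
Proof.
move=> abE /SE Sx o0; have [c bcE] := next_edge abE; have [z zaE] := prev_edge abE.
have /hull_edgesP[_ _ ab _ _] := abE.
have [s [es _ _]] := on_line ab o0; apply/segmentP; exists s => //.
have D1 := corner_gt0 nc abE bcE; have D2 := corner_gt0 nc zaE abE.
have h1 := Sx _ _ bcE; have h2 := Sx _ _ zaE; apply/andP; split.
  rewrite -(pmulr_lge0 _ D2).
  have <- // : orient z a x = s * orient z a b by rewrite es /orient /=; ring.
rewrite -subr_ge0 -(pmulr_lge0 _ D1).
have <- // : orient b c x = (1 - s) * orient a b c by rewrite es /orient /=; ring.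
Qed.

Lemma hull_edge_face a b : (a, b) \in hull_edges V ->
  face S (b.2 - a.2, - (b.1 - a.1)) = segment a b.
Proof.
move=> abE; have /hull_edgesP[aV bV ab _ _] := abE.
have E y : dot (b.2 - a.2, - (b.1 - a.1)) y = dot (b.2 - a.2, - (b.1 - a.1)) a - orient a b y.
  by rewrite /orient /dot /=; ring.
have oa : orient a b a = 0 by rewrite /orient; ring.
apply/seteqP; split=> x.
  move=> [Sx mx]; apply: edge_line_segment => //; apply/eqP.
  have /SE /(_ _ _ abE) := Sx; have := mx a (VS aV); rewrite (E x); lra.
have /SE Sa := VS aV; have /SE Sb := VS bV.
move=> /segmentP[t /andP[t0 t1] ->]; split.
  apply/SE => c d cdE.
  have -> : orient c d (a.1 + t * (b.1 - a.1), a.2 + t * (b.2 - a.2)) =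
    (1 - t) * orient c d a + t * orient c d b by rewrite /orient /=; ring.
  by rewrite addr_ge0 // mulr_ge0 ?Sa ?Sb // subr_ge0.
move=> y /SE /(_ _ _ abE) h; rewrite (E (_, _)) (E y) lerD2l lerN2.
suff -> : orient a b (a.1 + t * (b.1 - a.1), a.2 + t * (b.2 - a.2)) = 0 by [].
by rewrite /orient /=; ring.
Qed.

Lemma hull_edge_edge a b : (a, b) \in hull_edges V -> edge S a b.
Proof.
move=> abE; have /hull_edgesP[aV bV ab _ _] := abE; split => //.
exists (b.2 - a.2, - (b.1 - a.1)); last exact: hull_edge_face.
apply: contra ab => /eqP[h1 h2]; apply/eqP/injective_projections.
  by move: h2; lra.
by move: h1; lra.
Qed.

(** The midpoint of a face is not interior to S, so it lies on a hull edge,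
    as do then both ends; since the face contains the whole of that edge, the
    two segments have the same ends. *)
Lemma edge_hull_edge a b : edge S a b ->
  (a, b) \in hull_edges V \/ (b, a) \in hull_edges V.
Proof.
case=> ab [u u0 fu].
have segS x : segment a b x -> S x /\ forall y, S y -> dot u y <= dot u x.
  by rewrite -fu => -[].
have sa : segment a b a by apply/segmentP; exists 0; rewrite ?lexx ?ler01 // !mul0r !addr0 -surjective_pairing.
have sb : segment a b b.
  apply/segmentP; exists 1; rewrite ?lexx ?ler01 // !mul1r.
  by apply: injective_projections => /=; ring.
have sm : segment a b (midpoint a b).
  apply/segmentP; exists 2^-1; first by apply/andP; split; lra.
  by apply: injective_projections; rewrite /= /GRing.scale /=; field.
have [Sm mm] := segS _ sm.
have [Sa ma] := segS _ sa; have [Sb mb] := segS _ sb.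
have n0 : 0 < u.1 ^+ 2 + u.2 ^+ 2.
  have := @sqdist_gt0 _ (0, 0) u; rewrite /= !subr0; apply; by rewrite eq_sym.
have [[c d] cdE om] : exists2 e, e \in hull_edges V & orient e.1 e.2 (midpoint a b) = 0.
  apply: contrapT => h.
  have pos e : e \in hull_edges V -> 0 < orient e.1 e.2 (midpoint a b).
    move=> eE; rewrite lt_neqAle; apply/andP; split.
      by apply/eqP => /esym k; apply: h; exists e.
    by have /SE := Sm; apply; rewrite -surjective_pairing.
  pose m := midpoint a b.
(* otherwise the midpoint can be moved in the direction u inside S *)
  have [t t0 tS] : exists2 t, 0 < t & forall e, e \in hull_edges V ->
      0 <= orient e.1 e.2 (m.1 + t * u.1, m.2 + t * u.2).
    elim: (hull_edges V) pos => [_|e s IH pos]; first by exists 1.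
    have [|t t0 ht] := IH; first by move=> e' e's; apply: pos; rewrite inE e's orbT.
    have p0 := pos e (mem_head _ _); rewrite -/m in p0.
    pose B := (e.2.1 - e.1.1) * u.2 - (e.2.2 - e.1.2) * u.1.
    have Bp : 0 < 1 + `|B| by have := normr_ge0 B; lra.
    pose t' := Num.min t (orient e.1 e.2 m / (1 + `|B|)).
    have t'0 : 0 < t' by rewrite lt_min t0 divr_gt0.
    exists t' => // e'; rewrite inE => /orP[/eqP ->|e's].
      have -> : orient e.1 e.2 (m.1 + t' * u.1, m.2 + t' * u.2) = orient e.1 e.2 m + t' * B.
        by rewrite /orient /B /=; ring.
      have : t' * (1 + `|B|) <= orient e.1 e.2 m by rewrite -ler_pdivlMr // ge_min lexx orbT.
      have : - `|B| <= B by rewrite lerNl ler_normr lexx orbT.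
      move/(ler_wpM2l (ltW t'0)); rewrite mulrDr mulrN; lra.
    have h1 := ht e' e's; have h0 := pos e'; rewrite inE e's orbT in h0.
    have {}h0 := h0 isT; rewrite -/m in h0.
    have tt : 0 <= t' / t <= 1.
      apply/andP; split; first exact: divr_ge0 (ltW t'0) (ltW t0).
      by rewrite ler_pdivrMr // mul1r ge_min lexx.
    have -> : orient e'.1 e'.2 (m.1 + t' * u.1, m.2 + t' * u.2) =
      (1 - t' / t) * orient e'.1 e'.2 m + t' / t * orient e'.1 e'.2 (m.1 + t * u.1, m.2 + t * u.2).
      by rewrite /orient /=; field; rewrite gt_eqF.
    case/andP: tt => tt0 tt1.
    apply: addr_ge0; apply: mulr_ge0 => //; last exact: ltW.
    by rewrite subr_ge0.
  have Sm' : S (m.1 + t * u.1, m.2 + t * u.2).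
    by apply/SE => c d cdE; exact: (tS (c, d)).
  have := mm _ Sm'.
  have -> : dot u (m.1 + t * u.1, m.2 + t * u.2) = dot u m + t * (u.1 ^+ 2 + u.2 ^+ 2).
    by rewrite /dot /=; ring.
  by rewrite -/m gerDl leNgt mulr_gt0.
rewrite /= in om.
have om2 : orient c d a + orient c d b = 2 * orient c d (midpoint a b).
  by rewrite /orient /midpoint /= /GRing.scale /=; field.
have oa0 : 0 <= orient c d a by have /SE := Sa; apply.
have ob0 : 0 <= orient c d b by have /SE := Sb; apply.
have oa : orient c d a = 0 by lra. have ob : orient c d b = 0 by lra.
have /segmentP[s /andP[s0 s1] es] := edge_line_segment cdE Sa oa.
have /segmentP[t /andP[t0 t1] et] := edge_line_segment cdE Sb ob.
have st : s != t by apply: contra ab => /eqP st; apply/eqP; rewrite es et st.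
have /hull_edgesP[cV dV cd _ _] := cdE.
have dab : dot u a = dot u b by apply/eqP; rewrite eq_le ma ?mb.
have ducd : dot u d = dot u c.
  have : (s - t) * (dot u d - dot u c) = 0.
    have -> : (s - t) * (dot u d - dot u c) = dot u a - dot u b.
      by rewrite es et /dot /=; ring.
    by rewrite dab subrr.
  by move/eqP; rewrite mulf_eq0 subr_eq0 (negbTE st) subr_eq0 => /eqP.
have dac : dot u a = dot u c.
  have -> : dot u a = dot u c + s * (dot u d - dot u c) by rewrite es /dot /=; ring.
  by rewrite ducd subrr mulr0 addr0.
have fc : segment a b c by rewrite -fu; split; [exact: VS|rewrite -dac].
have fd : segment a b d by rewrite -fu; split; [exact: VS|rewrite ducd -dac].
have /segmentP[k /andP[k0 k1] ek] := fc; have /segmentP[l /andP[l0 l1] el] := fd.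
have param (f : R) x : x = (c.1 + f * (d.1 - c.1), c.2 + f * (d.2 - c.2)) ->
    x = c -> f = 0.
  move=> -> e; have n1 := sqdist_gt0 cd.
  have e1 : f * (d.1 - c.1) = 0 by move: (congr1 fst e) => /=; lra.
  have e2 : f * (d.2 - c.2) = 0 by move: (congr1 snd e) => /=; lra.
  have /eqP : f * ((d.1 - c.1) ^+ 2 + (d.2 - c.2) ^+ 2) = 0.
    rewrite mulrDr !expr2 !mulrA e1 e2; ring.
  by rewrite mulf_eq0 (gt_eqF n1) orbF => /eqP.
have hc : (1 - k) * s + k * t = 0.
  by apply: (param _ c) => //; rewrite {1}ek es et /=; congr (_, _); ring.
have hd : (1 - l) * s + l * t - 1 = 0.
  apply: (param _ (d.1 - (d.1 - c.1), d.2 - (d.2 - c.2))); last first.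
    by apply: injective_projections => /=; ring.
  move: (congr1 fst el) (congr1 snd el); rewrite es et /= => l1' l2'.
  by congr (_, _); [rewrite {1}l1'|rewrite {1}l2']; ring.
have ts (f : R) : f * (t - s) = f * t - f * s by rewrite mulrBr.
have [lt|gt] : s < t \/ t < s by apply/orP; rewrite -neq_lt.
  have ts0 : 0 <= t - s by rewrite subr_ge0 ltW.
  have := mulr_ge0 k0 ts0; have := mulr_ge0 (_ : 0 <= 1 - l) ts0; rewrite subr_ge0 ts => /(_ l1) hl hk.
  left; have -> : a = c.
    by rewrite es (_ : s = 0) ?mul0r ?addr0 -?surjective_pairing //; lra.
  suff -> : b = d by [].
  by rewrite et (_ : t = 1) ?mul1r; [apply: injective_projections => /=; ring|lra].
have ts0 : 0 <= s - t by rewrite subr_ge0 ltW.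
have := mulr_ge0 l0 ts0; have := mulr_ge0 (_ : 0 <= 1 - k) ts0; rewrite subr_ge0 => /(_ k1) hk hl.
right; have -> : b = c.
  by rewrite et (_ : t = 0) ?mul0r ?addr0 -?surjective_pairing //; lra.
suff -> : a = d by [].
by rewrite es (_ : s = 1) ?mul1r; [apply: injective_projections => /=; ring|lra].
Qed.

End Hulled.
End Polygon.

(** * The group generated by the rotation vector and the integer vectors *)

Notation triple := (int * (int * int))%type.

Section Lattice.
Variables (R : realType) (alpha : R * R).
Implicit Types (g h : triple) (x z v : R * R).

(** Integer triples index the group injectively when alpha is irrational;
    lemma names abbreviate this map to gpt. *)
Definition orbit_point g : R * R :=
  (g.1%:~R * alpha.1 + g.2.1%:~R, g.1%:~R * alpha.2 + g.2.2%:~R).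

Local Notation gpt := orbit_point.

Lemma gptE n m : gpt (n, m) = alpha *~ n + Z2 m.
Proof.
have fM (x : R * R) (k : int) : x *~ k = (x.1 *~ k, x.2 *~ k).
  by apply: injective_projections; [apply: (raddfMz (@fst R R))|apply: (raddfMz (@snd R R))].
by apply: injective_projections; rewrite fM /= mulrzl.
Qed.

Lemma gptD g h : gpt (g + h) = gpt g + gpt h.
Proof. by apply: injective_projections; rewrite /= !intrD; ring. Qed.

Lemma gptN g : gpt (- g) = - gpt g.
Proof. by apply: injective_projections; rewrite /= !intrN; ring. Qed.

Lemma tripleMz g (k : int) : g *~ k = (g.1 * k, (g.2.1 * k, g.2.2 * k)).
Proof.
have fM (U W : zmodType) (x : U * W) : x *~ k = (x.1 *~ k, x.2 *~ k).
  by apply: injective_projections; [apply: (raddfMz (@fst U W))|apply: (raddfMz (@snd U W))].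
by rewrite !fM /= !mulrzz.
Qed.

Lemma gptMz g (k : int) : gpt (g *~ k) = (k%:~R * (gpt g).1, k%:~R * (gpt g).2).
Proof. by rewrite tripleMz; congr (_, _); rewrite /= !intrM; ring. Qed.

Lemma Zalpha_Z2P x : Zalpha_Z2 alpha x <-> exists g, x = gpt g.
Proof.
split=> [[n [m ->]]|[[n m] ->]]; last by exists n, m; rewrite gptE.
by exists (n, m); rewrite gptE.
Qed.

Hypothesis irr : irrational_vector alpha.

Lemma irr_int (p q r : int) : p%:~R + q%:~R * alpha.1 + r%:~R * alpha.2 = 0 ->
  [/\ p = 0, q = 0 & r = 0].
Proof.
move=> h; have [] := irr (p := p%:~R) (q := q%:~R) (r := r%:~R).
  by rewrite !ratr_int.
by move=> /eqP + /eqP + /eqP; rewrite !intr_eq0 => /eqP -> /eqP -> /eqP ->.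
Qed.

(** A vanishing determinant of two group elements is a rational relation
    between 1 and the coordinates of alpha, whose coefficients are the minors
    of the two triples. *)
Lemma gpt_det g h : det2 (gpt g) (gpt h) = 0 ->
  [/\ g.1 * h.2.1 = h.1 * g.2.1, g.1 * h.2.2 = h.1 * g.2.2 &
      g.2.1 * h.2.2 = g.2.2 * h.2.1].
Proof.
rewrite /det2 /= => e.
have [] := @irr_int (g.2.1 * h.2.2 - g.2.2 * h.2.1) (g.1 * h.2.2 - h.1 * g.2.2)
  (h.1 * g.2.1 - g.1 * h.2.1).
  by rewrite !intrB !intrM -[RHS]e; ring.
by split; lia.
Qed.

Lemma gpt_eq0 g : gpt g = (0, 0) -> g = 0.
Proof.
case: g => n [m1 m2] [/= e1 e2].
have [] := @irr_int m1 n 0; first by rewrite mul0r; lra.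
have [] := @irr_int m2 0 n; first by rewrite mul0r; lra.
by move=> -> _ -> -> _ _.
Qed.

(** Pigeonhole on the multiples of alpha by multiples of N + 1, in a
    partition of the torus into squares of side less than d. *)
Lemma small_return (N : nat) (d : R) : 0 < d ->
  exists n m, [/\ N%:Z < n, `|(gpt (n, m)).1| < d & `|(gpt (n, m)).2| < d].
Proof.
move=> d0; pose fr (x : R) := x - (Num.floor x)%:~R.
have fr0 (x : R) : 0 <= fr x by rewrite subr_ge0 floor_le.
have fr1 (x : R) : fr x < 1 by have := floorD1_gt x; rewrite /fr intrD; lra.
pose K := (Num.truncn d^-1).+1.
have K0 : (0 : R) < K%:R by rewrite ltr0n.
have Kd : K%:R^-1 < d.
  by rewrite invf_plt // /K; apply: Num.Theory.truncnS_gt.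
pose cell (x : R) : 'I_K := inord (Num.truncn (K%:R * fr x)).
have cellE (x y : R) : cell x = cell y -> `|fr x - fr y| < d.
  move=> e; have tr (z : R) : (Num.truncn (K%:R * fr z) < K)%N.
    rewrite truncn_lt_nat ?mulr_ge0 // ?ltW //.
    by rewrite -[ltRHS]mulr1 ltr_pM2l.
  have e' : Num.truncn (K%:R * fr x) = Num.truncn (K%:R * fr y).
    by have := congr1 val e; rewrite /= !inordK.
  have ge0 (z : R) : 0 <= K%:R * fr z by rewrite mulr_ge0 // ltW.
  have /andP[h1 h2] := truncn_itv (ge0 x); have /andP[h3 h4] := truncn_itv (ge0 y).
  rewrite e' in h1 h2; rewrite -natr1 in h2 h4.
  apply: lt_trans Kd; rewrite -[X in _ < X]mul1r ltr_pdivlMr //.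
  rewrite -[X in _ * X](gtr0_norm K0) -normrM mulrBl ![fr _ * _]mulrC ltr_norml.
  by apply/andP; split; lra.
pose f (j : 'I_(K * K).+1) : 'I_K * 'I_K :=
  (cell ((j * N.+1)%N%:R * alpha.1), cell ((j * N.+1)%N%:R * alpha.2)).
have /injectivePn[i [j ij fij]] : ~~ injectiveb f.
  apply/negP => /injectiveP/leq_card; rewrite card_prod !card_ord; lia.
wlog lt_ij : i j ij fij / (i < j)%N.
  move=> H; have : (i < j)%N || (j < i)%N.
    by rewrite -neq_ltn; apply: contra ij => /eqP h; apply/eqP/val_inj.
  by case/orP; apply: H => //; rewrite eq_sym.
move: fij => [/cellE h1 /cellE h2].
exists ((j - i) * N.+1)%N%:Z, (Num.floor ((i * N.+1)%N%:R * alpha.1) - Num.floor ((j * N.+1)%N%:R * alpha.1),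
  Num.floor ((i * N.+1)%N%:R * alpha.2) - Num.floor ((j * N.+1)%N%:R * alpha.2)).
split; first by nia.
  rewrite distrC in h1; move: h1; congr (`|_| < d).
  by rewrite /fr /= -pmulrn mulnBl natrB ?leq_mul2r ?(ltnW lt_ij) ?orbT // intrB; ring.
rewrite distrC in h2; move: h2; congr (`|_| < d).
by rewrite /fr /= -pmulrn mulnBl natrB ?leq_mul2r ?(ltnW lt_ij) ?orbT // intrB; ring.
Qed.

(** The second element returns so much closer to 0 than the first that it
    cannot be collinear with it: collinear triples are proportional, and the
    factor is controlled by the return time n1 of the first. *)
Lemma small_basis (d : R) : 0 < d ->
  exists g h, [/\ `|(gpt g).1| < d, `|(gpt g).2| < d, `|(gpt h).1| < d, `|(gpt h).2| < d
    & det2 (gpt g) (gpt h) != 0].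
Proof.
move=> d0; have [n1 [m1 [n10 s1 s1']]] := small_return 0 d0.
have g0 : 0 < Num.max `|(gpt (n1, m1)).1| `|(gpt (n1, m1)).2|.
  rewrite lt_max !normr_gt0 -negb_and; apply/negP => /andP[/eqP e1 /eqP e2].
  have : gpt (n1, m1) = (0, 0) by rewrite [gpt _]surjective_pairing e1 e2.
  by move/gpt_eq0 => [e _]; rewrite e in n10.
have n1R : (0 : R) < n1%:~R by rewrite ltr0z.
set mx := Num.max _ _ in g0.
have [|n2 [m2 [n20 s2 s2']]] := @small_return 0 (Num.min d (mx / n1%:~R)).
  by rewrite lt_min d0 divr_gt0.
move: s2 s2'; rewrite !lt_min => /andP[s2 t2] /andP[s2' t2'].
exists (n1, m1), (n2, m2); split => //; apply/eqP => /gpt_det[/= e1 e2 _].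
have n2R : (1 : R) <= n2%:~R by rewrite (ler_int _ 1).
have c1 : n1%:~R * (gpt (n2, m2)).1 = n2%:~R * (gpt (n1, m1)).1.
  by rewrite /= !mulrDr -!intrM e1; ring.
have c2 : n1%:~R * (gpt (n2, m2)).2 = n2%:~R * (gpt (n1, m1)).2.
  by rewrite /= !mulrDr -!intrM e2; ring.
have k (x y : R) : n1%:~R * x = n2%:~R * y -> `|x| < mx / n1%:~R -> `|y| < mx.
  move=> e lt; have : `|y| <= n1%:~R * `|x|.
    rewrite -{1}(gtr0_norm n1R) -normrM e normrM ger0_norm; last lra.
    by rewrite ler_peMl.
  move/le_lt_trans; apply; by rewrite -ltr_pdivlMl // mulrC.
have := k _ _ c1 t2; have := k _ _ c2 t2'.
by rewrite /mx !lt_max !ltxx /= orbF => h1 h2; have := lt_trans h1 h2; rewrite ltxx.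
Qed.

Lemma gpt_dense z (d : R) : 0 < d ->
  exists g, `|(gpt g).1 - z.1| < d /\ `|(gpt g).2 - z.2| < d.
Proof.
move=> d0; have d2 : 0 < d / 2 by lra.
have [g [h [g1 g2 h1 h2 D]]] := small_basis d2.
set D' := det2 _ _ in D.
pose s := det2 z (gpt h) / D'; pose t := det2 (gpt g) z / D'.
have z1 : z.1 = s * (gpt g).1 + t * (gpt h).1.
  by rewrite /s /t; move: D; rewrite /D' /det2 => D; field.
have z2 : z.2 = s * (gpt g).2 + t * (gpt h).2.
  by rewrite /s /t; move: D; rewrite /D' /det2 => D; field.
have fl (x y : R) : `|y| < d / 2 -> `|(Num.floor x)%:~R * y - x * y| < d / 2.
  move=> yd; rewrite -mulrBl normrM distrC.
  have f0 : 0 <= x - (Num.floor x)%:~R by rewrite subr_ge0 floor_le.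
  have f1 : x - (Num.floor x)%:~R < 1 by have := floorD1_gt x; rewrite intrD; lra.
  apply: le_lt_trans yd; rewrite (ger0_norm f0) -[X in _ <= X]mul1r.
  by apply: ler_wpM2r; [exact: normr_ge0|exact: ltW].
exists (g *~ Num.floor s + h *~ Num.floor t); rewrite gptD !gptMz /= -/(gpt g).1 -/(gpt h).1; split.
  have := fl s _ g1; have := fl t _ h1; rewrite z1 /= !ltr_norml => /andP[? ?] /andP[? ?].
  by apply/andP; split; lra.
have := fl s _ g2; have := fl t _ h2; rewrite z2 /= !ltr_norml => /andP[? ?] /andP[? ?].
by apply/andP; split; lra.
Qed.

(** Density at arbitrarily late times: a late and small return is added to
    any approximation. *)
Lemma gpt_dense_late z (d : R) (N : nat) : 0 < d ->
  exists g, [/\ N%:Z < g.1, `|(gpt g).1 - z.1| < d & `|(gpt g).2 - z.2| < d].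
Proof.
move=> d0; have d2 : 0 < d / 2 by lra.
have [g [g1 g2]] := gpt_dense z d2.
have [n [m [nN s1 s2]]] := small_return (N + `|g.1|)%N d2.
exists (g + (n, m)); split; first by rewrite /=; lia.
  move: g1 s1; rewrite gptD /= !ltr_norml => /andP[? ?] /andP[? ?].
  by apply/andP; split; lra.
move: g2 s2; rewrite gptD /= !ltr_norml => /andP[? ?] /andP[? ?].
by apply/andP; split; lra.
Qed.

Lemma gpt_dense_early z (d : R) (N : nat) : 0 < d ->
  exists g, [/\ g.1 < - N%:Z, `|(gpt g).1 - z.1| < d & `|(gpt g).2 - z.2| < d].
Proof.
move=> d0; have [g [h1 h2 h3]] := gpt_dense_late (- z) N d0.
exists (- g); split; rewrite ?gptN /=; first by lia.
  by move: h2; rewrite /= opprK -normrN opprD.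
by move: h3; rewrite /= opprK -normrN opprD.
Qed.

(** The triples of group elements parallel to v are proportional to each
    other, so the inner product c with one of them, g1, determines them.  The
    element with least positive value of c generates. *)
Lemma gpt_line_cyclic v : v != (0, 0) ->
  exists (tau : R) (g0 : triple), [/\ 0 <= tau, gpt g0 = (tau * v.1, tau * v.2) &
    forall g t, gpt g = (t * v.1, t * v.2) -> exists j : int, g = g0 *~ j].
Proof.
move=> v0; pose L g := exists t, gpt g = (t * v.1, t * v.2).
have Lpar g h : L g -> L h -> det2 (gpt g) (gpt h) = 0.
  by move=> [s ->] [t ->]; rewrite /det2 /=; ring.
have [[g1 [L1 n1]]|none] := pselect (exists g, L g /\ g != 0); last first.
  exists 0, 0; split => //; first by rewrite !mul0r /gpt /= !mul0r !addr0.
  move=> g t gt; exists 0; rewrite mulr0z; apply: contrapT => /eqP gn.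
  by apply: none; exists g; split => //; exists t.
pose c g := g.1 * g1.1 + g.2.1 * g1.2.1 + g.2.2 * g1.2.2.
have cD g h : c (g + h) = c g + c h by rewrite /c /=; ring.
have cM g (k : int) : c (g *~ k) = c g * k by rewrite tripleMz /c /=; ring.
have c1 : c g1 != 0.
  rewrite /c -!expr2 !paddr_eq0 ?addr_ge0 ?sqr_ge0 // !sqrf_eq0 -andbA.
  apply: contra n1 => /and3P[/eqP e1 /eqP e2 /eqP e3]; apply/eqP.
  by rewrite [g1]surjective_pairing [g1.2]surjective_pairing e1 e2 e3.
have cP h : L h -> c h = 0 -> h = 0.
  move=> Lh h0; have [e1 e2 e3] := gpt_det (Lpar _ _ Lh L1).
  have z (x y : int) : x * c g1 = y * c h -> x = 0.
    by rewrite h0 mulr0 => /eqP; rewrite mulf_eq0 (negbTE c1) orbF => /eqP.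
  have z1 : h.1 = 0.
    apply: (z _ g1.1); transitivity (g1.1 * c h + g1.2.1 * (h.1 * g1.2.1 - g1.1 * h.2.1) +
      g1.2.2 * (h.1 * g1.2.2 - g1.1 * h.2.2)); first by rewrite /c; ring.
    by rewrite e1 e2 !subrr !mulr0 !addr0.
  have z2 : h.2.1 = 0.
    apply: (z _ g1.2.1); transitivity (g1.2.1 * c h - g1.1 * (h.1 * g1.2.1 - g1.1 * h.2.1) +
      g1.2.2 * (h.2.1 * g1.2.2 - h.2.2 * g1.2.1)); first by rewrite /c; ring.
    by rewrite e1 e3 !subrr !mulr0 subr0 addr0.
  have z3 : h.2.2 = 0.
    apply: (z _ g1.2.2); transitivity (g1.2.2 * c h - g1.1 * (h.1 * g1.2.2 - g1.1 * h.2.2) -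
      g1.2.1 * (h.2.1 * g1.2.2 - h.2.2 * g1.2.1)); first by rewrite /c; ring.
    by rewrite e2 e3 !subrr !mulr0 !subr0.
  by rewrite [h]surjective_pairing [h.2]surjective_pairing z1 z2 z3.
have LB g h (k : int) : L g -> L h -> L (g - h *~ k).
  move=> [s es] [t et]; exists (s - k%:~R * t).
  by rewrite gptD gptN gptMz es et; apply: injective_projections => /=; ring.
have LN g : L g -> L (- g).
  move=> [s es]; exists (- s); rewrite gptN es.
  by apply: injective_projections => /=; ring.
have cN g : c (- g) = - c g.
  by have := cM g (-1); rewrite mulrN1z mulrN1.
pose P (k : nat) := `[< (0 < k)%N /\ exists2 g, L g & c g = k%:Z >].
have exP : exists k, P k.
  exists `|c g1|%N; apply/asboolP; split; first by rewrite absz_gt0.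
  have [pos|neg] := ltP 0 (c g1); first by exists g1 => //; lia.
  by exists (- g1); [exact: LN|rewrite cN; lia].
case: (ex_minnP exP) => k0 /asboolP[k00 [g0 L0 cg0]] kmin.
have gen g : L g -> exists j : int, g = g0 *~ j.
  move=> Lg; exists (c g %/ k0%:Z)%Z; apply/eqP; rewrite -subr_eq0; apply/eqP.
  set q := (_ %/ _)%Z; have Lr := LB g g0 q Lg L0.
  apply: cP => //; have cr : c (g - g0 *~ q) = (c g %% k0%:Z)%Z.
    by rewrite cD cN cM cg0 /q; have := divz_eq (c g) k0%:Z; lia.
  have r0 : 0 <= (c g %% k0%:Z)%Z by apply: modz_ge0; lia.
  have rk : (c g %% k0%:Z)%Z < k0%:Z by apply: ltz_pmod; lia.
  apply/eqP/negPn/negP => rn.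
  have kr : (k0 <= absz (c (g - g0 *~ q)%R))%N.
    apply: kmin; apply/asboolP; split; first by rewrite absz_gt0.
    by exists (g - g0 *~ q) => //; rewrite cr; lia.
  by move: kr; rewrite cr; lia.
have [t0 et0] := L0.
have [pos|neg] := leP 0 t0.
  by exists t0, g0; split => // g t gt; apply: gen; exists t.
exists (- t0), (- g0); split; first by rewrite oppr_ge0 ltW.
  by rewrite gptN et0; apply: injective_projections => /=; ring.
move=> g t gt; have [|j ->] := gen g; first by exists t.
by exists (- j); rewrite mulNrz mulrNz opprK.
Qed.

End Lattice.

(** * Null sets of the plane *)

Section Null.
Variable R : realType.
Notation mR := (measurableTypeR R).

Lemma measurable_affine (c1 c2 : R) : measurable_fun setT (fun x : mR * mR => c1 * x.1 + c2 * x.2).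
Proof.
apply: measurable_funD; apply: measurable_funM.
- exact: measurable_cst.
- exact: measurable_fst.
- exact: measurable_cst.
- exact: measurable_snd.
Qed.

Lemma mes2_setX (A B : set mR) : measurable A -> measurable B ->
  mes2 (A `*` B) = (@lebesgue_measure R A * @lebesgue_measure R B)%E.
Proof. by move=> mA mB; exact: (product_measure1E (@lebesgue_measure R) (@lebesgue_measure R)). Qed.

Lemma mes2_sections (A : set (mR * mR)) :
  mes2 A = (\int[@lebesgue_measure R]_x (@lebesgue_measure R (xsection A x)))%E.
Proof. by []. Qed.

Lemma line_negligible (c1 c2 c0 : R) : (c1, c2) != (0, 0) ->
  mes2.-negligible [set x : mR * mR | c1 * x.1 + c2 * x.2 = c0].
Proof.
move=> c12; have mA : measurable [set x : mR * mR | c1 * x.1 + c2 * x.2 = c0].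
  have := measurable_affine c1 c2 measurableT (measurable_set1 c0).
  by rewrite setTI.
apply: negligibleS (_ : _ `<=` [set x : mR * mR | c1 * x.1 + c2 * x.2 = c0]) _ => //.
apply/negligibleP => //.
have [c20|c20] := eqVneq c2 0.
  have c10 : c1 != 0 by move: c12; rewrite c20 -pair_eqE /= /pair_eq /= eqxx andbT.
  have -> : [set x : mR * mR | c1 * x.1 + c2 * x.2 = c0] = [set c0 / c1] `*` setT.
    apply/seteqP; split=> [x /= | x [/= -> _]].
      by rewrite c20 mul0r addr0 => <-; split => //; rewrite mulrAC divff // mul1r.
    by rewrite c20 mul0r addr0 mulrCA divff // mulr1.
  apply: (eq_trans (mes2_setX (measurable_set1 _) measurableT)).
  by rewrite lebesgue_measure_set1 mul0e.
apply: (eq_trans (mes2_sections _)).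
apply: integral0_eq => x _ /=.
have -> : xsection [set x : mR * mR | c1 * x.1 + c2 * x.2 = c0] x = [set (c0 - c1 * x) / c2].
  apply/seteqP; split=> y; rewrite /xsection /= inE /=.
    move=> <-; by rewrite addrAC subrr add0r mulrAC divff // mul1r.
  by move=> ->; rewrite mulrCA divff // mulr1 addrC subrK.
exact: lebesgue_measure_set1.
Qed.

Lemma ae_box (P : R * R -> Prop) (z : R * R) (d : R) : 0 < d ->
  {ae mes2, forall x, P x} ->
  exists y, [/\ `|y.1 - z.1| < d, `|y.2 - z.2| < d & P y].
Proof.
move=> d0 [N [mN N0 PN]].
apply: contrapT => h.
pose I1 : set mR := [set` `]z.1 - d, z.1 + d[]; pose I2 : set mR := [set` `]z.2 - d, z.2 + d[].
have BN : I1 `*` I2 `<=` N.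
  move=> y [/= y1 y2]; apply: PN => /= Py; apply: h; exists y.
  move: y1 y2; rewrite /I1 /I2 /= !in_itv /= => /andP[? ?] /andP[? ?].
  by split => //; rewrite ltr_norml; apply/andP; split; lra.
have : (mes2 (I1 `*` I2) <= mes2 N)%E.
  by apply: le_measure => //; rewrite inE //; apply: measurableX; exact: measurable_itv.
rewrite N0 (mes2_setX (measurable_itv _) (measurable_itv _)).
rewrite /= /I1 /I2 !lebesgue_measure_itv /= !lte_fin.
have -> : z.1 - d < z.1 + d by lra.
have -> : z.2 - d < z.2 + d by lra.
rewrite -!EFinD -EFinM lee_fin leNgt.
suff -> : 0 < (z.1 + d - (z.1 - d)) * (z.2 + d - (z.2 - d)) by [].
by apply: mulr_gt0; lra.
Qed.

Lemma ae_countable (T : countType) (P : T -> R * R -> Prop) :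
  (forall t, {ae mes2, forall x, P t x}) -> {ae mes2, forall x, forall t, P t x}.
Proof.
move=> h.
have := @negligible_bigcup _ _ _ (@mes2 R) (fun n => [set x | exists2 t, unpickle n = Some t & ~ P t x]).
move=> /(_ _)H; apply: negligibleS (H _); last first.
  move=> n; case E : (unpickle n) => [t|].
    by apply: negligibleS (h t) => x [t' [<-]].
  by apply: negligibleS (@negligible_set0 _ _ _ _) => x [t'].
move=> x /= hx; have [t ht] : exists t, ~ P t x.
  by apply: contrapT => k; apply: hx => t; apply: contrapT => k'; apply: k; exists t.
by exists (pickle t) => //; exists t => //; rewrite pickleK.
Qed.

End Null.

(** * Visits of an orbit to a bounded set *)

Definition box (n : nat) : seq int := [seq i%:Z - n%:Z | i <- iota 0 n.*2.+1].
Definition box2 (n : nat) : seq (int * int) := [seq (i, j) | i <- box n, j <- box n].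
Definition window (n2 : int) (n N : nat) : seq triple :=
  [seq (n2 + k%:Z, m) | k <- iota 0 n, m <- box2 N].

Lemma mem_box n i : (i \in box n) = (`|i| <= n)%N.
Proof.
apply/mapP/idP => [[k]|h]; first by rewrite mem_iota add0n => h ->; lia.
by exists (absz (i + n%:Z)); [rewrite mem_iota add0n; lia|lia].
Qed.

Lemma box_uniq n : uniq (box n).
Proof. by rewrite map_inj_uniq ?iota_uniq // => i j; lia. Qed.

Lemma box_bound (R : realType) (u b : R) (j : int) (B n : nat) :
  `|u| <= b -> ((Num.truncn b).+1 + B <= n)%N -> `|u + j%:~R| <= B%:R -> j \in box n.
Proof.
move=> ub h2 h1; rewrite mem_box leqNgt; apply/negP => lt.
have h3 := truncnS_gt b.
have h4 : ((Num.truncn b).+1 + B)%N%:R < `|j%:~R| :> R.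
  by rewrite -intr_norm -[X in X < _]/(((Num.truncn b).+1 + B)%N%:Z%:~R) ltr_int; lia.
have h5 : `|j%:~R| <= `|u + j%:~R| + `|u| :> R.
  by rewrite -{1}[j%:~R](addKr u) addrC; apply: le_trans (ler_normB _ _) _.
by move: h4; rewrite natrD; lra.
Qed.

Lemma mem_box2 n m : (m \in box2 n) = (`|m.1| <= n)%N && (`|m.2| <= n)%N.
Proof.
rewrite -!mem_box; apply/allpairsP/andP => [[[i j] /= [h1 h2 ->]]//|[h1 h2]].
by exists m; rewrite -surjective_pairing.
Qed.

Lemma box2_uniq n : uniq (box2 n).
Proof. by apply: allpairs_uniq; rewrite ?box_uniq // => -[? ?] [? ?]. Qed.

Lemma mem_window n2 n N g : (g \in window n2 n N) =
  [&& n2 <= g.1, g.1 < n2 + n%:Z & g.2 \in box2 N].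
Proof.
case: g => i m /=; apply/allpairsP/and3P => [[[k m'] /=]|[h1 h2 h3]].
  by rewrite mem_iota add0n => -[h1 h2 [-> ->]] /=; split => //; lia.
exists (absz (i - n2)%R, m); rewrite mem_iota /=; split => //; first by lia.
by congr (_, _); lia.
Qed.

Lemma window_uniq n2 n N : uniq (window n2 n N).
Proof.
apply: allpairs_uniq; rewrite ?iota_uniq ?box2_uniq // => -[k m] [k' m'] _ _ /= [h ->].
by congr (_, _); lia.
Qed.

Section Windows.
Variables (R : realType) (alpha : R * R).
Implicit Types (x y z : R * R) (S : set (R * R)).
Notation gpt := (orbit_point alpha).

Lemma gpt0E (m : int * int) : gpt (0, m) = Z2 m.
Proof. by rewrite gptE mulr0z add0r. Qed.

Lemma chi_box S x n : (forall m, S (x + Z2 m) -> m \in box2 n) ->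
  chi S x = \sum_(m <- box2 n) (\1_S (x + Z2 m) : R).
Proof.
move=> h; rewrite /chi [RHS]fsbig_seq ?box2_uniq //.
rewrite -(@fsbig_widen _ _ 0 _ [set` box2 n] setT) // => m [_ /= mn]; rewrite /= indicE.
by rewrite memNset // => /h.
Qed.

Lemma chi_periodic S x m : chi S (x + Z2 m) = chi S x.
Proof.
rewrite /chi (reindex_fsbigT (fun k => k - m)) /=; last first.
  by exists (fun k => k + m) => k; rewrite ?subrK ?addrK.
apply: eq_fsbigr => k _; congr (\1_S _); rewrite -addrA; congr (_ + _).
by apply: injective_projections; rewrite /= intrB; ring.
Qed.

Definition visit_sum S y (n2 : int) (n : nat) : R :=
  \sum_(k < n) chi S (y + gpt (n2 + k%:Z, 0)).

Local Notation visits := visit_sum.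

Lemma visitsD S y n2 n n' :
  visits S y n2 (n + n') = visits S y n2 n + visits S y (n2 + n%:Z) n'.
Proof.
rewrite /visits big_split_ord /=; congr (_ + _); apply: eq_bigr => k _.
by rewrite -addrA -PoszD.
Qed.

(** Moving the base point by a group element shifts the time: only the
    coefficient of alpha matters, by periodicity. *)
Lemma visits_shift S y g n : visits S (y + gpt g) 0 n = visits S y g.1 n.
Proof.
apply: eq_bigr => k _; rewrite -[RHS](chi_periodic _ _ g.2) -gpt0E -!addrA -!gptD.
congr (chi S (_ + gpt _)); apply: injective_projections => //=; first by rewrite add0r addr0.
by rewrite addr0 add0r.
Qed.

(** Near x, the infinite sum that defines chi only involves translates in a
    box, and the same box serves for all the times of the window. *)
Lemma visits_window S (B : nat) x n2 n :
  (forall y, S y -> `|y.1| <= B%:R /\ `|y.2| <= B%:R) ->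
  exists N0, forall N, (N0 <= N)%N -> forall y, `|y.1 - x.1| <= 1 -> `|y.2 - x.2| <= 1 ->
   visits S y n2 n = \sum_(g <- window n2 n N) (\1_S (y + gpt g) : R).
Proof.
move=> SB.
pose b : R := `|x.1| + `|x.2| + 1 + (`|n2|%N + n)%N%:R * (`|alpha.1| + `|alpha.2|).
exists ((Num.truncn b).+1 + B)%N => N bN y y1 y2.
rewrite /window big_allpairs_dep /visits -(big_mkord xpredT (fun k => chi S (y + gpt (n2 + k%:Z, 0)))).
rewrite /index_iota subn0; apply: eq_big_seq => k; rewrite mem_iota add0n => /andP[_ kn].
have split_g m : y + gpt (n2 + k%:Z, 0) + Z2 m = y + gpt (n2 + k%:Z, m).
  rewrite -gpt0E -addrA -gptD; congr (_ + gpt _).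
  by apply: injective_projections; rewrite /= ?addr0 // add0r.
rewrite (@chi_box _ _ N) => [|m]; first by apply: eq_bigr => m _; rewrite split_g.
rewrite split_g => /SB[h1 h2]; rewrite mem_box2 -!mem_box.
have key (t u w : R) : `|w| <= `|alpha.1| + `|alpha.2| -> `|t| <= `|x.1| + `|x.2| ->
    `|u - t| <= 1 -> `|u + (n2 + k%:Z)%:~R * w| <= b.
  move=> wa tx ut.
  have cb : `|(n2 + k%:Z)%:~R| <= (`|n2|%N + n)%N%:R :> R.
    by rewrite -intr_norm -[X in _ <= X]/((`|n2|%N + n)%N%:Z%:~R) ler_int; lia.
  apply: le_trans (ler_normD _ _) _; rewrite normrM; apply: lerD; last exact: ler_pM.
  by rewrite -(subrK t u) addrC; apply: le_trans (ler_normD _ _) _; exact: lerD.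
rewrite /= !addrA in h1 h2; apply/andP; split.
  by apply: (box_bound (key x.1 y.1 alpha.1 _ _ y1) bN h1); rewrite lerDl.
by apply: (box_bound (key x.2 y.2 alpha.2 _ _ y2) bN h2); rewrite lerDr.
Qed.

End Windows.

(** * Counting integers in translated intervals *)

Section Ceil.
Variable R : archiRealFieldType.
Implicit Types (x y u : R).

Definition isZ x : bool := x == (Num.ceil x)%:~R.

Lemma isZP x : reflect (exists k : int, x = k%:~R) (isZ x).
Proof.
apply: (iffP eqP) => [->|[k ->]]; first by exists (Num.ceil x).
by rewrite intrKceil.
Qed.

Lemma ceilDi x (k : int) : Num.ceil (x + k%:~R) = Num.ceil x + k.
Proof. by rewrite ceilDrz ?intrKceil //; apply/intrP; exists k. Qed.

Lemma isZDi x (k : int) : isZ (x + k%:~R) = isZ x.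
Proof. by rewrite /isZ ceilDi intrD (inj_eq (addIr _)). Qed.

Lemma isZN x : isZ (- x) = isZ x.
Proof. by apply/isZP/isZP => -[k e]; exists (- k); rewrite intrN -e ?opprK. Qed.

Lemma floorS x : Num.floor x + 1 = Num.ceil x + isZ x.
Proof.
have := floor_itv x; have := ceil_itv x; rewrite intrB intrD.
set c := Num.ceil x; set f := Num.floor x => /andP[c1 c2] /andP[f1 f2].
rewrite /isZ -/c; have [e|ne] := eqVneq x c%:~R.
  congr (_ + _); apply/eqP; rewrite eq_le; apply/andP; split.
    by rewrite -(ler_int R) -e.
  by rewrite -ltzD1 -(ltr_int R) intrD -e.
rewrite addr0; apply/eqP; rewrite eq_le; apply/andP; split.
  rewrite lezD1 -(ltr_int R); apply: le_lt_trans f1 _.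
  by rewrite lt_neqAle ne.
by rewrite -ltzD1 -(ltr_int R) !intrD; lra.
Qed.

Lemma ceil_below y : exists2 e, 0 < e & forall t, 0 < t -> t < e -> Num.ceil (y - t) = Num.ceil y.
Proof.
have := ceil_itv y; rewrite intrB => /andP[c1 c2].
exists (y - ((Num.ceil y)%:~R - 1)); first by rewrite subr_gt0.
by move=> t t0 te; apply: ceil_def; rewrite intrB; apply/andP; split; lra.
Qed.

Lemma ceil_above y : exists2 e, 0 < e & forall t, 0 < t -> t < e -> Num.ceil (y + t) = Num.floor y + 1.
Proof.
have := floor_itv y; rewrite intrD => /andP[c1 c2].
exists ((Num.floor y)%:~R + 1 - y); first by rewrite subr_gt0.
by move=> t t0 te; apply: ceil_def; rewrite addrK intrD; apply/andP; split; lra.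
Qed.

(** The difference of ceilings counts the integers in an interval of length L
    that slides with u, and on the right in one of length M.  Agreement on a
    dense set passes to limits from both sides, hence to the jumps: the
    integrality of the end points has to match at every u.  The jumps at 0, L
    and q give the alternative, and the values at 0 then give L = M. *)
Lemma ceil_count_eq (L M q : R) :
  (forall u0 u1, u0 < u1 -> exists2 u, u0 < u < u1 &
     Num.ceil (L - u) - Num.ceil (- u) = Num.ceil (q + M - u) - Num.ceil (q - u)) ->
  L = M /\ (isZ L \/ isZ q).
Proof.
move=> h.
(* limit from the right in u, where the ceilings are continuous *)
have right u : Num.ceil (L - u) - Num.ceil (- u) = Num.ceil (q + M - u) - Num.ceil (q - u).
  have [e1 e10 h1] := ceil_below (L - u); have [e2 e20 h2] := ceil_below (- u).
  have [e3 e30 h3] := ceil_below (q + M - u); have [e4 e40 h4] := ceil_below (q - u).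
  pose e := Num.min (Num.min e1 e2) (Num.min e3 e4).
  have [|w /andP[w1 w2] hw] := h u (u + e); first by rewrite ltrDl !lt_min e10 e20 e30.
  have w0 : 0 < w - u by lra.
  have : w - u < e by lra.
  rewrite !lt_min => /andP[/andP[k1 k2] /andP[k3 k4]].
  rewrite -(h1 _ w0 k1) -(h2 _ w0 k2) -(h3 _ w0 k3) -(h4 _ w0 k4).
  have E z : z - u - (w - u) = z - w by ring.
  by rewrite !E -hw; congr (_ - Num.ceil _); ring.
(* limit from the left in u, which turns ceilings into floors *)
have left u : Num.floor (L - u) - Num.floor (- u) = Num.floor (q + M - u) - Num.floor (q - u).
  have [e1 e10 h1] := ceil_above (L - u); have [e2 e20 h2] := ceil_above (- u).
  have [e3 e30 h3] := ceil_above (q + M - u); have [e4 e40 h4] := ceil_above (q - u).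
  pose e := Num.min (Num.min e1 e2) (Num.min e3 e4).
  have [|w /andP[w1 w2] hw] := h (u - e) u; first by rewrite ltrBlDr ltrDl !lt_min e10 e20 e30.
  have w0 : 0 < u - w by lra.
  have : u - w < e by lra.
  rewrite !lt_min => /andP[/andP[k1 k2] /andP[k3 k4]].
  have E z : z - u + (u - w) = z - w by ring.
  have := h1 _ w0 k1; have := h2 _ w0 k2; have := h3 _ w0 k3; have := h4 _ w0 k4.
  have E0 : - u + (u - w) = - w by ring.
  rewrite !E E0 => a4 a3 a2 a1; move: hw; rewrite a1 a2 a3 a4; clear; lia.
have jump u : (isZ (L - u)%R + isZ (q - u)%R = isZ (q + M - u)%R + isZ (- u)%R)%N.
  have F y : Num.floor y = Num.ceil y + isZ y - 1 by rewrite -floorS addrK.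
  have l := left u; rewrite !F in l; have r := right u; move: l r.
  move: (Num.ceil (L - u)) (Num.ceil (- u)) (Num.ceil (q + M - u)) (Num.ceil (q - u)).
  move: (nat_of_bool (isZ (L - u))) (nat_of_bool (isZ (- u))).
  move: (nat_of_bool (isZ (q + M - u))) (nat_of_bool (isZ (q - u))).
  move=> n1 n2 n3 n4 x1 x2 x3 x4 l r.
  have : n3%:Z + n2%:Z = n1%:Z + n4%:Z :> int by lra.
  by rewrite -!PoszD => -[].
have z0 : isZ 0 by apply/isZP; exists 0.
have j0 := jump 0; rewrite !subr0 oppr0 z0 in j0.
have r0 := right 0; rewrite !subr0 oppr0 ceil0 subr0 in r0.
have [qZ|qN] := boolP (isZ q).
  have /isZP[k qk] := qZ.
  have jL := jump L; rewrite subrr isZN z0 qk in jL.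
  rewrite ![k%:~R + _]addrC -[_ + k%:~R - L]addrA [k%:~R - L]addrC addrA !isZDi isZN in jL.
  have /isZP[m mE] : isZ (M - L) by move: jL; case: (isZ L); case: (isZ _).
  have ME : M = L + m%:~R by rewrite -mE; ring.
  split; last by right.
  move: r0; rewrite qk [k%:~R + M]addrC ceilDi intrKceil ME ceilDi => r0.
  have -> : m = 0 by lia.
  by rewrite addr0.
rewrite (negbTE qN) in j0.
have LZ : isZ L by move: j0; case: (isZ L); case: (isZ _).
have /isZP[k Lk] := LZ.
have jq := jump q; rewrite subrr z0 Lk [k%:~R - q]addrC isZDi in jq.
have MZ : isZ M.
  have E : q + M - q = M by ring.
  by move: jq; rewrite E; case: (isZ M); case: (isZ (- q)).
have /isZP[m Mm] := MZ; split; last by left.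
by move: r0; rewrite Lk Mm ceilDi intrKceil => ->; congr (_%:~R); ring.
Qed.

Lemma count_integers (A B : R) (s : seq int) : A <= B -> uniq s ->
  (forall j : int, A <= j%:~R -> j%:~R < B -> j \in s) ->
  \sum_(j <- s) ((A <= j%:~R) && (j%:~R < B))%R%:R = (Num.ceil B - Num.ceil A)%:~R :> R.
Proof.
move=> AB us hs; pose n := absz (Num.ceil B - Num.ceil A)%R.
have nE : Num.ceil B - Num.ceil A = n%:Z by have := le_ceil AB; rewrite /n; lia.
have pE (j : int) : ((A <= j%:~R) && (j%:~R < B))%R = (Num.ceil A <= j < Num.ceil B).
  by rewrite ceil_le_int ceil_gt_int.
rewrite nE; under eq_bigr do rewrite pE.
rewrite -natr_sum -pmulrn; congr (_%:R).
transitivity (size [seq j <- s | Num.ceil A <= j < Num.ceil B]).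
  by rewrite size_filter -sum1_count [RHS]big_mkcond; apply: eq_bigr => j _; case: ifP.
have -> : n = size [seq Num.ceil A + i%:Z | i <- iota 0 n] by rewrite size_map size_iota.
apply: perm_size; apply: uniq_perm; first exact: filter_uniq.
  by rewrite map_inj_uniq ?iota_uniq // => i j; lia.
move=> j; rewrite mem_filter; apply/andP/mapP => [[/andP[h1 h2] _]|[i]].
  by exists (absz (j - Num.ceil A)%R); [rewrite mem_iota add0n; lia|lia].
rewrite mem_iota add0n => /andP[_ ilt] ->; have k : Num.ceil A <= Num.ceil A + i%:Z < Num.ceil B by lia.
split => //; have := k; rewrite -pE => /andP[]; exact: hs.
Qed.

End Ceil.

(** * Crossing an edge *)

Lemma norm_add_lt (R : realType) (p q d : R) : `|p| <= d / 2 -> `|q| < d / 2 -> `|p + q| < d.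
Proof.
move=> h1 h2; rewrite [X in _ < X](splitr d).
by apply: le_lt_trans (ler_normD _ _) _; exact: ler_ltD.
Qed.

Lemma shifted_corner (R : realType) (t y e d : R) : 0 < e -> e <= d -> e <= 1 - y -> 0 <= y ->
  `|t - (y + e / 2)| < e / 2 -> [/\ `|t - y| < d, 0 <= t & t < 1].
Proof.
move=> e0 ed e1 y0; rewrite ltr_norml => /andP[h1 h2]; split; [|lra..].
by rewrite ltr_norml; apply/andP; split; lra.
Qed.

Lemma close_gt0 (R : realType) (A B : R) : `|A - B| < B -> 0 < A.
Proof. by rewrite ltr_norml => /andP[]; lra. Qed.

Lemma close_lt0 (R : realType) (A B : R) : `|A + B| < B -> A < 0.
Proof. by rewrite ltr_norml => /andP[]; lra. Qed.

Lemma quarter_lt_half (R : realType) : 4^-1 < 2^-1 :> R.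
Proof. by lra. Qed.

(** Adding and subtracting a near-maximal amount w to D both respect the
    maximum M only if D is small. *)
Lemma oscillation_lt (R : realType) (D w M q : R) :
  M - q < `|w| -> `|D + w| <= M -> `|D - w| <= M -> `|D| < q.
Proof.
rewrite lter_normr => /orP[h|h]; rewrite !ler_norml ltr_norml => /andP[? ?] /andP[? ?];
  apply/andP; split; lra.
Qed.

Lemma late_minus_early (g1 g2 : int) (K m : nat) : (K + m)%N%:Z < g1 -> g2 < - K%:Z ->
  [/\ (absz (g1 - g2)%R)%:Z = g1 - g2, (m <= absz (g1 - g2)%R)%N &
      K%:Z < g2 + (absz (g1 - g2)%R)%:Z].
Proof. by move=> h1 h2; split; lia. Qed.

Section Jump.
Variables (R : realType) (alpha : R * R).
Hypothesis irr : irrational_vector alpha.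
Variables (S : set (R * R)) (V : seq (R * R)).
Hypothesis SV : polygon_hull S V.
Implicit Types (x y z p : R * R) (g : triple).
Notation gpt := (orbit_point alpha).
Notation visits := (visit_sum alpha).

Let nc : noncollinear V. Proof. by case: SV. Qed.
Let SE x : S x <-> forall a b, (a, b) \in hull_edges V -> 0 <= orient a b x.
Proof. by case: SV => _ _ _; apply. Qed.

(** The points with no translate on a line that carries an edge. *)
Definition generic y := forall g e, e \in hull_edges V -> orient e.1 e.2 (y + gpt g) != 0.

Definition near_pt x (d : R) y := `|y.1 - x.1| < d /\ `|y.2 - x.2| < d.

Lemma orientD a b x y : orient a b y = orient a b x + ((b.1 - a.1) * (y.2 - x.2) - (b.2 - a.2) * (y.1 - x.1)).
Proof. by rewrite /orient; ring. Qed.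

Lemma ae_generic : {ae @mes2 R, forall x, generic x}.
Proof.
pose Q (t : triple * nat) x := (t.2 < size (hull_edges V))%N ->
  let e := nth (0, 0) (hull_edges V) t.2 in orient e.1 e.2 (x + gpt t.1) != 0.
have h : {ae @mes2 R, forall x, forall t, Q t x}.
  apply: ae_countable => -[g i]; rewrite /Q /=.
  have [iE|] := ltnP i (size (hull_edges V)); last first.
    by move=> _; apply: aeW.
  set e := nth _ _ _; have eE : e \in hull_edges V by rewrite /e; apply: mem_nth; exact: iE.
  have /hull_edgesP[_ _ ne _ _] : (e.1, e.2) \in hull_edges V by rewrite -surjective_pairing.
  have := @line_negligible R (- (e.2.2 - e.1.2)) (e.2.1 - e.1.1)
     (- (e.2.2 - e.1.2) * (e.1.1 - (gpt g).1) + (e.2.1 - e.1.1) * (e.1.2 - (gpt g).2)).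
  move=> /(_ _)H; apply: negligibleS (H _); last first.
    apply: contra ne => /eqP[h1 h2]; apply/eqP/injective_projections.
      by move: h2; lra.
    by move: h1; lra.
  move=> x /= hx; have /eqP : orient e.1 e.2 (x + gpt g) == 0.
    by apply: contrapT => k; apply: hx => _; apply/negP.
  by rewrite /orient /=; lra.
apply: negligibleS h => x nx hx; apply: nx => g e eE.
have := hx (g, index e (hull_edges V)); rewrite /Q /= index_mem nth_index // => /(_ eE).
by [].
Qed.

Lemma generic_shift y g : generic y -> generic (y + gpt g).
Proof. by move=> gy h e eE; rewrite -addrA -gptD; exact: gy. Qed.

(** Finitely many signs are stable under a small displacement. *)
Lemma local_sign x (s : seq triple) : exists2 d, 0 < d & forall y, near_pt x d y ->
  forall g, g \in s -> forall e, e \in hull_edges V -> orient e.1 e.2 (x + gpt g) != 0 ->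
    (0 <= orient e.1 e.2 (y + gpt g)) = (0 <= orient e.1 e.2 (x + gpt g)).
Proof.
have [d d0 hd] : exists2 d, 0 < d & forall y, near_pt x d y ->
  forall t, t \in [seq (g, e) | g <- s, e <- hull_edges V] -> orient t.2.1 t.2.2 (x + gpt t.1) != 0 ->
    (0 <= orient t.2.1 t.2.2 (y + gpt t.1)) = (0 <= orient t.2.1 t.2.2 (x + gpt t.1)).
  elim: [seq _ | _ <- _, _ <- _] => [|[g e] l [d d0 IH]]; first by exists 1.
  have [ o0|on] := eqVneq (orient e.1 e.2 (x + gpt g)) 0.
    exists d => // y yx t; rewrite inE => /orP[/eqP -> /=|/IH]; last exact.
    by rewrite o0 eqxx.
  set o := orient _ _ _ in on; pose v := (e.2.1 - e.1.1, e.2.2 - e.1.2).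
  have vp : 0 < `|v.1| + `|v.2| + 1 by have := normr_ge0 v.1; have := normr_ge0 v.2; lra.
  have oo : 0 < `|o| by rewrite normr_gt0.
  exists (Num.min d (`|o| / (`|v.1| + `|v.2| + 1))); first by rewrite lt_min d0 divr_gt0.
  move=> y [y1 y2] t; move: y1 y2; rewrite !lt_min => /andP[y1 k1] /andP[y2 k2].
  rewrite inE => /orP[/eqP -> /= _|/(IH y (conj y1 y2))]; last exact.
  have -> : orient e.1 e.2 (y + gpt g) = o + (v.1 * (y.2 - x.2) - v.2 * (y.1 - x.1)).
    by rewrite (orientD _ _ (x + gpt g)) /o /=; ring.
  rewrite -/o; set w := _ - _.
  have wo : `|w| < `|o|.
    rewrite !ltr_pdivlMr // in k1 k2.
    have h1 : `|v.1| * `|y.2 - x.2| * (`|v.1| + `|v.2| + 1) <= `|v.1| * `|o|.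
      by rewrite -mulrA ler_wpM2l // ltW.
    have h2 : `|v.2| * `|y.1 - x.1| * (`|v.1| + `|v.2| + 1) <= `|v.2| * `|o|.
      by rewrite -mulrA ler_wpM2l // ltW.
    have hw : `|w| <= `|v.1| * `|y.2 - x.2| + `|v.2| * `|y.1 - x.1|.
      by apply: le_trans (ler_normB _ _) _; rewrite !normrM.
    rewrite -(ltr_pM2r vp); apply: le_lt_trans (ler_wpM2r (ltW vp) hw) _.
    by rewrite mulrDl; move: h1 h2 oo; rewrite [`|o| * _]mulrDr mulr1 ![_ * `|o|]mulrC mulrDr; lra.
  clear - on wo; move: o w on wo => o w on wo.
  have [ op|on'|oz] := ltrgt0P o.
  - move: wo; rewrite (gtr0_norm op) ltr_norml => /andP[? ?].
    by apply/idP; lra.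
  - move: wo; rewrite (ltr0_norm on') ltr_norml => /andP[? ?].
    by apply/negbTE; rewrite -ltNge; lra.
  - by rewrite oz eqxx in on.
exists d => // y yx g gs e eE; apply: (hd y yx (g, e)).
by apply/allpairsP; exists (g, e).
Qed.

Let bounded : exists B : nat, forall y, S y -> `|y.1| <= B%:R /\ `|y.2| <= B%:R.
Proof. exact: polygon_bounded SV. Qed.

Lemma indic_eq_sides p q : (forall e, e \in hull_edges V ->
  (0 <= orient e.1 e.2 p) = (0 <= orient e.1 e.2 q)) -> \1_S p = \1_S q :> R.
Proof.
move=> pq; rewrite !indicE; congr (_%:R); congr nat_of_bool.
apply/idP/idP; rewrite !inE => /SE h; apply/SE => c d cdE; have := pq _ cdE => /= E.
  by rewrite -E h.
by rewrite E h.
Qed.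

Lemma visits_locally_const y n2 n : generic y ->
  exists2 d, 0 < d & forall z, near_pt y d z -> visits S z n2 n = visits S y n2 n.
Proof.
move=> gy; have [B SB] := bounded.
have [N0 /(_ N0 (leqnn _)) hN] := visits_window alpha y n2 n SB.
have [d d0 hd] := local_sign y (window n2 n N0).
exists (Num.min d 1); first by rewrite lt_min d0 ltr01.
move=> z [z1 z2]; move: z1 z2; rewrite !lt_min => /andP[z1 k1] /andP[z2 k2].
rewrite !hN ?subrr ?normr0 ?ler01 // 1?ltW //.
apply: eq_big_seq => g gw; apply: indic_eq_sides => e eE.
by apply: hd => //; exact: gy.
Qed.

Lemma visits_ergodicE x n : visits S x 0 n = \sum_(k < n) chi S (x + alpha *+ k).
Proof.
apply: eq_bigr => k _; congr (chi S (_ + _)).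
rewrite gptE add0r -pmulrn; suff -> : @Z2 R (0, 0) = 0 by rewrite addr0.
by [].
Qed.

(** The sums are locally constant at generic points and periodic, so a bound
    valid almost everywhere on the unit square is valid at each of them. *)
Lemma bounded_remainder_generic (mu C : R) : 0 <= C ->
  (forall n : nat, (0 < n)%N ->
    {ae @mes2 R, forall x, unit_square x ->
       `| \sum_(k < n) chi S (x + alpha *+ k) - n%:R * mu| <= C}) ->
  forall y n2 n, generic y -> `|visits S y n2 n - n%:R * mu| <= C.
Proof.
move=> C0 h; suff key y n : generic y -> `|visits S y 0 n - n%:R * mu| <= C.
  move=> y n2 n gy; have := key _ n (@generic_shift y (n2, 0) gy).
  by rewrite visits_shift.
case: n => [|n] gy; first by rewrite /visit_sum big_ord0 mul0r subrr normr0.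
pose g : triple := (0, (- Num.floor y.1, - Num.floor y.2)).
have := @generic_shift y g gy; have -> : visits S y 0 n.+1 = visits S (y + gpt g) 0 n.+1.
  by rewrite visits_shift.
set y0 := y + gpt g => gy0.
have fl (t : R) : 0 <= t - (Num.floor t)%:~R < 1.
  by have /andP[] := floor_itv t; rewrite intrD => ? ?; apply/andP; split; lra.
have /andP[y01 y01'] : 0 <= y0.1 < 1.
  by have := fl y.1; rewrite /y0 /= mul0r add0r intrN.
have /andP[y02 y02'] : 0 <= y0.2 < 1.
  by have := fl y.2; rewrite /y0 /= mul0r add0r intrN.
have [d d0 hd] := visits_locally_const 0 n.+1 gy0.
clearbody y0.
(* a box with lower left corner y0, inside the unit square *)
pose e := Num.min d (Num.min (1 - y0.1) (1 - y0.2)).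
have e0 : 0 < e by rewrite !lt_min d0 /= !subr_gt0 y01' y02'.
have [ed e1 e2] : [/\ e <= d, e <= 1 - y0.1 & e <= 1 - y0.2].
  by split; rewrite /e !ge_min lexx ?orbT.
have eh : 0 < e / 2 by lra.
have [z [z1 z2 Pz]] := ae_box (y0.1 + e / 2, y0.2 + e / 2) eh (h n.+1 isT).
have [k1 k2 k3] := shifted_corner e0 ed e1 y01 z1.
have [k4 k5 k6] := shifted_corner e0 ed e2 y02 z2.
rewrite -(hd z) // visits_ergodicE; apply: Pz.
by split; rewrite /= in_itv /=; apply/andP; split.
Qed.

Section AtEdge.
Variables a b : R * R.
Hypothesis abE : (a, b) \in hull_edges V.

(** The length is free here: that it equals the length of ab is part of what
    has to be proved. *)
Definition opposite_edge (e : (R * R) * (R * R)) : Prop :=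
  e \in hull_edges V /\ exists2 l : R, 0 < l &
   e.2.1 - e.1.1 = - (l * (b.1 - a.1)) /\ e.2.2 - e.1.2 = - (l * (b.2 - a.2)).

Lemma opposite_disjoint e p : opposite_edge e -> orient a b p = 0 -> orient e.1 e.2 p = 0 -> False.
Proof.
case=> eE [l l0 [e1 e2]] o1 o2.
have /hull_edgesP[_ _ ab hab _] := abE.
have /hull_edgesP[_ _ _ he _] : (e.1, e.2) \in hull_edges V by rewrite -surjective_pairing.
have [r rV /eqP] := nc ab; apply; have h1 := hab r rV; have h2 := he r rV.
have E : orient e.1 e.2 r = - (l * orient a b r).
  by rewrite (orientD _ _ p r) o2 (orientD a b p r) o1 e1 e2; ring.
have : l * orient a b r <= 0 by move: h2; rewrite E; lra.
by rewrite pmulr_rle0 // => h3; apply/eqP; rewrite eq_le h3.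
Qed.

(** The points whose translates meet no carrying line transverse to ab. *)
Definition good_point x := forall g e, e \in hull_edges V ->
  orient e.1 e.2 (x + gpt g) = 0 -> e = (a, b) \/ opposite_edge e.

Definition hit x g : bool := `[< S (x + gpt g) /\ orient a b (x + gpt g) = 0 >].
Definition opposite_hit x g : bool :=
  `[< exists e, [/\ opposite_edge e, S (x + gpt g) & orient e.1 e.2 (x + gpt g) = 0] >].

(** For y on the inner side of ab and z on the outer side, a translate of the
    edge through x is crossed into S on the way from z to y, and a translate of
    the opposite edge out of S; all other signs agree by [local_sign]. *)
Lemma jump x (s : seq triple) : good_point x -> exists2 d, 0 < d & forall y z,
   near_pt x d y -> near_pt x d z ->
   0 < (b.1 - a.1) * (y.2 - x.2) - (b.2 - a.2) * (y.1 - x.1) ->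
   (b.1 - a.1) * (z.2 - x.2) - (b.2 - a.2) * (z.1 - x.1) < 0 ->
   forall g, g \in s -> \1_S (y + gpt g) - \1_S (z + gpt g) = (hit x g)%:R - (opposite_hit x g)%:R :> R.
Proof.
move=> gx; have [d d0 hd] := local_sign x s; exists d => // y z yx zx yp zn g gs.
have oE c e p : orient c e (p + gpt g) = orient c e (x + gpt g) +
    ((e.1 - c.1) * (p.2 - x.2) - (e.2 - c.2) * (p.1 - x.1)).
  by rewrite (orientD _ _ (x + gpt g)) /=; ring.
have move_to p e0 : near_pt x d p -> orient e0.1 e0.2 (x + gpt g) = 0 ->
    0 <= orient e0.1 e0.2 (p + gpt g) ->
    (forall e, e \in hull_edges V -> orient e.1 e.2 (x + gpt g) = 0 -> e = e0) ->
    \1_S (p + gpt g) = \1_S (x + gpt g) :> R.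
  move=> px o0 op u; apply: indic_eq_sides => e eE.
  have [k|k] := eqVneq (orient e.1 e.2 (x + gpt g)) 0; last by apply: hd.
  by rewrite (u e eE k) op o0 lexx.
have outside p e : e \in hull_edges V -> orient e.1 e.2 (p + gpt g) < 0 -> \1_S (p + gpt g) = 0 :> R.
  move=> eE neg; rewrite indicE memNset // => /SE /(_ e.1 e.2).
  by rewrite -surjective_pairing => /(_ eE); rewrite leNgt neg.
have [ o0|on] := eqVneq (orient a b (x + gpt g)) 0.
  have -> : opposite_hit x g = false.
    by apply/asboolP => -[e [ oe _ o1]]; exact: (opposite_disjoint oe o0 o1).
  rewrite (outside z (a, b)) //=; last by rewrite oE o0 add0r.
  rewrite (move_to y (a, b)) //=; last 2 first.
  - by rewrite oE o0 add0r ltW.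
  - move=> e eE oe; have [//|k] := gx g e eE oe.
    by case: (opposite_disjoint k o0 oe).
  rewrite !subr0 indicE; congr (_%:R); congr nat_of_bool.
  by apply/idP/asboolP; rewrite inE; [move=> ?; split|case].
have hit0 : hit x g = false by apply/asboolP => -[_ /eqP]; rewrite (negbTE on).
have [[e [ oe o1]]|none] := pselect (exists e, opposite_edge e /\ orient e.1 e.2 (x + gpt g) = 0).
  have [eE [l l0 [e1 e2]]] := oe.
  have oE' p : orient e.1 e.2 (p + gpt g) =
     - (l * ((b.1 - a.1) * (p.2 - x.2) - (b.2 - a.2) * (p.1 - x.1))).
    by rewrite oE o1 e1 e2; ring.
  rewrite (outside y e) //; last by rewrite oE' oppr_lt0 mulr_gt0.
  rewrite (move_to z e) //; last 2 first.
  - by rewrite oE' oppr_ge0 pmulr_rle0 // ltW.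
  - move=> f fE of_; have [fab|[_ [m m0 [f1 f2]]]] := gx g f fE of_.
      by move: of_; rewrite fab /= => /eqP; rewrite (negbTE on).
    rewrite [f]surjective_pairing [e]surjective_pairing; symmetry.
    apply: (@parallel_edges_eq _ V _ _ _ _ (m / l)); rewrite ?divr_gt0 -?surjective_pairing //.
      by rewrite e1 f1; field; rewrite gt_eqF.
    by rewrite e2 f2; field; rewrite gt_eqF.
  rewrite hit0 !sub0r indicE; congr (- _%:R); congr nat_of_bool.
  by apply/idP/asboolP; rewrite inE; [move=> ?; exists e|case=> ? []].
have -> : opposite_hit x g = false.
  by apply/asboolP => -[e [ oe _ o1]]; apply: none; exists e.
rewrite hit0 subrr; apply/eqP; rewrite subr_eq0; apply/eqP.
have nz e : e \in hull_edges V -> orient e.1 e.2 (x + gpt g) != 0.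
  move=> eE; apply/eqP => k; have [e'|oe] := gx g e eE k.
    by move: k; rewrite e' /= => /eqP; rewrite (negbTE on).
  by apply: none; exists e.
by apply: indic_eq_sides => e eE; rewrite !hd // nz.
Qed.

Lemma natr_close (m n : nat) : `|m%:R - n%:R : R| < 1 -> m = n.
Proof.
rewrite ltr_norml => /andP[h1 h2]; apply/eqP; rewrite eqn_leq -[(m <= n)%N]ltnS -[(n <= m)%N]ltnS -!(ltr_nat R) -!natr1.
by apply/andP; split; lra.
Qed.

(** The discrepancy over the window is below 1/4 on both sides of the line,
    by [oscillation_lt] with w nearly extremal, and its jump across the line is
    an integer.  The window covers any prescribed range of times because the
    visits near z can be chosen arbitrarily late and arbitrarily early. *)
Lemma edge_hits_balance (mu C : R) x (K : nat) : 
  (forall y n2 n, generic y -> `|visits S y n2 n - n%:R * mu| <= C) ->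
  good_point x ->
  exists n2 n N0, [/\ n2 < - K%:Z, K%:Z < n2 + n%:Z & forall N, (N0 <= N)%N ->
    \sum_(g <- window n2 n N) (hit x g)%:R = \sum_(g <- window n2 n N) (opposite_hit x g)%:R :> R].
Proof.
move=> bnd gx.
pose A := [set r : R | exists y n, generic y /\ r = `|visits S y 0 n - n%:R * mu|].
have [y0 [_ _ gy0]] := ae_box 0 (@ltr01 R) ae_generic.
have supA : has_sup A.
  split; first by exists (`|visits S y0 0 0 - 0%:R * mu|), y0, 0%N.
  by exists C => r [y [n [gy ->]]]; exact: bnd.
have Mub y n2 n : generic y -> `|visits S y n2 n - n%:R * mu| <= sup A.
  move=> gy; apply: ub_le_sup; first by case: supA.
  exists (y + gpt (n2, 0)), n; split; first exact: generic_shift.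
  by rewrite visits_shift.
have q4 : 0 < 4^-1 :> R by lra.
have [_ [z [m [gz ->]]] zM] := sup_adherent q4 supA.
have [d d0 hd] := visits_locally_const 0 m gz.
have d2 : 0 < d / 2 by lra.
(* x + gpt g1 and x + gpt g2 are close to z, late and early *)
have [g1 [g1K g11 g12]] := gpt_dense_late irr (z - x) (K + m) d2.
have [g2 [g2K g21 g22]] := gpt_dense_early irr (z - x) K d2.
pose n := absz (g1.1 - g2.1)%R.
have [nE mn nK] := late_minus_early g1K g2K; rewrite -/n in nE mn nK.
have [B SB] := bounded.
have [N0 hN0] := visits_window alpha x g2.1 n SB.
exists g2.1, n, N0; split => //.
move=> N N0N.
have [d' d'0 hj] := jump (window g2.1 n N) gx.
pose r := Num.min (d / 2) (Num.min d' 1).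
have r0 : 0 < r by rewrite !lt_min d2 d'0 ltr01.
have [rd rd' r1] : [/\ r <= d / 2, r <= d' & r <= 1].
  by split; rewrite /r !ge_min lexx ?orbT.
pose v1 := b.1 - a.1; pose v2 := b.2 - a.2.
have /hull_edgesP[_ _ ab _ _] := abE.
have n0 := sqdist_gt0 ab; rewrite -/v1 -/v2 in n0.
have vp' : 0 < `|v1| + `|v2| + 1 by apply: ltr_wpDl => //; exact: addr_ge0.
have vp : 0 < 2 * (`|v1| + `|v2| + 1) by exact: mulr_gt0.
pose t := r / (2 * (`|v1| + `|v2| + 1)).
have t0 : 0 < t by rewrite divr_gt0.
have tE : t * (2 * (`|v1| + `|v2| + 1)) = r by rewrite /t divfK // gt_eqF.
(* the generic point of [side] is found within rho of x + s (- v2, v1) *)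
pose rho := Num.min (r / 2) (t * (v1 ^+ 2 + v2 ^+ 2) / (`|v1| + `|v2| + 1)).
have rho0 : 0 < rho by rewrite lt_min divr_gt0 //= ?divr_gt0 // mulr_gt0.
have rho1 : rho <= r / 2 by rewrite /rho ge_min lexx.
have rho2 : rho * (`|v1| + `|v2| + 1) <= t * (v1 ^+ 2 + v2 ^+ 2).
  by rewrite -ler_pdivlMr // /rho ge_min lexx orbT.
have side (s : R) : `|s| = t -> exists y, [/\ generic y, near_pt x r y &
    `|(v1 * (y.2 - x.2) - v2 * (y.1 - x.1)) - s * (v1 ^+ 2 + v2 ^+ 2)| < t * (v1 ^+ 2 + v2 ^+ 2)].
  move=> st; have [y [y1 y2 gy]] := ae_box (x.1 - s * v2, x.2 + s * v1) rho0 ae_generic.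
  exists y; split => //.
    have half (u : R) : `|u| <= `|v1| + `|v2| + 1 -> `|s * u| <= r / 2.
      move=> uv; rewrite normrM st -tE mulrCA [2 * _ / 2]mulrAC divff // mul1r.
      exact: ler_wpM2l (ltW t0) _ _ uv.
    split.
      have -> : y.1 - x.1 = - (s * v2) + (y.1 - (x.1 - s * v2)) by ring.
      apply: norm_add_lt; last exact: lt_le_trans y1 rho1.
      by rewrite normrN half // -addrA addrCA lerDl addr_ge0.
    have -> : y.2 - x.2 = s * v1 + (y.2 - (x.2 + s * v1)) by ring.
    apply: norm_add_lt; last exact: lt_le_trans y2 rho1.
    by rewrite half // -addrA lerDl addr_ge0.
  have -> : v1 * (y.2 - x.2) - v2 * (y.1 - x.1) - s * (v1 ^+ 2 + v2 ^+ 2) =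
    v1 * (y.2 - (x.2 + s * v1)) - v2 * (y.1 - (x.1 - s * v2)) by ring.
  apply: lt_le_trans rho2; apply: le_lt_trans (ler_normB _ _) _; rewrite !normrM /=.
  have h1 : `|v1| * `|y.2 - (x.2 + s * v1)| <= `|v1| * rho by rewrite ler_wpM2l // ltW.
  have h2 : `|v2| * `|y.1 - (x.1 - s * v2)| <= `|v2| * rho by rewrite ler_wpM2l // ltW.
  apply: le_lt_trans (lerD h1 h2) _.
  by rewrite [X in _ < X]mulrDr mulr1 mulrDr ![rho * _]mulrC ltrDl.
have tn : 0 < t * (v1 ^+ 2 + v2 ^+ 2) by exact: mulr_gt0.
have [yp [gyp yx ypos]] := side t (gtr0_norm t0).
have [ym [gym mx yneg]] := side (- t) ltac:(by rewrite normrN gtr0_norm).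
have {}ypos : 0 < v1 * (yp.2 - x.2) - v2 * (yp.1 - x.1).
  exact: close_gt0 ypos.
have {}yneg : v1 * (ym.2 - x.2) - v2 * (ym.1 - x.1) < 0.
  by move: yneg; rewrite mulNr opprK; exact: close_lt0.
have small y : generic y -> near_pt x r y -> `|visits S y g2.1 n - n%:R * mu| < 4^-1.
  move=> gy [y1 y2].
  have at_z g : `|(gpt g).1 - (z - x).1| < d / 2 -> `|(gpt g).2 - (z - x).2| < d / 2 ->
      visits S y g.1 m = visits S z 0 m.
    move=> h1 h2; rewrite -visits_shift; apply: hd; split.
      have -> : (y + gpt g).1 - z.1 = (y.1 - x.1) + ((gpt g).1 - (z - x).1) by rewrite /=; ring.
      by apply: norm_add_lt => //; apply: le_trans rd; exact: ltW.
    have -> : (y + gpt g).2 - z.2 = (y.2 - x.2) + ((gpt g).2 - (z - x).2) by rewrite /=; ring.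
    by apply: norm_add_lt => //; apply: le_trans rd; exact: ltW.
  set D := visits S y g2.1 n - n%:R * mu; set w := visits S z 0 m - m%:R * mu in zM.
(* lengthen the window by m steps at its end *)
  have e1 : `|D + w| <= sup A.
    have := Mub y g2.1 (n + m)%N gy; rewrite visitsD.
    have -> : g2.1 + n%:Z = g1.1 by rewrite nE; ring.
    by rewrite (at_z g1) // natrD; congr (`|_| <= _); rewrite /D /w; ring.
(* remove the first m steps of the window *)
  have e2 : `|D - w| <= sup A.
    have := Mub y (g2.1 + m%:Z) (n - m)%N gy.
    have := visitsD alpha S y g2.1 m (n - m); rewrite subnKC // (at_z g2) // => hD.
    by congr (`|_| <= _); rewrite /D hD /w natrB //; ring.
  exact: oscillation_lt zM e1 e2.
have := small yp gyp yx; have := small ym gym mx.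
have nr y : near_pt x r y -> near_pt x d' y.
  by move=> [h1 h2]; split; [exact: lt_le_trans rd'|exact: lt_le_trans rd'].
have nr1 y : near_pt x r y -> `|y.1 - x.1| <= 1 /\ `|y.2 - x.2| <= 1.
  by move=> [h1 h2]; split; apply/ltW; [exact: lt_le_trans r1|exact: lt_le_trans r1].
have [k1 k2] := nr1 _ yx; have [k3 k4] := nr1 _ mx.
rewrite (hN0 N N0N yp k1 k2) (hN0 N N0N ym k3 k4).
move=> s1 s2; have J : \sum_(g <- window g2.1 n N) \1_S (yp + gpt g) -
   \sum_(g <- window g2.1 n N) \1_S (ym + gpt g) =
   \sum_(g <- window g2.1 n N) (hit x g)%:R - \sum_(g <- window g2.1 n N) (opposite_hit x g)%:R :> R.
  rewrite -!sumrB; apply: eq_big_seq => g gw; apply: hj => //; exact: nr.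
have : `|\sum_(g <- window g2.1 n N) (hit x g)%:R - \sum_(g <- window g2.1 n N) (opposite_hit x g)%:R : R| < 1.
  rewrite -J -(subrK (n%:R * mu) (\sum_(g <- _) \1_S (yp + _))) -addrA.
  rewrite -[X in _ + X]opprB; apply: le_lt_trans (ler_normB _ _) _.
  rewrite -[X in _ < X](_ : 2^-1 + 2^-1 = 1); last by field.
  by apply: ltrD; [apply: lt_trans s2 _|apply: lt_trans s1 _]; exact: quarter_lt_half.
by rewrite -!natr_sum => /natr_close ->.
Qed.

End AtEdge.
End Jump.

(** * The edge opposite to a given one *)

Lemma avoid_countable (R : realType) (T : countType) (f : T -> R -> Prop) (u0 u1 : R) :
  u0 < u1 -> (forall t u v, f t u -> f t v -> u = v) ->
  exists2 u, u0 < u < u1 & forall t, ~ f t u.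
Proof.
move=> u01 hf; pose P t (x : R * R) := ~ f t x.1.
have aeP : {ae @mes2 R, forall x, forall t, P t x}.
  apply: ae_countable => t; have [[u fu]|none] := pselect (exists u, f t u); last first.
    by apply: aeW => x fx; apply: none; exists x.1.
  have := @line_negligible R 1 0 u; move=> /(_ _)H; apply: negligibleS (H _).
    move=> x nx; have fx : f t x.1 by apply: contrapT.
    by rewrite /= mul0r addr0 mul1r (hf _ _ _ fx fu).
  by apply/eqP => -[/eqP]; rewrite oner_eq0.
have d0 : 0 < (u1 - u0) / 2 by lra.
have [y [y1 _ Py]] := ae_box ((u0 + u1) / 2, 0) d0 aeP.
exists y.1 => //; move: y1; rewrite /= ltr_norml => /andP[? ?].
by apply/andP; split; lra.
Qed.

Lemma eq_sum_bool_bij (R : pzSemiRingType) (T1 T2 : eqType) (s1 : seq T1) (s2 : seq T2)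
  (P1 : pred T1) (P2 : pred T2) (f : T2 -> T1) : uniq s1 -> uniq s2 -> injective f ->
  (forall x, P1 x -> x \in s1) -> (forall y, P2 y -> y \in s2) ->
  (forall x, P1 x <-> exists2 y, x = f y & P2 y) ->
  \sum_(x <- s1) (P1 x)%:R = \sum_(y <- s2) (P2 y)%:R :> R.
Proof.
move=> u1 u2 finj h1 h2 h12.
have E (T : eqType) (s : seq T) (P : pred T) : \sum_(x <- s) (P x)%:R = (size [seq x <- s | P x])%:R :> R.
  rewrite -natr_sum; congr (_%:R); rewrite size_filter -sum1_count [RHS]big_mkcond.
  by apply: eq_bigr => x _; case: (P x).
rewrite !E; congr (_%:R).
rewrite -(size_map f [seq x <- s2 | P2 x]); apply: perm_size; apply: uniq_perm.
- exact: filter_uniq.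
- by rewrite map_inj_uniq // filter_uniq.
move=> x; rewrite mem_filter; apply/andP/mapP => [[/h12[y -> Py] _]|[y]].
  by exists y => //; rewrite mem_filter Py h2.
rewrite mem_filter => /andP[Py _] ->.
have P1x : P1 (f y) by apply/h12; exists y.
by split => //; exact: h1.
Qed.

Lemma intr_bound (R : realType) (tau A : R) : 0 < tau -> exists J : nat, forall j : int,
  `|j%:~R * tau| <= A -> (`|j| <= J)%N.
Proof.
move=> t0; exists (Num.truncn (A / tau)).+1 => j; rewrite normrM (gtr0_norm t0) -ler_pdivlMr // => h.
have := le_lt_trans h (truncnS_gt _).
by rewrite -intr_norm -[X in _ < X]/((Num.truncn (A / tau)).+1%:Z%:~R) ltr_int; lia.
Qed.

Lemma absz_affine_le (p q r j : int) (J : nat) : (absz r <= absz p)%N -> (absz j <= J)%N ->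
  (absz (r + q * j)%R <= absz p + absz q * J)%N.
Proof.
move=> rp jJ; have : (absz (q * j)%R <= absz q * J)%N by rewrite abszM leq_mul.
by lia.
Qed.

Lemma pair_addE (R : zmodType) (p q r : R * R) : p + q = r -> q.1 = r.1 - p.1 /\ q.2 = r.2 - p.2.
Proof. by move=> <-; split; rewrite /= addrAC subrr add0r. Qed.

Section Opposite.
Variables (R : realType) (alpha : R * R).
Hypothesis irr : irrational_vector alpha.
Variables (S : set (R * R)) (V : seq (R * R)).
Hypothesis SV : polygon_hull S V.
Implicit Types (x y z p : R * R) (g h : triple).
Notation gpt := (orbit_point alpha).
Notation visits := (visit_sum alpha).
Variables mu C : R.
Hypothesis bnd : forall y n2 n, generic alpha V y -> `|visits S y n2 n - n%:R * mu| <= C.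
Variables a b : R * R.
Hypothesis abE : (a, b) \in hull_edges V.

Let v := (b.1 - a.1, b.2 - a.2).
Let pt (s : R) : R * R := (a.1 + s * v.1, a.2 + s * v.2).

Let ab : a != b. Proof. by have /hull_edgesP[] := abE. Qed.
Let n0 : 0 < v.1 ^+ 2 + v.2 ^+ 2. Proof. exact: sqdist_gt0 ab. Qed.
Let v0 : v != (0, 0).
Proof.
apply: contra ab => /eqP[h1 h2]; apply/eqP/injective_projections; apply/esym/subr0_eq => //.
Qed.

Let vmul_inj (r s : R) : r * v.1 = s * v.1 -> r * v.2 = s * v.2 -> r = s.
Proof.
move=> e1 e2; have /eqP : (r - s) * (v.1 ^+ 2 + v.2 ^+ 2) = 0.
  by rewrite mulrDr !expr2 !mulrA !mulrBl e1 e2; ring.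
by rewrite mulf_eq0 (gt_eqF n0) orbF subr_eq0 => /eqP.
Qed.

(** On the line of ab, each translate of a transverse line excludes a single
    parameter.  The family f is a further countable set to avoid. *)
Lemma exists_good (T : countType) (f : T -> R) (u0 u1 : R) : u0 < u1 ->
  exists2 s, u0 < s < u1 & good_point alpha V a b (pt s) /\ forall t, s != f t.
Proof.
move=> u01.
pose F (t : (triple * nat) + T) (s : R) : Prop := match t with
  | inl (g, i) => let e := nth (0, 0) (hull_edges V) i in
     orient e.1 e.2 (pt s + gpt g) = 0 /\
     v.1 * (e.2.2 - e.1.2) - v.2 * (e.2.1 - e.1.1) != 0
  | inr t => s = f t end.
have [|s s01 hs] := @avoid_countable R _ F u0 u1 u01.
  move=> [[g i]|t] s s' /=; last by move=> -> ->.
  set e := nth _ _ _ => -[ o1 D] [ o2 _].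
  have : (s - s') * (v.1 * (e.2.2 - e.1.2) - v.2 * (e.2.1 - e.1.1)) = 0.
    transitivity (orient e.1 e.2 (pt s' + gpt g) - orient e.1 e.2 (pt s + gpt g)).
      by rewrite /orient /pt /=; ring.
    by rewrite o1 o2 subrr.
  by move/eqP; rewrite mulf_eq0 (negbTE D) orbF subr_eq0 => /eqP.
exists s => //; split; last by move=> t; apply/eqP => e; apply: (hs (inr t)).
move=> g e eE oe.
have eE' : (e.1, e.2) \in hull_edges V by rewrite -surjective_pairing.
have /hull_edgesP[_ _ ne _ _] := eE'.
have D0 : v.1 * (e.2.2 - e.1.2) - v.2 * (e.2.1 - e.1.1) = 0.
  apply/eqP/negPn/negP => D; apply: (hs (inl (g, index e (hull_edges V)))).
  by rewrite /F nth_index.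
have [|k [/(congr1 (fun z => (z.1 - a.1, z.2 - a.2)))[]]] :=
  @on_line _ a b (a.1 + (e.2.1 - e.1.1), a.2 + (e.2.2 - e.1.2)) ab.
  by rewrite -[RHS]D0 /orient /v /=; ring.
rewrite ![a.1 + _]addrC ![a.2 + _]addrC !addrK => k1 k2 _ _.
have [k0|k0|k0] := ltrgt0P k.
- left; rewrite [e]surjective_pairing; symmetry.
  exact: (@parallel_edges_eq _ V a b e.1 e.2 k k0 abE eE' k1 k2).
- by right; split => //; exists (- k); rewrite ?oppr_gt0 // !mulNr !opprK.
- case/negP: ne; apply/eqP/injective_projections; apply/esym/subr0_eq.
    by rewrite k1 k0 mul0r.
  by rewrite k2 k0 mul0r.
Qed.

Lemma hitP s g : hit alpha S a b (pt s) g <->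
  exists2 r, gpt g = (r * v.1, r * v.2) & 0 <= s + r <= 1.
Proof.
split=> [/asboolP[Sp o0]|[r er sr]].
  have /segmentP[t t01 /pair_addE[e1 e2]] := edge_line_segment SV abE Sp o0.
  exists (t - s); last by rewrite addrC subrK.
  by rewrite [gpt g]surjective_pairing e1 e2 /v /pt /=; congr (_, _); ring.
apply/asboolP; have seg : segment a b (pt s + gpt g).
  apply/segmentP; exists (s + r) => //; rewrite er.
  by apply: injective_projections; rewrite /pt /=; ring.
split; last by rewrite er /orient /pt /v /=; ring.
by move: seg; rewrite -(hull_edge_face SV abE) => -[].
Qed.

(** The edge cd runs against v, so that in the parameter of the line of ab,
    after translation by h, it occupies the interval from sg to sg + l. *)
Lemma opposite_hitP s g (c d : R * R) (l sg : R) h : opposite_edge V a b (c, d) -> 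
  gpt h = (d.1 - a.1 - sg * v.1, d.2 - a.2 - sg * v.2) ->
  c.1 - d.1 = l * v.1 -> c.2 - d.2 = l * v.2 ->
  opposite_hit alpha S V a b (pt s) g <->
  exists2 r, gpt (g - h) = (r * v.1, r * v.2) & 0 <= s - sg + r <= l.
Proof.
move=> opp hE l1 l2; have cdE : (c, d) \in hull_edges V by case: opp.
have l0 : 0 < l.
  have [_ [k k0 /= [k1 k2]]] := opp; suff -> : l = k by [].
  by apply: vmul_inj; rewrite -?l1 -?l2 /v /=; lra.
split=> [/asboolP[[c' d'] [ oe Sp o0]]|[r er sr]].
  have [E1 E2] : (c, d) = (c', d').
    have [_ [k k0 /= [k1 k2]]] := opp; have [c'd'E [m m0 /= [m1 m2]]] := oe.
    apply: (@parallel_edges_eq _ V _ _ _ _ (m / k)); rewrite ?divr_gt0 //.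
      by rewrite m1 k1; field; rewrite gt_eqF.
    by rewrite m2 k2; field; rewrite gt_eqF.
  subst c' d'.
  have /segmentP[t /andP[t0 t1] /pair_addE[/= E1 E2]] := edge_line_segment SV cdE Sp o0.
  exists (sg - s + (1 - t) * l).
    rewrite gptD gptN hE; apply: injective_projections => /=.
      transitivity ((1 - t) * (c.1 - d.1) + sg * v.1 - s * v.1); last by rewrite l1 /=; ring.
      by rewrite E1 /v /=; ring.
    transitivity ((1 - t) * (c.2 - d.2) + sg * v.2 - s * v.2); last by rewrite l2 /=; ring.
    by rewrite E2 /v /=; ring.
  have -> : s - sg + (sg - s + (1 - t) * l) = (1 - t) * l by ring.
  apply/andP; split; first by apply: mulr_ge0; [rewrite subr_ge0|exact: ltW].
  by rewrite -[X in _ <= X]mul1r ler_pM2r // gerBl.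
apply/asboolP; exists (c, d).
have seg : segment c d (pt s + gpt g).
  apply/segmentP; exists (1 - (s - sg + r) / l).
    by case/andP: sr => s0 s1; rewrite subr_ge0 ler_pdivrMr // mul1r s1 lerBlDr lerDl divr_ge0 // ltW.
  have gE : gpt g = gpt h + (r * v.1, r * v.2) by rewrite -er gptD gptN addrC subrK.
  have f1 : (s - sg + r) / l * (c.1 - d.1) = (s - sg + r) * v.1.
    by rewrite l1; field; rewrite gt_eqF.
  have f2 : (s - sg + r) / l * (c.2 - d.2) = (s - sg + r) * v.2.
    by rewrite l2; field; rewrite gt_eqF.
  rewrite gE hE; apply: injective_projections; rewrite /pt /=.
    transitivity (d.1 + (s - sg + r) / l * (c.1 - d.1)); last by ring.
    by rewrite f1 /v /=; ring.
  transitivity (d.2 + (s - sg + r) / l * (c.2 - d.2)); last by ring.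
  by rewrite f2 /v /=; ring.
have fc := hull_edge_face SV cdE; move: (seg); rewrite -fc => -[Sp mx]; split => //=.
move/segmentP: seg => [t _ ->]; by rewrite /orient /=; ring.
Qed.

Lemma window_covers (K K' : nat) n2 n N g : n2 < - K%:Z -> K%:Z < n2 + n%:Z ->
  (K' <= N)%N -> (`|g.1| <= K)%N -> (`|g.2.1| <= K')%N -> (`|g.2.2| <= K')%N ->
  g \in window n2 n N.
Proof.
case: g => i [j k] /= h1 h2 h3 h4 h5 h6; rewrite mem_window mem_box2 /=.
by apply/and3P; split; [lia|lia|apply/andP; split; lia].
Qed.

(** A good point inside ab is itself a hit, so by balance some translate of
    it hits an opposite edge. *)
Lemma exists_opposite : exists c d l sg h,
  [/\ opposite_edge V a b (c, d), 0 < l, gpt h = (d.1 - a.1 - sg * v.1, d.2 - a.2 - sg * v.2) /\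
  (c.1 - d.1 = l * v.1 /\ c.2 - d.2 = l * v.2) &
  exists x y, [/\ segment a b x, segment c d y & exists g, y = x + gpt g]].
Proof.
have [s /andP[s0 s1] [gs _]] := exists_good (fun _ : void => 0) (@ltr01 R).
have [n2 [n [N0 [h1 h2 /(_ N0 (leqnn _)) bal]]]] := edge_hits_balance irr SV abE 0 bnd gs.
have hit0 : hit alpha S a b (pt s) 0.
  apply/hitP; exists 0; rewrite ?addr0 ?(ltW s0) ?(ltW s1) //.
  by rewrite /orbit_point /= !mul0r !addr0.
have w0 : 0 \in window n2 n N0.
  by apply: (@window_covers 0 0) => //=; lia.
have : 0 < \sum_(g <- window n2 n N0) (opposite_hit alpha S V a b (pt s) g)%:R :> R.
  by rewrite -bal sum_bool_gt0; apply/hasP; exists 0.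
rewrite sum_bool_gt0 => /hasP[g gw /asboolP[[c d] [ oe Sp o0]]].
have [cdE [l l0 /= [l1 l2]]] := oe.
have /segmentP[t t01 /pair_addE[E1 E2]] := edge_line_segment SV cdE Sp o0.
exists c, d, l, (s - (1 - t) * l), (- (- g)).
have eqc1 : c.1 - d.1 = l * v.1 by rewrite /v /=; move: l1; lra.
have eqc2 : c.2 - d.2 = l * v.2 by rewrite /v /=; move: l2; lra.
split => //.
  split=> //; rewrite opprK [gpt g]surjective_pairing E1 E2; congr (_, _) => /=.
    transitivity (d.1 - a.1 - s * v.1 + (1 - t) * (c.1 - d.1)); first by rewrite /pt /v /=; ring.
    by rewrite eqc1 /v /=; ring.
  transitivity (d.2 - a.2 - s * v.2 + (1 - t) * (c.2 - d.2)); first by rewrite /pt /v /=; ring.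
  by rewrite eqc2 /v /=; ring.
exists (pt s), (pt s + gpt g); split; last by exists g.
  by apply/segmentP; exists s; rewrite ?(ltW s0) ?(ltW s1).
exact: (edge_line_segment SV cdE Sp o0).
Qed.

(** When no nonzero group element is parallel to the edge, both counts are 0
    or 1, and two intervals that agree on a dense set have the same ends. *)
Lemma trivial_line_case (l sg : R) : 0 < l ->
  (forall u0 u1, u0 < u1 -> exists2 s, u0 < s < u1 & (0 <= s <= 1) = (0 <= s - sg <= l)) ->
  sg = 0 /\ l = 1.
Proof.
move=> l0 H.
have sg0 : sg = 0.
  apply/eqP; rewrite eq_le; apply/andP; split; rewrite leNgt; apply/negP => sgn.
    have [|s /andP[]] := H 0 (Num.min sg 1); first by rewrite lt_min sgn ltr01.
    rewrite lt_min => s0 /andP[s1 s2].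
    by rewrite (ltW s0) (ltW s2) /= subr_ge0 leNgt s1.
  have [|s /andP[s0]] := H sg (Num.min 0 (sg + l)).
    by rewrite lt_min sgn ltrDl.
  rewrite lt_min => /andP[s1 s2].
  by rewrite [0 <= s]leNgt s1 /= subr_ge0 (ltW s0) lerBlDl (ltW s2).
split=> //; move: H; rewrite sg0 => H.
apply/eqP; rewrite eq_le; apply/andP; split; rewrite leNgt; apply/negP => ln.
  have [s /andP[s0 s1]] := H 1 l ln; rewrite subr0 [s <= 1]leNgt s0 andbF (ltW s1) andbT.
  by move/esym/negbT; rewrite -ltNge => k; have := lt_trans ltr01 s0; rewrite ltNge (ltW k).
have [s /andP[s0 s1]] := H l 1 ln; rewrite subr0 [s <= l]leNgt s0 andbF (ltW s1) andbT.
by move/negbT; rewrite -ltNge => k; have := lt_trans l0 s0; rewrite ltNge (ltW k).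
Qed.

Lemma scaled_count (tau A B : R) (J : nat) : 0 < tau -> A <= B ->
  (forall j : int, A <= j%:~R * tau <= B -> j \in box J) ->
  (forall j : int, j%:~R * tau != B) ->
  \sum_(j <- box J) (A <= j%:~R * tau <= B)%R%:R =
  (Num.ceil (B / tau) - Num.ceil (A / tau))%:~R :> R.
Proof.
move=> t0 AB hJ hB.
have E (j : int) : (A <= j%:~R * tau <= B) = ((A / tau <= j%:~R) && (j%:~R < B / tau)).
  by rewrite ler_pdivrMr // ltr_pdivlMr // lt_neqAle hB.
rewrite -(@count_integers _ _ _ (box J)) ?box_uniq //.
- by apply: eq_bigr => j _; rewrite E.
- by rewrite ler_pM2r ?invr_gt0.
- by move=> j h1 h2; apply: hJ; rewrite E h1.
Qed.

(** With tau v generating the group elements on the line, the hits of pt s are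
    the multiples of tau in an interval of length 1, and those of the opposite
    edge the multiples in an interval of length l, shifted by sg.  In units of
    tau, [ceil_count_eq] gives l = 1 and that 1/tau or sg/tau is an integer:
    either v or the shift sg v is a group element. *)
Lemma opposite_edge_conditions : exists c d, [/\ (c, d) \in hull_edges V,
   c.1 - d.1 = v.1 /\ c.2 - d.2 = v.2,
   exists x y, [/\ segment a b x, segment c d y & exists g, y = x + gpt g] &
   (exists g, d - a = gpt g) \/ (exists g, v = gpt g)].
Proof.
have [c [d [l [sg [h [oe l0 [hE [l1 l2]] pts]]]]]] := exists_opposite.
have cdE : (c, d) \in hull_edges V by case: oe.
have [tau [g0 [tau0 g0E cyc]]] := gpt_line_cyclic irr v0.
suff [L [[g gE]|[g gE]]] : l = 1 /\ ((exists g, gpt g = (sg * v.1, sg * v.2)) \/ (exists g, gpt g = v)).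
- exists c, d; split => //; first by rewrite l1 l2 L !mul1r.
  left; exists (g + h); rewrite gptD gE hE.
  by apply: injective_projections => /=; ring.
- exists c, d; split => //; first by rewrite l1 l2 L !mul1r.
  by right; exists g.
pose W1 s n2 n N := \sum_(g <- window n2 n N) (hit alpha S a b (pt s) g)%:R : R.
pose W2 s n2 n N := \sum_(g <- window n2 n N) (opposite_hit alpha S V a b (pt s) g)%:R : R.
have bal s K : good_point alpha V a b (pt s) -> exists n2 n N0, [/\ n2 < - K%:Z, K%:Z < n2 + n%:Z &
   forall N, (N0 <= N)%N -> W1 s n2 n N = W2 s n2 n N].
  by move=> gs; exact: (edge_hits_balance irr SV abE K bnd gs).
have hp s g := hitP s g; have hp' s g := opposite_hitP s g oe hE l1 l2.
have [t00|tn0] := eqVneq tau 0.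
  have [||sg0 l11] := @trivial_line_case l sg; first exact: l0; last first.
    split=> //; left; exists 0; rewrite sg0 !mul0r.
    by rewrite /orbit_point /= !mul0r !addr0.
  move=> u0 u1 u01.
  have [s s01 [gs _]] := exists_good (fun _ : void => 0) u01; exists s => //.
  pose K := (maxn `|h.1| (maxn `|h.2.1| `|h.2.2|))%N.
  have [n2 [n [N0 [k1 k2 k3]]]] := bal s K gs.
  have {k3} := k3 (maxn N0 K) (leq_maxl _ _).
  have triv g r : gpt g = (r * v.1, r * v.2) -> g = 0 /\ r = 0.
    move=> e; have g00 : g0 = 0 by apply: (gpt_eq0 irr); rewrite g0E t00 !mul0r.
    have gz : g = 0 by have [j ->] := cyc g r e; rewrite g00 mul0rz.
    split => //; move: e; rewrite gz => e; apply: vmul_inj.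
      by move: (congr1 fst e) => /= <-; rewrite !mul0r addr0.
    by move: (congr1 snd e) => /= <-; rewrite !mul0r addr0.
  have g000 : gpt 0 = (0 * v.1, 0 * v.2) by rewrite /orbit_point /= !mul0r !addr0.
  rewrite /W1 /W2.
  rewrite (@eq_sum_bool_bij R _ unit _ [:: tt] _ (fun _ => 0 <= s <= 1) (fun _ => 0)) ?window_uniq //; first last.
  - move=> g; split=> [/hp[r e]|[u -> s1]].
      by have [-> ->] := triv _ _ e; rewrite addr0 => ?; exists tt.
    by apply/hp; exists 0; rewrite ?addr0.
  - move=> g /hp[r e _]; have [-> _] := triv _ _ e.
    by apply: (window_covers k1 k2 (leq_maxr N0 K)).
  - by move=> [] [].
  rewrite big_seq1.
  rewrite (@eq_sum_bool_bij R _ unit _ [:: tt] _ (fun _ => 0 <= s - sg <= l) (fun _ => h)) ?window_uniq //; first last.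
  - move=> g; split=> [/hp'[r e]|[u -> s1]].
      have [/eqP + ->] := triv _ _ e; rewrite addr0 subr_eq0 => /eqP -> ?.
      by exists tt.
    by apply/hp'; exists 0; rewrite ?subrr ?addr0.
  - move=> g /hp'[r e _]; have [/eqP + _] := triv _ _ e; rewrite subr_eq0 => /eqP ->.
    by apply: (window_covers k1 k2 (leq_maxr N0 K)); rewrite /K !leq_max leqnn ?orbT.
  - by move=> [] [].
  rewrite big_seq1 => /eqP; rewrite eqr_nat; by case: (0 <= s <= 1); case: (0 <= s - sg <= l).
have {tn0} tp : 0 < tau by rewrite lt_neqAle eq_sym tn0.
have multE (j : int) : gpt (g0 *~ j) = (j%:~R * tau * v.1, j%:~R * tau * v.2).
  by rewrite gptMz g0E; apply: injective_projections => /=; rewrite mulrA.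
have [LM isz] : tau^-1 = l / tau /\ (isZ tau^-1 \/ isZ (sg / tau)).
  apply: ceil_count_eq => u0 u1 u01.
(* at these parameters a hit would be the right end of an edge *)
  pose F (t : int * bool) : R := if t.2 then 1 - t.1%:~R * tau else sg + l - t.1%:~R * tau.
  have tu : u0 * tau < u1 * tau by rewrite ltr_pM2r.
  have [s /andP[s0 s1] [gs sF]] := exists_good F tu.
  exists (s / tau); first by rewrite ltr_pdivlMr // ltr_pdivrMr // s0.
  have [J1 hJ1] := intr_bound (1 + `|s|) tp.
  have [J2 hJ2] := intr_bound (l + `|s - sg|) tp.
  pose J := maxn J1 J2.
  have jb1 (j : int) : - s <= j%:~R * tau <= 1 - s -> j \in box J.
    case/andP=> j1 j2; rewrite mem_box leq_max hJ1 //.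
    have := ler_norm s; have := ler_norm (- s); rewrite normrN ler_norml => *.
    by apply/andP; split; lra.
  have jb2 (j : int) : sg - s <= j%:~R * tau <= sg + l - s -> j \in box J.
    case/andP=> j1 j2; rewrite mem_box leq_max hJ2 ?orbT //.
    have := ler_norm (s - sg); have := ler_norm (- (s - sg)); rewrite normrN ler_norml => *.
    by apply/andP; split; lra.
  pose K := (maxn (`|h.1| + `|g0.1| * J) (maxn (`|h.2.1| + `|g0.2.1| * J) (`|h.2.2| + `|g0.2.2| * J)))%N.
  have [n2 [n [N0 [k1 k2 k3]]]] := bal s K gs.
  have {k3} := k3 (maxn N0 K) (leq_maxl _ _).
  have cov (g : triple) (hh : triple) (j : int) : j \in box J -> g = hh + g0 *~ j ->
      (`|hh.1| <= `|h.1|)%N -> (`|hh.2.1| <= `|h.2.1|)%N -> (`|hh.2.2| <= `|h.2.2|)%N ->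
      g \in window n2 n (maxn N0 K).
    move=> jJ -> b1 b2 b3; rewrite mem_box in jJ.
    apply: (window_covers k1 k2 (leq_maxr N0 K)); rewrite tripleMz /=.
    - by rewrite /K leq_max absz_affine_le.
    - by rewrite /K !leq_max absz_affine_le ?orbT.
    - by rewrite /K !leq_max absz_affine_le ?orbT.
  have g0inj : injective (fun j : int => g0 *~ j).
    move=> i j /(congr1 gpt); rewrite !multE => e.
    have := vmul_inj (congr1 fst e) (congr1 snd e) => /(mulIf (lt0r_neq0 tp))/eqP.
    by rewrite eqr_int => /eqP.
  have uniqr (g : triple) (r : R) : gpt g = (r * v.1, r * v.2) -> exists2 j : int, g = g0 *~ j & r = j%:~R * tau.
    move=> e; have [j gj] := cyc g r e; exists j => //.
    by move: e; rewrite gj multE => -[e1 e2]; apply: vmul_inj.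
  rewrite /W1 /W2.
  rewrite (@eq_sum_bool_bij R _ int _ (box J) _ (fun j => - s <= j%:~R * tau <= 1 - s) (fun j => g0 *~ j)) ?window_uniq ?box_uniq //; first last.
  - move=> g; split=> [/hp[r e /andP[r1 r2]]|[j -> /andP[r1 r2]]].
      by have [j gj rj] := uniqr _ _ e; exists j => //; rewrite -rj; apply/andP; split; lra.
    by apply/hp; exists (j%:~R * tau); rewrite ?multE //; apply/andP; split; lra.
  - move=> g /hp[r e /andP[r1 r2]]; have [j gj rj] := uniqr _ _ e.
    apply: (cov g 0 j) => //; last by rewrite add0r.
    by apply: jb1; rewrite -rj; apply/andP; split; lra.
  rewrite (@eq_sum_bool_bij R _ int _ (box J) _ (fun j => sg - s <= j%:~R * tau <= sg + l - s) (fun j => h + g0 *~ j)) ?window_uniq ?box_uniq //; first last.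
  - move=> g; split=> [/hp'[r e /andP[r1 r2]]|[j -> /andP[r1 r2]]].
      have [j gj rj] := uniqr _ _ e; exists j; first by rewrite -gj addrC subrK.
      by rewrite -rj; apply/andP; split; lra.
    apply/hp'; exists (j%:~R * tau); first by rewrite addrAC subrr add0r multE.
    by apply/andP; split; lra.
  - move=> g /hp'[r e /andP[r1 r2]]; have [j gj rj] := uniqr _ _ e.
    apply: (cov g h j) => //; last by rewrite -gj addrC subrK.
    by apply: jb2; rewrite -rj; apply/andP; split; lra.
  - by move=> i j /addrI/g0inj.
  rewrite !scaled_count //; first last.
  - move=> j; apply/eqP => e; case/negP: (sF (j, true)); apply/eqP; rewrite /F /= e; ring.
  - by rewrite lerDr.
  - move=> j; apply/eqP => e; case/negP: (sF (j, false)); apply/eqP; rewrite /F /= e; ring.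
  - by rewrite lerD2r lerDl ltW.
  move=> /eqP; rewrite eqr_int => /eqP.
  have -> : tau^-1 - s / tau = (1 - s) / tau by field; rewrite gt_eqF.
  have -> : sg / tau + l / tau - s / tau = (sg + l - s) / tau by field; rewrite gt_eqF.
  have -> : sg / tau - s / tau = (sg - s) / tau by field; rewrite gt_eqF.
  by rewrite -mulNr.
have l11 : l = 1.
  by move/(congr1 ( *%R^~ tau)): LM; rewrite mulVf ?gt_eqF // divfK ?gt_eqF.
split=> //; case: isz => /isZP[k kE]; [right|left]; exists (g0 *~ k); rewrite multE -kE.
  by rewrite mulVf ?gt_eqF // !mul1r.
by rewrite divfK ?gt_eqF.
Qed.

End Opposite.

(** * Necessity of the conditions *)

Section Necessity.
Variables (R : realType) (alpha : R * R).
Implicit Types (a b c d x y : R * R) (S : set (R * R)).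

Definition edge_pair_condition a b a' b' : Prop :=
  (exists x y, [/\ segment a b x, segment a' b' y & Zalpha_Z2 alpha (y - x)]) /\
  (~ Zalpha_Z2 alpha (midpoint a' b' - midpoint a b) ->
   Zalpha_Z2 alpha (b - a) /\ Zalpha_Z2 alpha (b' - a')).

Lemma segmentC a b : segment a b = segment b a.
Proof.
by apply/seteqP; split=> x /segmentP[t t01 ->]; apply/segmentP; exists (1 - t);
  rewrite ?subr_ge0 ?lerBlDr ?lerDl 1?andbC //; apply: injective_projections => /=; ring.
Qed.

Lemma midpointC a b : midpoint a b = midpoint b a.
Proof. by rewrite /midpoint addrC. Qed.

Lemma Zalpha_Z2N x : Zalpha_Z2 alpha (- x) -> Zalpha_Z2 alpha x.
Proof. by move/Zalpha_Z2P=> [g e]; apply/Zalpha_Z2P; exists (- g); rewrite gptN -e opprK. Qed.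

Lemma Zalpha_Z2B a b : Zalpha_Z2 alpha (a - b) -> Zalpha_Z2 alpha (b - a).
Proof. by move=> h; apply: Zalpha_Z2N; rewrite opprB. Qed.

Lemma edge_pair_conditionCl a b a' b' : edge_pair_condition a b a' b' -> edge_pair_condition b a a' b'.
Proof.
rewrite /edge_pair_condition (segmentC a b) (midpointC a b) => -[h1 h2]; split => // /h2[h3 h4].
by split => //; exact: Zalpha_Z2B.
Qed.

Lemma edge_pair_conditionCr a b a' b' : edge_pair_condition a b a' b' -> edge_pair_condition a b b' a'.
Proof.
rewrite /edge_pair_condition (segmentC a' b') (midpointC a' b') => -[h1 h2]; split => // /h2[h3 h4].
by split => //; exact: Zalpha_Z2B.
Qed.

Lemma scale_pairE (t : R) x : t *: x = (t * x.1, t * x.2).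
Proof. by apply: injective_projections. Qed.

Hypothesis irr : irrational_vector alpha.

Lemma bounded_remainder_edges S (V : seq (R * R)) : polygon_hull S V ->
  bounded_remainder_set alpha S ->
  centrally_symmetric S /\
  forall a b a' b', edge S a b -> edge S a' b' -> segment a b <> segment a' b' ->
    parallel (b - a) (b' - a') -> edge_pair_condition a b a' b'.
Proof.
move=> SV [_ _ [C0 hC0]].
have nc : noncollinear V by case: SV.
pose C := Num.max 0 C0.
have bnd : forall y n2 n, generic alpha V y ->
    `|visit_sum alpha S y n2 n - n%:R * fine (mes2 S)| <= C.
  apply: (bounded_remainder_generic SV) => [|n n0]; first by rewrite /C le_max lexx.
  apply: negligibleS (hC0 n n0) => x nx hx; apply: nx => sx.
  by apply: le_trans (hx sx) _; rewrite /C le_max lexx orbT.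
have opp a b (abE : (a, b) \in hull_edges V) := opposite_edge_conditions irr SV bnd abE.
split.
  have [|m hm] := opposite_edges_center nc.
    move=> a b abE; have [c [d [cdE [e1 e2] _ _]]] := opp a b abE.
    exists c, d; split => //; apply: injective_projections => /=.
      by move: e1 => /=; lra.
    by move: e2 => /=; lra.
  exists (2^-1 *: m) => x Sx.
  have -> : (2^-1 *: m) *+ 2 - x = m - x.
    congr (_ - x); rewrite mulr2n scale_pairE.
    by apply: injective_projections => /=; field.
  case: SV => _ _ _ SE; apply/SE => a b abE.
  have /SE/(_ _ _ (hm a b abE)) := Sx; congr (_ <= _).
  by rewrite /orient /=; ring.
have oriented a b a' b' : (a, b) \in hull_edges V -> (a', b') \in hull_edges V ->
    segment a b <> segment a' b' -> parallel (b - a) (b' - a') -> edge_pair_condition a b a' b'.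
  move=> abE abE' ne [t t0]; rewrite scale_pairE => e.
  have t1 : b'.1 - a'.1 = t * (b.1 - a.1) by have := congr1 fst e.
  have t2 : b'.2 - a'.2 = t * (b.2 - a.2) by have := congr1 snd e.
  have [tp|tn|//] := ltrgt0P t; last by move=> tz; rewrite tz eqxx in t0.
    by case: ne; case: (parallel_edges_eq tp abE abE' t1 t2) => -> ->.
  have [c [d [cdE [/= e1 e2] pts alt]]] := opp a b abE.
  have [-> ->] : (a', b') = (c, d).
    apply: (@parallel_edges_eq _ V _ _ _ _ (- t^-1)) => //.
    - by rewrite oppr_gt0 invr_lt0.
    - by rewrite t1 mulNr mulrA mulVf // mul1r; lra.
    - by rewrite t2 mulNr mulrA mulVf // mul1r; lra.
  split.
    have [x [y [sx sy [g ey]]]] := pts; exists x, y; split => //.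
    by apply/Zalpha_Z2P; exists g; rewrite ey addrAC subrr add0r.
  have -> : midpoint c d - midpoint a b = d - a.
    rewrite /midpoint !scale_pairE; apply: injective_projections => /=.
      by apply/eqP; rewrite -subr_eq0; apply/eqP; have := e1; lra.
    by apply/eqP; rewrite -subr_eq0; apply/eqP; have := e2; lra.
  move=> nz; case: alt => [[g ge]|[g ge]]; first by case: nz; apply/Zalpha_Z2P; exists g.
  have ba : b - a = orbit_point alpha g by rewrite -ge; apply: injective_projections.
  split; first by apply/Zalpha_Z2P; exists g.
  apply/Zalpha_Z2B/Zalpha_Z2P; exists g; rewrite -ge.
  by apply: injective_projections.
move=> a b a' b' e e' ne par.
have parN (u w : R * R) : parallel u w -> parallel (- u) w.
  by move=> [t t0 ->]; exists (- t); rewrite ?oppr_eq0 // scalerN scaleNr opprK.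
have parN' (u w : R * R) : parallel u w -> parallel u (- w).
  by move=> [t t0 ->]; exists (- t); rewrite ?oppr_eq0 // scaleNr.
have [abE|abE] := edge_hull_edge SV e; have [abE'|abE'] := edge_hull_edge SV e'.
- exact: oriented.
- apply: edge_pair_conditionCr; apply: oriented => //; first by rewrite (segmentC b').
  by rewrite -(opprB b'); exact: parN'.
- apply: edge_pair_conditionCl; apply: oriented => //; first by rewrite (segmentC b).
  by rewrite -(opprB b); exact: parN.
- apply: edge_pair_conditionCl; apply: edge_pair_conditionCr; apply: oriented => //.
    by rewrite (segmentC b) (segmentC b').
  by rewrite -(opprB b) -(opprB b'); apply: parN; exact: parN'.
Qed.

End Necessity.

(** * Functions with bounded sums along the orbits *)

Local Arguments orbit_point : simpl never.

Section Coboundary.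
Variables (R : realType) (alpha : R * R).
Implicit Types (F G H phi psi : R * R -> R) (x y p q a b c : R * R) (g h : triple).
Notation gpt := (orbit_point alpha).

(** The bound is required at all points, not almost all: this keeps the
    calculus of [eqBR] free of exceptional sets. *)
Definition bounded_sums F := exists C, forall n x, `|\sum_(k < n) F (x + gpt (k%:Z, 0))| <= C.
Definition eqBR F G := bounded_sums (fun x => F x - G x).

Lemma bounded_sums_ext F G : F =1 G -> bounded_sums F -> bounded_sums G.
Proof.
move=> e [C h]; exists C => n x; have := h n x.
by congr (`|_| <= _); apply: eq_bigr => k _; rewrite e.
Qed.

Lemma bounded_sumsD F G : bounded_sums F -> bounded_sums G -> bounded_sums (fun x => F x + G x).
Proof.
move=> [C h] [D k]; exists (C + D) => n x; rewrite big_split /=.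
by apply: le_trans (ler_normD _ _) _; apply: lerD; [exact: h|exact: k].
Qed.

Lemma bounded_sumsZ (r : R) F : bounded_sums F -> bounded_sums (fun x => r * F x).
Proof. by move=> [C h]; exists (`|r| * C) => n x; rewrite -mulr_sumr normrM ler_wpM2l // h. Qed.

Lemma bounded_sums_shift p F : bounded_sums F -> bounded_sums (fun x => F (x + p)).
Proof.
move=> [C h]; exists C => n x; have := h n (x + p).
by under eq_bigr do rewrite addrAC.
Qed.

Lemma bounded_sums0 : bounded_sums (fun=> 0).
Proof. by exists 0 => n x; rewrite big1 ?normr0. Qed.

Lemma eqBR_ext F G : F =1 G -> eqBR F G.
Proof. by move=> e; apply: bounded_sums_ext bounded_sums0 => x; rewrite e subrr. Qed.

Lemma eqBR_trans F G H : eqBR F G -> eqBR G H -> eqBR F H.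
Proof. by move=> h k; apply: bounded_sums_ext (bounded_sumsD h k) => x; rewrite addrA subrK. Qed.

Lemma eqBR_sym F G : eqBR F G -> eqBR G F.
Proof. by move=> h; apply: bounded_sums_ext (bounded_sumsZ (-1) h) => x; rewrite mulN1r opprB. Qed.

Lemma eqBRD F F' G G' : eqBR F F' -> eqBR G G' -> eqBR (fun x => F x + G x) (fun x => F' x + G' x).
Proof. by move=> h k; apply: bounded_sums_ext (bounded_sumsD h k) => x; ring. Qed.

Lemma eqBR_sum (T : eqType) (s : seq T) (f f' : T -> R * R -> R) :
  (forall t, t \in s -> eqBR (f t) (f' t)) ->
  eqBR (fun x => \sum_(t <- s) f t x) (fun x => \sum_(t <- s) f' t x).
Proof.
elim: s => [|t s IH] h; first by apply: eqBR_ext => x; rewrite !big_nil.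
have /eqBRD := h t (mem_head _ _) => /(_ _ _ (IH _)) k.
apply: (eqBR_trans (eqBR_ext _) (eqBR_trans (k _) (eqBR_ext _))) => [x|u us|x]; rewrite ?big_cons //.
by apply: h; rewrite inE us orbT.
Qed.

Definition periodic H := forall x m, H (x + Z2 m) = H x.
Definition sup_bounded H := exists D, forall x, `|H x| <= D.

(** For g = alpha the sum of the difference telescopes; general g are reached
    by composition. *)
Lemma eqBR_translate H g : periodic H -> sup_bounded H -> eqBR (fun x => H (x + gpt g)) H.
Proof.
move=> perH [D HD].
have trD h k : eqBR (fun x => H (x + gpt h)) H -> eqBR (fun x => H (x + gpt k)) H ->
    eqBR (fun x => H (x + gpt (h + k))) H.
  move=> e1 e2; apply: eqBR_trans e1; have := bounded_sums_shift (gpt h) e2.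
  by apply: bounded_sums_ext => x; rewrite gptD addrA.
have trN h : eqBR (fun x => H (x + gpt h)) H -> eqBR (fun x => H (x + gpt (- h))) H.
  move/eqBR_sym => e; have := bounded_sums_shift (- gpt h) e.
  by apply: bounded_sums_ext => x; rewrite gptN subrK.
have tr1 : eqBR (fun x => H (x + gpt (1, 0))) H.
  exists (D + D) => n x.
  have -> : \sum_(k < n) (H (x + gpt (k%:Z, 0) + gpt (1, 0)) - H (x + gpt (k%:Z, 0))) =
     H (x + gpt (n%:Z, 0)) - H (x + gpt (0%:Z, 0)).
    elim: n => [|n IH]; first by rewrite big_ord0 subrr.
    rewrite big_ord_recr /= IH -[x + _ + _]addrA -gptD.
    have -> : ((n%:Z, 0) + (1, 0) : triple) = (n.+1%:Z, 0).
      by congr (_, _); rewrite ?addr0 // -addn1 PoszD.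
    ring.
  by apply: le_trans (ler_normB _ _) _; apply: lerD; exact: HD.
have tr0 m : eqBR (fun x => H (x + gpt (0, m))) H.
  by apply: eqBR_ext => x; rewrite gpt0E perH.
have trn (n : nat) : eqBR (fun x => H (x + gpt (n%:Z, 0))) H.
  elim: n => [|n IH]; first exact: tr0.
  have := trD _ _ tr1 IH; apply: bounded_sums_ext => x.
  by congr (H (_ + gpt (_, _)) - _); rewrite ?addr0 //= -add1n PoszD.
have -> : g = (g.1, 0) + (0, g.2).
  by rewrite [LHS]surjective_pairing; congr (_, _); rewrite ?addr0 ?add0r.
apply: trD (tr0 _); case: (g.1) => n; first exact: trn.
have := trN _ (trn n.+1); apply: bounded_sums_ext => x.
by congr (H (_ + gpt (_, _)) - _); rewrite ?oppr0 // NegzE.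
Qed.

(** The conditions under which the sum over the horizontal translates is
    a bounded Z^2-periodic function. *)
Definition admissible (phi : R * R -> R) :=
  [/\ exists B : nat, forall x, B%:R < `|x.1| -> phi x = 0,
      sup_bounded phi & forall x (k : int), phi (x.1, x.2 + k%:~R) = phi x].

Definition per (phi : R * R -> R) x : R := \sum_(j \in [set: int]) phi (x.1 + j%:~R, x.2).

Lemma per_box phi x (N : nat) : (forall j : int, phi (x.1 + j%:~R, x.2) != 0 -> j \in box N) ->
  per phi x = \sum_(j <- box N) phi (x.1 + j%:~R, x.2).
Proof.
move=> h; rewrite /per [RHS]fsbig_seq ?box_uniq //.
symmetry; apply: fsbig_widen => // j [_ /= jn]; apply/eqP/negPn/negP => /h.
by [].
Qed.

Lemma per_periodic phi : (forall x (k : int), phi (x.1, x.2 + k%:~R) = phi x) -> periodic (per phi).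
Proof.
move=> hp x m; rewrite /per (reindex_fsbigT (fun j => j - m.1)) /=; last first.
  by exists (fun j => j + m.1) => j; rewrite ?subrK ?addrK.
apply: eq_fsbigr => j _; rewrite -[RHS](hp _ m.2) /=; congr (phi (_, _)).
by rewrite intrB; ring.
Qed.

Lemma support_box phi (B : nat) x (j : int) : (forall x, B%:R < `|x.1| -> phi x = 0) ->
  phi (x.1 + j%:~R, x.2) != 0 -> j \in box ((Num.truncn (`|x.1|)).+1 + B).
Proof.
move=> hB nz; apply: box_bound (lexx _) (leqnn _) _; rewrite leNgt; apply: contra nz => lt.
by apply/eqP/hB.
Qed.

Lemma per_boxE phi (B : nat) x (N : nat) : (forall x, B%:R < `|x.1| -> phi x = 0) ->
  ((Num.truncn (`|x.1|)).+1 + B <= N)%N -> per phi x = \sum_(j <- box N) phi (x.1 + j%:~R, x.2).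
Proof.
move=> hB hN; apply: per_box => j /(support_box hB); rewrite !mem_box => h.
exact: leq_trans hN.
Qed.

Lemma per_bounded phi : admissible phi -> sup_bounded (per phi).
Proof.
move=> [[B hB] [D hD] hp]; have pp := per_periodic hp.
exists (\sum_(j <- box (1 + B)) D) => x.
rewrite -(pp x (- Num.floor x.1, 0)); pose y : R * R := x + Z2 (- Num.floor x.1, 0); rewrite -/y.
have /andP[y0 y1] : 0 <= y.1 < 1.
  have /andP[] := floor_itv x.1; rewrite intrD /y /= intrN => *.
  by apply/andP; split; lra.
rewrite (@per_boxE _ B _ (1 + B)) //.
  by apply: le_trans (ler_norm_sum _ _ _) _; apply: ler_sum.
have -> : Num.truncn `|y.1| = 0%N by apply: truncn_def; rewrite ger0_norm // y0.
by [].
Qed.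

Lemma perD phi psi x : admissible phi -> admissible psi ->
  per (fun z => phi z + psi z) x = per phi x + per psi x.
Proof.
move=> [[B hB] _ _] [[B' hB'] _ _].
pose N := ((Num.truncn (`|x.1|)).+1 + (B + B'))%N.
have h (B1 : nat) (z : R * R) : (B + B')%N%:R < `|z.1| -> B%:R < `|z.1| /\ B'%:R < `|z.1|.
  by rewrite natrD => k; have := ler0n R B; have := ler0n R B'; split; lra.
rewrite (@per_boxE _ (B + B') _ N) //.
  rewrite (@per_boxE phi B _ N) ?(@per_boxE psi B' _ N) ?big_split //; rewrite /N; lia.
by move=> z /(h 0%N)[h1 h2]; rewrite hB // hB' // addr0.
Qed.

Lemma perZ (r : R) phi x : admissible phi -> per (fun z => r * phi z) x = r * per phi x.
Proof.
move=> [[B hB] _ _]; pose N := ((Num.truncn (`|x.1|)).+1 + B)%N.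
rewrite !(@per_boxE _ B _ N) // ?mulr_sumr // => z /hB ->; by rewrite mulr0.
Qed.

Lemma eq_per phi psi : phi =1 psi -> per phi =1 per psi.
Proof. by move=> e x; apply: eq_fsbigr => j _; rewrite e. Qed.

Lemma per_shift phi p x : per phi (x + p) = per (fun z => phi (z + p)) x.
Proof. by apply: eq_fsbigr => j _; congr phi; apply: injective_projections => //=; ring. Qed.

Lemma eqBR_per phi g : admissible phi -> eqBR (fun x => per phi (x + gpt g)) (per phi).
Proof.
move=> hphi; apply: eqBR_translate; last exact: per_bounded.
by case: hphi => _ _; exact: per_periodic.
Qed.

(** On the projection of the edge to the first axis, +1 if the edge runs to the
    left, as on the upper boundary, and -1 if it runs to the right. *)
Definition step (a b : R * R) (t : R) : R := (b.1 <= t)%R%:R - (a.1 <= t)%R%:R.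
Definition line (a b : R * R) (t : R) : R := a.2 + (t - a.1) * ((b.2 - a.2) / (b.1 - a.1)).
(** The ceiling counts the integer points below the edge on the vertical line,
    up to a constant; adding x.2 makes it periodic in x.2, and these additions
    cancel between the lower and the upper boundary. *)
Definition edge_fun a b x : R := step a b x.1 * ((Num.ceil (line a b x.1 - x.2))%:~R + x.2).
Definition saw p x : R := (Num.ceil (p.1 - x.1))%:~R - (p.1 - x.1).

Lemma stepN a b t : step b a t = - step a b t.
Proof. by rewrite /step opprB. Qed.
Lemma stepD a b c t : step a b t + step b c t = step a c t.
Proof. by rewrite /step; ring. Qed.
Lemma step_same a b t : a.1 = b.1 -> step a b t = 0.
Proof. by rewrite /step => ->; rewrite subrr. Qed.
Lemma step_out a b t : `|a.1| + `|b.1| < `|t| -> step a b t = 0.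
Proof.
move=> h; have ta : (a.1 <= t) = (0 <= t) /\ (b.1 <= t) = (0 <= t).
  have ha := ler_norm a.1; have ha' := ler_norm (- a.1).
  have hb := ler_norm b.1; have hb' := ler_norm (- b.1).
  rewrite !normrN in ha' hb'.
  have [t0|t0] := leP 0 t.
    rewrite (ger0_norm t0) in h; split; apply/idP; lra.
  rewrite (ltr0_norm t0) in h; split; apply/negbTE; rewrite -ltNge; lra.
by rewrite /step; case: ta => -> ->; rewrite subrr.
Qed.
Lemma step_cases a b t : step a b t != 0 ->
  [/\ `|step a b t| = 1, a.1 != b.1 & `|t - a.1| <= `|b.1 - a.1| ].
Proof.
rewrite /step; case: (leP b.1 t) => bt; case: (leP a.1 t) => at_; rewrite ?subrr ?eqxx //= => _.
  rewrite subr0 normr1; split => //; first by rewrite gt_eqF //; lra.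
  by rewrite (ler0_norm (_ : t - a.1 <= 0)) ?(ler0_norm (_ : b.1 - a.1 <= 0)); lra.
rewrite sub0r normrN1; split => //; first by rewrite lt_eqF //; lra.
by rewrite !ger0_norm; lra.
Qed.

Lemma admissible_step a b : admissible (fun x => step a b x.1).
Proof.
split => //.
  exists (Num.truncn (`|a.1| + `|b.1|)).+1 => x h; apply: step_out.
  by apply: lt_trans h; exact: truncnS_gt.
exists 1 => x; have [->|/step_cases[-> _ _]] := eqVneq (step a b x.1) 0; by rewrite ?normr0 ?ler01.
Qed.

Lemma admissible_edge a b : admissible (edge_fun a b).
Proof.
split.
- exists (Num.truncn (`|a.1| + `|b.1|)).+1 => x h; rewrite /edge_fun step_out ?mul0r //.
  by apply: lt_trans h; exact: truncnS_gt.
- exists (`|a.2| + `|b.2 - a.2| + 1) => x; rewrite /edge_fun normrM.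
  have [->|/step_cases[-> ab ta]] := eqVneq (step a b x.1) 0.
    by rewrite normr0 mul0r !addr_ge0.
  rewrite mul1r; set y := line a b x.1.
  have /andP[c1 c2] := ceil_itv (y - x.2); rewrite intrB in c1.
  have yb : `|y| <= `|a.2| + `|b.2 - a.2|.
    apply: le_trans (ler_normD _ _) _; rewrite lerD2l mulrCA normrM -[X in _ <= X]mulr1 ler_wpM2l //.
    by rewrite normrM normrV ?unitfE ?subr_eq0 1?eq_sym // ler_pdivrMr ?mul1r // normr_gt0 subr_eq0 eq_sym.
  move: yb; rewrite !ler_norml => /andP[? ?]; apply/andP; split; lra.
move=> x k; rewrite /edge_fun /=; congr (_ * _).
have -> : line a b x.1 - (x.2 + k%:~R) = line a b x.1 - x.2 + (- k)%:~R by rewrite intrN; ring.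
by rewrite ceilDi intrD intrN; ring.
Qed.

(** The number of integers in an interval is its length plus the difference
    of the sawtooth at its ends. *)
Lemma per_step a b x : per (fun z => step a b z.1) x = (a.1 - b.1) + (saw a x - saw b x).
Proof.
have -> : (a.1 - b.1) + (saw a x - saw b x) = (Num.ceil (a.1 - x.1) - Num.ceil (b.1 - x.1))%:~R.
  by rewrite intrB /saw; ring.
wlog ab : a b / a.1 <= b.1.
  move=> H; have [/H//|ba] := leP a.1 b.1.
  rewrite -opprB intrN -H ?ltW // -[RHS]mulN1r -perZ; last exact: admissible_step.
  by apply: eq_per => z; rewrite stepN mulN1r.
have E z : step a b z.1 = - ((a.1 <= z.1) && (z.1 < b.1))%R%:R.
  rewrite /step; case: (leP a.1 z.1) => h; case: (ltP z.1 b.1) => k //=; rewrite ?subrr ?oppr0 ?sub0r //.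
  by have := lt_le_trans h (le_trans ab k); rewrite ltxx.
have [[B hB] _ _] := admissible_step a b.
rewrite (per_boxE hB (leqnn _)); set N := (_ + _)%N.
under eq_bigr do rewrite E.
rewrite sumrN -[X in _ = X%:~R]opprB intrN; congr (- _).
have E2 (j : int) : ((a.1 <= x.1 + j%:~R) && (x.1 + j%:~R < b.1)) =
  ((a.1 - x.1 <= j%:~R) && (j%:~R < b.1 - x.1)).
  by rewrite lerBlDl ltrBrDl.
rewrite -(@count_integers _ _ _ (box N)) ?box_uniq //.
- by apply: eq_bigr => j _; rewrite /= E2.
- by rewrite lerD2r.
move=> j h1 h2; apply: (support_box hB); rewrite E /= E2 h1 h2.
by rewrite oppr_eq0 oner_eq0.
Qed.

Lemma saw_periodic p : periodic (saw p).
Proof.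
move=> x m; rewrite /saw /=.
have -> : p.1 - (x.1 + m.1%:~R) = p.1 - x.1 + (- m.1)%:~R by rewrite intrN; ring.
by rewrite ceilDi intrD; ring.
Qed.

Lemma saw_bounded p : sup_bounded (saw p).
Proof.
exists 1 => x; have /andP[] := ceil_itv (p.1 - x.1); rewrite intrB /saw ler_norml => ? ?.
by apply/andP; split; lra.
Qed.

Lemma saw_shift p g : eqBR (saw (p + gpt g)) (saw p).
Proof.
apply: eqBR_sym; apply: eqBR_trans (eqBR_translate g (saw_periodic _) (saw_bounded _)).
apply: eqBR_ext => x; rewrite /saw /=; congr ((Num.ceil _)%:~R - _); ring.
Qed.

(** The constant is the mean of the periodized edge function over the unit
    square: a ceiling minus its argument has mean 1/2. *)
Definition edge_disc a b x : R := per (edge_fun a b) x - (a.1 - b.1) * (a.2 + b.2 + 1) / 2.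

(** Translating the edge by g replaces [edge_fun] by its translate plus the
    vertical displacement times [step]; the translate is equivalent to the
    original, and [per_step] evaluates the rest. *)
Lemma edge_disc_shift a b g :
  eqBR (edge_disc (a + gpt g) (b + gpt g))
       (fun x => edge_disc a b x + (gpt g).2 * (saw a x - saw b x)).
Proof.
have E x : edge_fun (a + gpt g) (b + gpt g) (x + gpt g) = edge_fun a b x + (gpt g).2 * step a b x.1.
  rewrite /edge_fun.
  have -> : step (a + gpt g) (b + gpt g) (x + gpt g).1 = step a b x.1.
    by rewrite /step /= !lerD2r.
  have -> : line (a + gpt g) (b + gpt g) (x + gpt g).1 - (x + gpt g).2 = line a b x.1 - x.2.
    rewrite /line; move: (gpt g) => u /=.
    have -> : x.1 + u.1 - (a.1 + u.1) = x.1 - a.1 by ring.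
    have -> : b.2 + u.2 - (a.2 + u.2) = b.2 - a.2 by ring.
    have -> : b.1 + u.1 - (a.1 + u.1) = b.1 - a.1 by ring.
    by ring.
  by move: (gpt g) => u /=; ring.
have adm := admissible_edge (a + gpt g) (b + gpt g).
have h := eqBR_sym (eqBR_per g adm).
have h2 : eqBR (per (edge_fun (a + gpt g) (b + gpt g)))
    (fun x => per (edge_fun a b) x + (gpt g).2 * ((a.1 - b.1) + (saw a x - saw b x))).
  apply: eqBR_trans h _; apply: eqBR_ext => x; rewrite per_shift (eq_per E).
  have [s1 s2 s3] := admissible_step a b.
  rewrite perD; [|exact: admissible_edge|].
    by rewrite perZ ?per_step //; exact: admissible_step.
  split; first by have [B hB] := s1; exists B => z /hB ->; rewrite mulr0.
    by have [D hD] := s2; exists (`|(gpt g).2| * D) => z; rewrite normrM ler_wpM2l // hD.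
  by [].
apply: bounded_sums_ext h2 => x; by rewrite /edge_disc; move: (gpt g) => u /=; field.
Qed.

Lemma edge_fun_line a b (s r : R) x : a.2 = s * a.1 + r -> b.2 = s * b.1 + r ->
  edge_fun a b x = step a b x.1 * ((Num.ceil (s * x.1 + r - x.2))%:~R + x.2).
Proof.
move=> ea eb; rewrite /edge_fun; have [->|/step_cases[_ ab _]] := eqVneq (step a b x.1) 0.
  by rewrite !mul0r.
have d0 : b.1 - a.1 != 0 by rewrite subr_eq0 eq_sym.
by rewrite /line ea eb; congr (_ * ((Num.ceil (_ - _))%:~R + _)); field.
Qed.

Lemma per_edge_vertical a b x : a.1 = b.1 -> per (edge_fun a b) x = 0.
Proof.
move=> ab; rewrite /per; apply: fsbig1 => j _.
by rewrite /edge_fun step_same ?mul0r.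
Qed.

(** The steps add up, and the affine function is the same for collinear
    edges. *)
Lemma edge_disc_add a b c p v (r1 r2 r3 : R) x :
  a = (p.1 + r1 * v.1, p.2 + r1 * v.2) -> b = (p.1 + r2 * v.1, p.2 + r2 * v.2) ->
  c = (p.1 + r3 * v.1, p.2 + r3 * v.2) ->
  edge_disc a b x + edge_disc b c x = edge_disc a c x.
Proof.
move=> -> -> ->; rewrite /edge_disc.
set a' := (_, _); set b' := (_ + r2 * _, _); set c' := (_ + r3 * _, _).
suff E : per (edge_fun a' b') x + per (edge_fun b' c') x = per (edge_fun a' c') x.
  by rewrite -E /a' /b' /c' /=; field.
have [v0|v0] := eqVneq v.1 0.
  have e1 : a'.1 = b'.1 by rewrite /= v0 !mulr0.
  have e2 : b'.1 = c'.1 by rewrite /= v0 !mulr0.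
  by rewrite (per_edge_vertical _ e1) (per_edge_vertical _ e2) (per_edge_vertical _ (etrans e1 e2)) addr0.
pose s := v.2 / v.1; pose r := p.2 - s * p.1.
have on (t : R) : p.2 + t * v.2 = s * (p.1 + t * v.1) + r by rewrite /r /s; field.
rewrite -perD; [|exact: admissible_edge|exact: admissible_edge].
have ea : a'.2 = s * a'.1 + r := on r1.
have eb : b'.2 = s * b'.1 + r := on r2.
have ec : c'.2 = s * c'.1 + r := on r3.
apply: eq_per => z.
by rewrite (edge_fun_line _ ea eb) (edge_fun_line _ eb ec) (edge_fun_line _ ea ec) -mulrDl stepD.
Qed.

Lemma edge_disc_opp a b x : edge_disc b a x = - edge_disc a b x.
Proof.
have aa : edge_disc a a x = 0.
  by rewrite /edge_disc per_edge_vertical // !subrr !mul0r subrr.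
apply: (addrI (edge_disc a b x)); rewrite subrr -aa.
apply: (@edge_disc_add _ _ _ a (b.1 - a.1, b.2 - a.2) 0 1 0);
  by apply: injective_projections => /=; ring.
Qed.

End Coboundary.

(** * Discrepancy of a pair of opposite edges *)

Section EdgePairs.
Variables (R : realType) (alpha : R * R).
Implicit Types (x y p q a b c m : R * R) (g h : triple).
Notation gpt := (orbit_point alpha).
Notation eqBR := (eqBR alpha).
Notation bounded_sums := (bounded_sums alpha).

(** Both factors change sign when p is reflected to m - p, so that reflected
    vertices have the same term. *)
Definition vertex_term m p x : R := (p.2 - m.2 / 2) * (saw p x - saw (m - p) x).

(** If the midpoints differ by g in G, the edge from m - b to m - a is the
    translate of ab by g, and [edge_disc_shift] applies.  Otherwise the edge
    vector lies in G, and by condition (i) the edge from m - b to m - a is a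
    translate by g0 in G of an edge pq on the line of ab.  Then ab and pq differ
    by the intermediate segments ap and bq, which are translates of each
    other by the edge vector.  The remaining sawtooth terms are moved to the
    vertices with [saw_shift]. *)
Lemma edge_pair_disc a b m : edge_pair_condition alpha a b (m - a) (m - b) ->
  eqBR (fun x => edge_disc a b x + edge_disc (m - a) (m - b) x)
       (fun x => vertex_term m a x - vertex_term m b x).
Proof.
move=> [[x0 [y0 [/segmentP[s _ ex] /segmentP[s' _ ey] /Zalpha_Z2P[g0 eg0]]]] alt].
have [/Zalpha_Z2P[g ge]|ng] := pselect (Zalpha_Z2 alpha (midpoint (m - a) (m - b) - midpoint a b)).
  have wE : m - a - b = gpt g.
    rewrite -ge /midpoint !scale_pairE.
    by apply: injective_projections => /=; field.
  have eb : m - b = a + gpt g by rewrite -wE; apply: injective_projections => /=; ring.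
  have ea : m - a = b + gpt g by rewrite -wE; apply: injective_projections => /=; ring.
  have H1 := edge_disc_shift alpha a b g.
  have A1 := saw_shift alpha b g; have B1 := saw_shift alpha a g.
  rewrite -eb -ea in H1 A1 B1.
  have := bounded_sumsD (bounded_sumsD (bounded_sumsZ (-1) H1) (bounded_sumsZ (a.2 - m.2 / 2) A1))
    (bounded_sumsZ (- (b.2 - m.2 / 2)) B1).
  apply: bounded_sums_ext => x; rewrite (edge_disc_opp (m - b) (m - a)) /vertex_term.
  have g2 : (gpt g).2 = m.2 - a.2 - b.2 by rewrite -wE.
  rewrite g2; move: (edge_disc _ _ _) (edge_disc _ _ _) (saw a x) (saw b x) (saw _ x) (saw _ x) => *.
  by field.
have [/Zalpha_Z2P[gv gvE] _] := alt ng.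
pose r := s + s' - 1; pose v := (b.1 - a.1, b.2 - a.2).
have vE : v = gpt gv by rewrite -gvE; apply: injective_projections.
have wE : m - a - b = gpt g0 + (r * v.1, r * v.2).
  rewrite -eg0 ex ey /r /v; apply: injective_projections => /=; ring.
pose p : R * R := (a.1 + r * v.1, a.2 + r * v.2); pose q : R * R := (b.1 + r * v.1, b.2 + r * v.2).
have eb : m - b = p + gpt g0.
  have -> : m - b = a + (m - a - b) by apply: injective_projections => /=; ring.
  by rewrite wE; apply: injective_projections => /=; ring.
have ea : m - a = q + gpt g0.
  have -> : m - a = b + (m - a - b) by apply: injective_projections => /=; ring.
  by rewrite wE; apply: injective_projections => /=; ring.
have qp : q = p + gpt gv by rewrite -vE; apply: injective_projections => /=; ring.
have ba : b = a + gpt gv by rewrite -vE; apply: injective_projections => /=; ring.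
have ab' : m - a = m - b + gpt gv by rewrite -vE; apply: injective_projections => /=; ring.
have H1 := edge_disc_shift alpha p q g0; rewrite -eb -ea in H1.
have H2 := edge_disc_shift alpha a p gv; rewrite -ba -qp in H2.
have H3 := saw_shift alpha p gv; rewrite -qp in H3.
have H4 := saw_shift alpha a gv; rewrite -ba in H4.
have H5 := saw_shift alpha p g0; rewrite -eb in H5.
have H6 := saw_shift alpha (m - b) gv; rewrite -ab' in H6.
have sumpq x : edge_disc p q x = - edge_disc a p x + edge_disc a b x + edge_disc b q x.
  have pa : a = (a.1 + 0 * v.1, a.2 + 0 * v.2) by rewrite !mul0r !addr0 -surjective_pairing.
  have pb : b = (a.1 + 1 * v.1, a.2 + 1 * v.2).
    by apply: injective_projections => /=; ring.
  have pq : q = (a.1 + (1 + r) * v.1, a.2 + (1 + r) * v.2).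
    by apply: injective_projections => /=; ring.
  have e1 := edge_disc_add x pa (erefl p) pq.
  have e2 := edge_disc_add x pa pb pq.
  by rewrite -addrA e2 -e1 addrA addNr add0r.
have v2E : (gpt gv).2 = b.2 - a.2 by rewrite -vE.
have := bounded_sumsD (bounded_sumsD (bounded_sumsZ (-1) H1) (bounded_sumsZ (-1) H2))
  (bounded_sumsD (bounded_sumsD (bounded_sumsZ ((gpt g0).2) H3)
     (bounded_sumsZ (a.2 - m.2 / 2) (bounded_sumsD H5 H6)))
     (bounded_sumsZ (b.2 - m.2 / 2) (bounded_sumsD H4 (bounded_sumsZ (-1) H5)))).
apply: bounded_sums_ext => x; rewrite (edge_disc_opp (m - b) (m - a)) /vertex_term sumpq v2E.
move: (edge_disc (m - b) _ _) (edge_disc a b _) (edge_disc a p x) (edge_disc b q x) (saw a x) (saw b x) (saw p x) (saw q x) (saw (m - a) x) (saw (m - b) x) => *.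
by field.
Qed.

(** Every edge is counted twice when the sum is written over pairs. *)
Lemma sum_edges_bounded (V : seq (R * R)) m :
  (forall a b, (a, b) \in hull_edges V -> (m - a, m - b) \in hull_edges V) ->
  (forall a b, (a, b) \in hull_edges V -> edge_pair_condition alpha a b (m - a) (m - b)) ->
  bounded_sums (fun x => \sum_(e <- hull_edges V) edge_disc e.1 e.2 x).
Proof.
move=> hm hc.
have star x : \sum_(e <- hull_edges V) edge_disc (m - e.1) (m - e.2) x =
    \sum_(e <- hull_edges V) edge_disc e.1 e.2 x.
  pose f (e : (R * R) * (R * R)) := (m - e.1, m - e.2).
  have fK : involutive f by move=> [u w]; rewrite /f /= !subKr.
  have fin e : e \in hull_edges V -> f e \in hull_edges V by case: e => u w; exact: hm.
  rewrite -(big_map f xpredT (fun e => edge_disc e.1 e.2 x)); apply: perm_big.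
  apply: uniq_perm; rewrite ?(map_inj_uniq (inv_inj fK)) ?hull_edges_uniq // => e.
  by apply/mapP/idP => [[e' e'E ->]|eE]; [exact: fin|exists (f e); rewrite ?fin ?fK].
have h : eqBR (fun x => \sum_(e <- hull_edges V) (edge_disc e.1 e.2 x + edge_disc (m - e.1) (m - e.2) x))
    (fun x => \sum_(e <- hull_edges V) (vertex_term m e.1 x - vertex_term m e.2 x)).
  by apply: eqBR_sum => -[a b] abE; exact: edge_pair_disc (hc a b abE).
have := bounded_sumsZ 2^-1 h; apply: bounded_sums_ext => x.
have -> : \sum_(e <- hull_edges V) (edge_disc e.1 e.2 x + edge_disc (m - e.1) (m - e.2) x) =
  \sum_(e <- hull_edges V) edge_disc e.1 e.2 x + \sum_(e <- hull_edges V) edge_disc e.1 e.2 x.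
  by rewrite -[X in _ = _ + X]star -big_split.
have -> : \sum_(e <- hull_edges V) (vertex_term m e.1 x - vertex_term m e.2 x) = 0.
  have := edge_sum_telescope V (fun p => vertex_term m p x).
  rewrite !sumrB => e; apply/eqP; rewrite subr_eq0 eq_sym -subr_eq0; exact/eqP.
by field.
Qed.

End EdgePairs.

(** * Area under an edge *)

Section LineIntegral.
Variable R : realType.
Implicit Types (a b : R * R).
Notation mu := (@lebesgue_measure R).

Lemma affine_continuous (s r : R) : continuous (fun t : R => s * t + r).
Proof.
move=> t; apply: cvgD; last exact: cvg_cst.
by apply: cvgM; [exact: cvg_cst|exact: cvg_id].
Qed.

Lemma affine_integral (s r p q : R) : p < q ->
  (\int[mu]_(t in `[p, q]) (s * t + r)%:E)%E = ((q - p) * (s * (p + q) / 2 + r))%:E.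
Proof.
move=> pq; pose F (t : R) := s / 2 * (t * t) + r * t.
have dF (t : R) : is_derive t 1 F (s * t + r).
  by apply: is_derive_eq; rewrite /GRing.scale /=; field.
have cF : continuous F.
  by move=> u; apply: differentiable_continuous; apply/derivable1_diffP; case: (dF u).
rewrite (@continuous_FTC2 _ _ F) //.
- by rewrite -EFinB; congr (_%:E); rewrite /F; field.
- by apply: continuous_in_subspaceT => t _; exact: affine_continuous.
- split.
  + by move=> t _; case: (dF t).
  + by apply: cvg_at_right_filter; exact: cF.
  + by apply: cvg_at_left_filter; exact: cF.
- by move=> t _; rewrite derive1E; case: (dF t).
Qed.

Lemma line_affine a b (t : R) : line a b t =
  (b.2 - a.2) / (b.1 - a.1) * t + (a.2 - a.1 * ((b.2 - a.2) / (b.1 - a.1))).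
Proof. by rewrite /line; ring. Qed.

(** The strip under an edge that runs to the right; for other edges the interval
    is empty or a point. *)
Definition strip_fun a b : R -> R := line a b \_ `[a.1, b.1].

Lemma strip_integrable a b : mu.-integrable setT (EFin \o strip_fun a b).
Proof.
rewrite /strip_fun -restrict_EFin; apply: (iffLR (integrable_mkcond _ _)) => //.
apply: continuous_compact_integrable; first exact: segment_compact.
apply: continuous_in_subspaceT => t _.
rewrite (_ : line a b = fun t => (b.2 - a.2) / (b.1 - a.1) * t + (a.2 - a.1 * ((b.2 - a.2) / (b.1 - a.1)))).
  exact: affine_continuous.
by apply/funext => u; exact: line_affine.
Qed.

Lemma strip_integral a b : a.1 < b.1 ->
  (\int[mu]_t (strip_fun a b t)%:E)%E = ((b.1 - a.1) * (a.2 + b.2) / 2)%:E.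
Proof.
move=> ab; transitivity (\int[mu]_(t in `[a.1, b.1]) (line a b t)%:E)%E.
  by rewrite [RHS]integral_mkcond; apply: eq_integral => t _; rewrite restrict_EFin.
under eq_integral do rewrite line_affine.
rewrite affine_integral //; congr (_%:E).
by field; rewrite subr_eq0 gt_eqF.
Qed.

Definition edge_strip a b : R -> R := fun t =>
  (b.1 < a.1)%R%:R * strip_fun b a t - (a.1 < b.1)%R%:R * strip_fun a b t.

Lemma line_sym a b t : a.1 != b.1 -> line b a t = line a b t.
Proof.
move=> ab; have d0 : b.1 - a.1 != 0 by rewrite subr_eq0 eq_sym.
have d1 : a.1 - b.1 != 0 by rewrite subr_eq0.
by rewrite /line; field; rewrite d0 d1.
Qed.

Lemma edge_stripE a b t : t != a.1 -> t != b.1 -> step a b t * line a b t = edge_strip a b t.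
Proof.
move=> ta tb; rewrite /edge_strip /strip_fun /step !patchE !mem_setE !in_itv /=.
rewrite ![_ <= t]le_eqVlt ![t <= _]le_eqVlt (negbTE ta) (negbTE tb).
rewrite ![_ == t]eq_sym (negbTE ta) (negbTE tb) /=.
have [ab|ab|ab] := ltgtP a.1 b.1.
- rewrite mul0r mul1r sub0r; have [bt|tb'] := ltP b.1 t.
    have -> : a.1 < t by lra.
    by rewrite subrr mul0r andbC ltNge (ltW bt) /= oppr0.
  have -> : t < b.1 by rewrite lt_neqAle tb tb'.
  by rewrite andbT sub0r; case: (a.1 < t); rewrite ?mulN1r ?oppr0 ?mul0r.
- rewrite mul0r mul1r subr0; have [at_|ta'] := ltP a.1 t.
    have -> : b.1 < t by lra.
    by rewrite subrr mul0r andbC ltNge (ltW at_).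
  have -> : t < a.1 by rewrite lt_neqAle ta ta'.
  rewrite andbT subr0; case: (b.1 < t); rewrite ?mul1r ?mul0r //.
  by rewrite line_sym // lt_eqF.
- by rewrite ab subrr !mul0r subrr.
Qed.

Lemma edge_strip_integrable a b : mu.-integrable setT (EFin \o edge_strip a b).
Proof.
have -> : EFin \o edge_strip a b = (fun t => ((b.1 < a.1)%R%:R%:E * (EFin \o strip_fun b a) t -
   (a.1 < b.1)%R%:R%:E * (EFin \o strip_fun a b) t)%E).
  by apply/funext => t; rewrite /= -!EFinM -EFinB.
by apply: integrableB => //; apply: integrableZl => //; exact: strip_integrable.
Qed.

Lemma edge_strip_integral a b :
  (\int[mu]_t (edge_strip a b t)%:E)%E = ((a.1 - b.1) * (a.2 + b.2) / 2)%:E.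
Proof.
have -> : (\int[mu]_t (edge_strip a b t)%:E)%E = (\int[mu]_t (((b.1 < a.1)%R%:R%:E * (EFin \o strip_fun b a) t -
   (a.1 < b.1)%R%:R%:E * (EFin \o strip_fun a b) t)%E))%E.
  by apply: eq_integral => t _; rewrite /= -!EFinM -EFinB.
rewrite integralB //; try by apply: integrableZl => //; exact: strip_integrable.
rewrite !integralZl //; try exact: strip_integrable.
rewrite /=; have [ab|ab|ab] := ltgtP a.1 b.1.
- by rewrite mul0e mul1e strip_integral // sub0e -EFinN; congr (_%:E); field.
- by rewrite mul0e mul1e strip_integral // sube0; congr (_%:E); field.
- by rewrite !mul0e sube0 ab subrr !mul0r.
Qed.

End LineIntegral.

(** * Vertical slices of a polygon *)

Section Slices.
Variable R : realType.
Variables (S : set (R * R)) (V : seq (R * R)).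
Hypothesis SV : polygon_hull S V.
Implicit Types (x y p q a b c d : R * R).
Notation edge_t := ((R * R) * (R * R))%type.
Notation lam := (@lebesgue_measure R).

Let nc : noncollinear V. Proof. by case: SV. Qed.
Let VS r : r \in V -> S r. Proof. by case: SV => _ + _ _; apply. Qed.
Let SE x : S x <-> forall a b, (a, b) \in hull_edges V -> 0 <= orient a b x.
Proof. by case: SV => _ _ _; apply. Qed.
Let half w t : (forall r, r \in V -> height w r <= t) -> forall y, S y -> height w y <= t.
Proof. by case: SV => _ _ + _; apply. Qed.

Lemma orient_line a b (t y : R) : a.1 != b.1 -> orient a b (t, y) = (b.1 - a.1) * (y - line a b t).
Proof.
move=> ab; have d0 : b.1 - a.1 != 0 by rewrite subr_eq0 eq_sym.
by rewrite /orient /line /=; field.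
Qed.

Lemma edge_point_in a b (t : R) : (a, b) \in hull_edges V -> a.1 != b.1 ->
  0 <= (t - a.1) / (b.1 - a.1) <= 1 -> S (t, line a b t).
Proof.
move=> abE ab h; have d0 : b.1 - a.1 != 0 by rewrite subr_eq0 eq_sym.
have : segment a b (t, line a b t).
  apply/segmentP; exists ((t - a.1) / (b.1 - a.1)) => //.
  by congr (_, _); rewrite /line; field.
by rewrite -(hull_edge_face SV abE) => -[].
Qed.

(** A vertical line through no vertex misses the polygon, or crosses exactly
    one edge of the lower boundary and one of the upper boundary. *)
Lemma slice_description (t : R) : (forall r, r \in V -> r.1 != t) ->
  ((forall y : R, ~ S (t, y)) /\ forall e, e \in hull_edges V -> step e.1 e.2 t = 0) \/
  exists lo up : edge_t, [/\ lo \in hull_edges V, up \in hull_edges V,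
    line lo.1 lo.2 t <= line up.1 up.2 t /\ up.1.1 != up.2.1,
    forall y : R, S (t, y) <-> line lo.1 lo.2 t <= y <= line up.1 up.2 t &
    forall F : edge_t -> R, \sum_(e <- hull_edges V) step e.1 e.2 t * F e = F up - F lo].
Proof.
move=> gen; pose w : R * R := (1, 0).
have wE r : height w r = r.1 by rewrite /height /=; ring.
have [r0 r0V] : exists r, r \in V.
  have [|r rV _] := @nc (0, 0) (1, 0); last by exists r.
  by apply/eqP => -[/eqP]; rewrite eq_sym oner_eq0.
have [/hasP[p pV pt]|/hasPn nlo] := boolP (has (fun r => r.1 < t) V); last first.
  have gt r : r \in V -> t < r.1.
    by move=> rV; rewrite lt_neqAle eq_sym gen //= leNgt; exact: nlo.
  left; split=> [y Sy|[a b] abE].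
    have [r rV rmin] := seq_min (fun r => r.1) r0V.
    have w'E u : height (-1, 0) u = - u.1 by rewrite /height /=; ring.
    have k u : u \in V -> height (-1, 0) u <= - r.1 by move=> uV; rewrite w'E lerN2 rmin.
    by have := half k Sy; rewrite w'E lerN2 leNgt /= (gt r rV).
  have /hull_edgesP[aV bV _ _ _] := abE.
  by rewrite /step /= !leNgt !gt // subrr.
have [/hasP[q qV qt]|/hasPn nhi] := boolP (has (fun r => t < r.1) V); last first.
  have lt r : r \in V -> r.1 < t.
    by move=> rV; rewrite lt_neqAle gen //= leNgt; exact: nhi.
  left; split=> [y Sy|[a b] abE].
    have [r rV rmin] := seq_min (fun r => - r.1) r0V.
    have k u : u \in V -> height w u <= r.1 by move=> uV; rewrite wE -lerN2 rmin.
    by have := half k Sy; rewrite wE leNgt /= (lt r rV).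
  have /hull_edgesP[aV bV _ _ _] := abE.
  by rewrite /step /= !ltW ?lt // subrr.
have genw r : r \in V -> height w r != t by move=> rV; rewrite wE gen.
have [||a [b [abE]]] := @slice_edge _ V w t genw; [by exists p; rewrite ?wE|by exists q; rewrite ?wE|].
rewrite !wE => at_ tb.
have [||c [d [cdE]]] := @slice_edge_down _ V w t genw; [by exists p; rewrite ?wE|by exists q; rewrite ?wE|].
rewrite !wE => tc dt.
have ab1 : a.1 != b.1 by rewrite lt_eqF //; exact: lt_trans tb.
have cd1 : c.1 != d.1 by rewrite gt_eqF //; exact: lt_trans tc.
have Slo : S (t, line a b t).
  apply: edge_point_in => //; have h : 0 < b.1 - a.1 by rewrite subr_gt0; exact: lt_trans tb.
  apply/andP; split; first by apply: divr_ge0; [rewrite subr_ge0 ltW|exact: ltW].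
  by rewrite ler_pdivrMr // mul1r lerD2r ltW.
have Sup : S (t, line c d t).
  rewrite (line_sym t (_ : d.1 != c.1)) 1?eq_sym //.
  have : segment c d (t, line d c t).
    apply/segmentP; exists (1 - (t - d.1) / (c.1 - d.1)).
      have h : 0 < c.1 - d.1 by rewrite subr_gt0; exact: lt_trans tc.
      rewrite subr_ge0 ler_pdivrMr // mul1r lerD2r (ltW tc) /= gerBl.
      by apply: divr_ge0; [rewrite subr_ge0 ltW|exact: ltW].
    have d0 : c.1 - d.1 != 0 by rewrite subr_eq0.
    by congr (_, _); rewrite /line; field.
  by rewrite -(hull_edge_face SV cdE) => -[].
right; exists (a, b), (c, d); split => //=.
- split=> //; have /SE/(_ _ _ cdE) := Slo; rewrite orient_line // nmulr_rge0 ?subr_lt0; last exact: lt_trans tc.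
  by rewrite subr_le0.
- move=> y; split=> [Sy|/andP[y1 y2]].
    have /SE/(_ _ _ cdE) := Sy; have /SE/(_ _ _ abE) := Sy.
    rewrite !orient_line // pmulr_rge0 ?subr_gt0; last exact: lt_trans tb.
    rewrite nmulr_rge0 ?subr_lt0; last exact: lt_trans tc.
    by rewrite subr_ge0 subr_le0 => -> ->.
  apply/SE => u v uvE.
  have oy (z : R) : orient u v (t, y) = orient u v (t, z) + (v.1 - u.1) * (y - z).
    by rewrite /orient /=; ring.
  have /SE/(_ _ _ uvE) l0 := Slo; have /SE/(_ _ _ uvE) u0 := Sup.
  have [vu|vu] := leP 0 (v.1 - u.1).
    by rewrite (oy (line a b t)) addr_ge0 // mulr_ge0 // subr_ge0.
  by rewrite (oy (line c d t)) addr_ge0 // nmulr_rge0 // subr_le0.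
move=> F; have stepE e : e \in hull_edges V -> step e.1 e.2 t = (e == (c, d))%:R - (e == (a, b))%:R.
  case: e => u v uvE; have /hull_edgesP[uV vV _ _ _] := uvE.
  have gu := gen u uV; have gv := gen v vV.
  rewrite /step /= ![_ <= t]le_eqVlt (negbTE gu) (negbTE gv) /=.
  have loE : (u.1 < t) && (t < v.1) -> (u, v) = (a, b).
    move=> /andP[h1 h2]; apply: (@slice_edge_unique _ V w t) => //; by rewrite wE.
  have upE : (v.1 < t) && (t < u.1) -> (u, v) = (c, d).
    move=> /andP[h1 h2]; apply: (@slice_edge_unique _ V (- w.1, - w.2) (- t)) => //; by rewrite heightN wE ltrN2.
  have abn : ((a, b) == (c, d)) = false by apply/eqP => -[e1 _]; move: tc; rewrite -e1 ltNge (ltW at_).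
  have [h1|h1] := ltP u.1 t; have [h2|h2] := ltP v.1 t.
  - have -> : ((u, v) == (c, d)) = false.
      by apply/eqP => -[e1 _]; move: tc; rewrite -e1 ltNge (ltW h1).
    have -> // : ((u, v) == (a, b)) = false.
      by apply/eqP => -[_ e1]; move: tb; rewrite -e1 ltNge (ltW h2).
    by rewrite !subrr.
  - have k : (u.1 < t) && (t < v.1) by rewrite h1 lt_neqAle eq_sym gv h2.
    by rewrite (loE k) abn eqxx.
  - have k : (v.1 < t) && (t < u.1) by rewrite h2 lt_neqAle eq_sym gu h1.
    by rewrite (upE k) [(c, d) == (a, b)]eq_sym abn eqxx.
  - have -> : ((u, v) == (c, d)) = false.
      by apply/eqP => -[_ e1]; move: dt; rewrite -e1 ltNge h2.
    have -> // : ((u, v) == (a, b)) = false.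
      by apply/eqP => -[e1 _]; move: at_; rewrite -e1 ltNge h1.
have one e0 : e0 \in hull_edges V -> \sum_(e <- hull_edges V) (e == e0)%:R * F e = F e0.
  move=> e0E; rewrite (bigD1_seq e0) ?hull_edges_uniq //= eqxx mul1r big1 ?addr0 //.
  by move=> e /negbTE ->; rewrite mul0r.
rewrite -(one _ cdE) -(one _ abE) -sumrB; apply: eq_big_seq => e eE.
by rewrite stepE // mulrBl.
Qed.

Variable alpha : R * R.
Implicit Types (g : triple).
Notation gpt := (orbit_point alpha).
Notation mR := (measurableTypeR R).

(** * Sufficiency of the conditions *)

Definition vertical_generic x := forall g r, r \in V -> (x + gpt g).1 != r.1.

Lemma ae_vertical_generic : {ae @mes2 R, forall x, vertical_generic x}.
Proof.
pose Q (t : triple * nat) x := (t.2 < size V)%N -> (x + gpt t.1).1 != (nth (0, 0) V t.2).1.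
have h : {ae @mes2 R, forall x, forall t, Q t x}.
  apply: ae_countable => -[g i].
  have n0 : (1, 0) != (0, 0) :> R * R by apply/eqP => -[/eqP]; rewrite oner_eq0.
  apply: negligibleS (line_negligible ((nth (0, 0) V i).1 - (gpt g).1) n0) => x /= nx.
  have /eqP : (x + gpt g).1 == (nth (0, 0) V i).1.
    by apply: contrapT => k; apply: nx => _; apply/negP.
  by move=> /= <-; ring.
apply: negligibleS h => x nx hx; apply: nx => g r rV.
have := hx (g, index r V); rewrite /Q /= index_mem nth_index // => /(_ rV).
by [].
Qed.

(** On each vertical line in the periodization, the integers between the lower
    and the upper edge are counted by a difference of ceilings.  Genericity
    keeps integer points off the upper edge, where the half-open count would
    differ. *)
Lemma chi_edge_funs x : generic alpha V x -> vertical_generic x ->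
  chi S x = \sum_(e <- hull_edges V) per (edge_fun e.1 e.2) x.
Proof.
move=> gx vx; have [B SB] := polygon_bounded SV.
pose N := (((Num.truncn `|x.1|).+1 + (B + B)) + ((Num.truncn `|x.2|).+1 + B))%N.
have Sbox m : S (x + Z2 m) -> m \in box2 N.
  move=> /SB[/= h1 h2]; rewrite mem_box2 -!mem_box.
  by rewrite (box_bound (lexx _) _ h1) ?(box_bound (lexx _) _ h2) // /N; lia.
rewrite (chi_box Sbox) big_allpairs.
have perE e : e \in hull_edges V -> per (edge_fun e.1 e.2) x =
    \sum_(j <- box N) edge_fun e.1 e.2 (x.1 + j%:~R, x.2).
  case: e => a b /hull_edgesP[aV bV _ _ _].
  apply: (@per_boxE _ _ (B + B)) => [z hz|]; last by rewrite /N; lia.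
  rewrite /edge_fun step_out ?mul0r //; apply: le_lt_trans hz; rewrite natrD.
  by apply: lerD; [case: (SB _ (VS aV))|case: (SB _ (VS bV))].
rewrite [RHS](eq_big_seq _ perE) [RHS]exchange_big /=; apply: eq_bigr => j _.
set t := x.1 + j%:~R.
have gen r : r \in V -> r.1 != t.
  move=> rV; have := vx (0, (j, 0)) r rV; rewrite eq_sym gpt0E.
  by [].
have Sij i : x + Z2 (j, i) = (t, x.2 + i%:~R) by [].
have [[out st0]|[lo [up [loE upE [lu up1] Sst sumE]]]] := slice_description gen.
  rewrite [RHS]big_seq [RHS]big1; last first.
    by move=> e eE; rewrite /edge_fun /= st0 // mul0r.
  by rewrite big1 // => i _; rewrite indicE memNset // Sij; exact: out.
rewrite (sumE (fun e => (Num.ceil (line e.1 e.2 t - x.2))%:~R + x.2)).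
set l := line lo.1 lo.2 t; set u := line up.1 up.2 t.
have uN (i : int) : x.2 + i%:~R != u.
  apply/eqP => e; have := gx (0, (j, i)) up upE.
  by rewrite gpt0E Sij orient_line // e subrr mulr0 eqxx.
have E (i : int) : (S (t, x.2 + i%:~R)) <-> (l - x.2 <= i%:~R) && (i%:~R < u - x.2).
  rewrite Sst -/l -/u lerBlDl ltrBrDl.
  by split=> /andP[h1 h2]; rewrite h1 /= ?(ltW h2) // lt_neqAle uN h2.
transitivity ((Num.ceil (u - x.2) - Num.ceil (l - x.2))%:~R : R); last by rewrite intrB; ring.
rewrite -(@count_integers _ _ _ (box N)) ?box_uniq //.
- apply: eq_bigr => i _; rewrite indicE; congr (_%:R); congr nat_of_bool.
  by apply/idP/idP; rewrite inE Sij => /E.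
- by rewrite lerD2r.
move=> i h1 h2; have /E : (l - x.2 <= i%:~R) && (i%:~R < u - x.2) by rewrite h1 h2.
by rewrite -Sij => /Sbox; rewrite mem_box2 mem_box => /andP[].
Qed.

Lemma polygon_measurable : measurable (S : set (mR * mR)).
Proof.
have -> : S = \bigcap_(e in [set` hull_edges V]) [set x | 0 <= orient e.1 e.2 x].
  apply/seteqP; split=> x; first by move=> /SE h [a b] /= abE; exact: h.
  by move=> h; apply/SE => a b abE; exact: (h (a, b)).
apply: fin_bigcap_measurable => [|e _]; first exact: finite_seq.
pose c0 := (e.2.1 - e.1.1) * e.1.2 - (e.2.2 - e.1.2) * e.1.1.
have -> : [set x : mR * mR | 0 <= orient e.1 e.2 x] =
   [set x | True] `&` (fun x : mR * mR => - (e.2.2 - e.1.2) * x.1 + (e.2.1 - e.1.1) * x.2) @^-1` [set` `[c0, +oo[].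
  apply/seteqP; split=> x /=.
    by rewrite in_itv /= andbT /orient /c0 => h; split => //; lra.
  by rewrite in_itv /= andbT /orient /c0 => -[_ h]; lra.
by apply: measurable_affine => //; exact: measurable_itv.
Qed.

(** Integrating the lengths of the vertical slices gives the shoelace
    formula. *)
Lemma polygon_area : mes2 S = (\sum_(e <- hull_edges V) (e.1.1 - e.2.1) * (e.1.2 + e.2.2) / 2)%:E.
Proof.
apply: (eq_trans (mes2_sections _)).
have mS := polygon_measurable.
pose L t := \sum_(e <- hull_edges V) edge_strip e.1 e.2 t.
have LE : EFin \o L = (fun t => (\sum_(e <- hull_edges V) (EFin \o edge_strip e.1 e.2) t)%E).
  by apply/funext => t; rewrite /= sumEFin.
have intL : lam.-integrable setT (EFin \o L).
  by rewrite LE; apply: integrable_sum => // e _; exact: edge_strip_integrable.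
transitivity (\int[lam]_t (EFin \o L) t)%E.
  apply: ae_eq_integral => //; first exact: measurable_fun_xsection.
    by case/integrableP: intL.
  apply: negligibleS (_ : lam.-negligible [set` [seq r.1 | r <- V]]).
    move=> t nt; apply: contrapT => tV; apply: nt => _ /=.
    have gen r : r \in V -> r.1 != t.
      by move=> rV; apply/eqP => e; apply: tV; rewrite /= -e; apply/mapP; exists r.
    have LtE : L t = \sum_(e <- hull_edges V) step e.1 e.2 t * line e.1 e.2 t.
      apply: eq_big_seq => -[a b] /hull_edgesP[aV bV _ _ _].
      by rewrite -edge_stripE // eq_sym gen.
    have [[out st0]|[lo [up [loE upE [lu up1] Sst sumE]]]] := slice_description gen.
      rewrite LtE big_seq big1 => [|e eE]; last by rewrite st0 ?mul0r.
      rewrite (_ : xsection S t = set0) ?measure0 //.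
      by apply/seteqP; split => // y; rewrite /xsection /= inE => /out.
    rewrite LtE (sumE (fun e => line e.1 e.2 t)).
    rewrite (_ : xsection S t = [set` `[line lo.1 lo.2 t, line up.1 up.2 t]]).
      rewrite lebesgue_measure_itv /= lte_fin; case: ltP => h.
        by rewrite EFinB.
      by rewrite (_ : line up.1 up.2 t = line lo.1 lo.2 t) ?subrr //; apply/eqP; rewrite eq_le lu h.
    by apply/seteqP; split => y; rewrite /xsection /= inE in_itv /= => /Sst.
  have ct : countable [set` [seq r.1 | r <- V]].
    by apply: finite_set_countable; exact: finite_seq.
  apply/negligibleP; last exact: countable_lebesgue_measure0.
  by apply: countable_measurable => // t; exact: measurable_set1.
rewrite LE integral_sum //; last by move=> e; exact: edge_strip_integrable.
rewrite -sumEFin; apply: eq_bigr => e _.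
by rewrite -edge_strip_integral.
Qed.

Lemma polygon_bounded_set : bounded_set S.
Proof.
have [B SB] := polygon_bounded SV.
exists B%:R; split; first exact: num_real.
move=> M BM x /SB[h1 h2]; rewrite /Num.norm /= ge_max.
by rewrite (le_trans h1 (ltW BM)) (le_trans h2 (ltW BM)).
Qed.

(** Outside a null set the discrepancy of S is the sum of those of the edges:
    the constants in [edge_disc] add up to the area, since the extra 1/2 in
    each cancels around the boundary. *)
Lemma edges_bounded_remainder m :
  (forall a b, (a, b) \in hull_edges V -> (m - a, m - b) \in hull_edges V) ->
  (forall a b, (a, b) \in hull_edges V -> edge_pair_condition alpha a b (m - a) (m - b)) ->
  bounded_remainder_set alpha S.
Proof.
move=> hm hc; have [C hC] := sum_edges_bounded hm hc.
split; [exact: polygon_bounded_set|exact: polygon_measurable|].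
exists C => n n0.
have ae2 : {ae @mes2 R, forall x, forall b : bool, if b then generic alpha V x else vertical_generic x}.
  by apply: ae_countable => -[]; [exact: ae_generic|exact: ae_vertical_generic].
apply: negligibleS ae2 => x nx hx; apply: nx => _.
have gx := hx true; have vx := hx false.
have := hC n x; rewrite polygon_area /=.
suff -> : \sum_(k < n) \sum_(e <- hull_edges V) edge_disc e.1 e.2 (x + gpt (k%:Z, 0)) =
   \sum_(k < n) chi S (x + alpha *+ k) - n%:R * \sum_(e <- hull_edges V) (e.1.1 - e.2.1) * (e.1.2 + e.2.2) / 2 by [].
have sumE : \sum_(e <- hull_edges V) (e.1.1 - e.2.1) * (e.1.2 + e.2.2 + 1) / 2 =
    \sum_(e <- hull_edges V) (e.1.1 - e.2.1) * (e.1.2 + e.2.2) / 2.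
  apply/eqP; rewrite -subr_eq0 -sumrB; apply/eqP.
  transitivity (\sum_(e <- hull_edges V) ((fun p => - p.1 / 2) e.2 - (fun p : R * R => - p.1 / 2) e.1)).
    by apply: eq_bigr => e _; ring.
  exact: (edge_sum_telescope V (fun p => - p.1 / 2)).
rewrite -sumE mulr_natl -[n in _ *+ n]card_ord -sumr_const -sumrB; apply: eq_bigr => k _.
have -> : x + alpha *+ k = x + gpt (k%:Z, 0).
  by rewrite gptE -pmulrn; congr (_ + _); rewrite (_ : Z2 (0, 0) = 0) ?addr0.
rewrite chi_edge_funs ?sumrB //; first exact: generic_shift.
by move=> g r rV; rewrite -addrA -gptD; exact: vx.
Qed.

End Slices.

(** * The characterization *)

Section Reflection.
Variables (R : realType) (S : set (R * R)) (m : R * R).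
Implicit Types (a b x : R * R).
Hypothesis sym : forall x, S x -> S (m - x).

Lemma segment_reflect a b x : segment a b x -> segment (m - a) (m - b) (m - x).
Proof.
move=> /segmentP[t t01 ->]; apply/segmentP; exists t => //.
by apply: injective_projections => /=; ring.
Qed.

Lemma reflectK x : m - (m - x) = x.
Proof. by rewrite opprB addrC subrK. Qed.

Lemma edge_reflect a b : edge S a b -> edge S (m - a) (m - b).
Proof.
have dotB u x : dot u (m - x) = dot u m - dot u x by rewrite /dot /=; ring.
have face_reflect u x : face S u x -> face S (- u) (m - x).
  move=> [Sx hx]; split=> [|y Sy]; first exact: sym.
  have := hx _ (sym Sy).
  have dotN z : dot (- u) z = - dot u z by rewrite /dot /=; ring.
  by rewrite !dotN !dotB; lra.
move=> [ab [u u0 fu]]; split; first by rewrite (inj_eq (addrI m)) eqr_opp.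
exists (- u); first by rewrite oppr_eq0.
apply/seteqP; split=> x.
  move/face_reflect; rewrite opprK fu => /segment_reflect.
  by rewrite reflectK.
by move/segment_reflect; rewrite !reflectK -fu => /face_reflect; rewrite reflectK.
Qed.

(** The reflection maps faces to faces; it preserves orientation, which
    excludes the reversed edge. *)
Lemma hull_edge_reflect V a b : polygon_hull S V ->
  (a, b) \in hull_edges V -> (m - a, m - b) \in hull_edges V.
Proof.
move=> SV abE; have [//|ba] := edge_hull_edge SV (edge_reflect (hull_edge_edge SV abE)).
have [nc VS _ SE] := SV.
have /hull_edgesP[_ _ ab _ _] := abE.
have [r rV /eqP[]] := nc a b ab.
have /SE Sr := VS _ rV; have /SE/(_ _ _ ba) := sym (VS _ rV).
have := Sr _ _ abE.
have -> : orient (m - b) (m - a) (m - r) = - orient a b r by rewrite /orient /=; ring.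
by rewrite oppr_ge0 => h1 h2; apply/eqP; rewrite eq_le h1 h2.
Qed.

End Reflection.

Theorem theorem3 (R : realType) (alpha : R * R) (S : set (R * R))
    (halpha : irrational_vector alpha) (hS : convex_polygon S) :
  bounded_remainder_set alpha S <->
  centrally_symmetric S /\
  (forall a b a' b' : R * R,
     edge S a b -> edge S a' b' ->
     segment a b <> segment a' b' ->
     parallel (b - a) (b' - a') ->
     (exists x y : R * R,
        [/\ segment a b x, segment a' b' y & Zalpha_Z2 alpha (y - x)]) /\
     (~ Zalpha_Z2 alpha (midpoint a' b' - midpoint a b) ->
      Zalpha_Z2 alpha (b - a) /\ Zalpha_Z2 alpha (b' - a'))).
Proof.
have [V SV] := convex_polygon_hull hS.
split=> [|[[c hc] hE]]; first exact: (bounded_remainder_edges halpha SV).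
pose m := c *+ 2.
have hm a b : (a, b) \in hull_edges V -> (m - a, m - b) \in hull_edges V.
  exact: (hull_edge_reflect hc SV).
apply: (edges_bounded_remainder SV hm) => a b abE.
apply: hE; [exact: (hull_edge_edge SV abE)|exact: (hull_edge_edge SV (hm _ _ abE))| |].
  move=> e; have /hull_edgesP[_ _ ab ge _] := abE.
  have [nc _ _ _] := SV; have [r rV /eqP[]] := nc a b ab.
(* if the edge were its own reflection, all of S would lie on its line *)
  have : segment a b (m - a).
    by rewrite e; apply/segmentP; exists 0; rewrite ?lexx ?ler01 // !mul0r !addr0 -surjective_pairing.
  move=> /segmentP[t _ ma].
  have /hull_edgesP[_ _ _ /(_ _ rV) + _] := hm _ _ abE.
  have -> : orient (m - a) (m - b) r = - orient a b r.
    have -> : orient (m - a) (m - b) r = - orient a b r + orient a b (m - a).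
      by rewrite /orient /=; ring.
    by rewrite ma [X in _ + X](_ : _ = 0) ?addr0 // /orient /=; ring.
  rewrite oppr_ge0 => h.
  by apply/eqP; rewrite eq_le h ge.
exists (-1); first by rewrite oppr_eq0 oner_eq0.
by rewrite scaleN1r; apply: injective_projections => /=; ring.
Qed.
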